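(* Let $p$ be an odd prime and let $G$ be a GGS-group of FG-type defined over the $p$-adic tree. Then the profinite completion of $G$ is a pro-$p$ group of lower central width $2$.
   Context: $p$ is an odd prime and $\sigma=(1\ 2\ \ldots\ p)$. The $p$-adic tree $\mathcal T$ has as vertices the words over $X=\{1,\dots,p\}$, with $v$ joined to $vx$ ($x\in X$). $\mathrm{Aut}(\mathcal T)$ acts on the right; $fg$ means first $f$, then $g$. The section $f|_x$ ($x\in X$) is defined by $(xv)f=(xf)\,(v\,f|_x)$, and $\psi:\mathrm{Aut}(\mathcal T)\to \mathrm{Aut}(\mathcal T)\wr \mathrm{Sym}(p)$, $f\mapsto (f|_1,\dots,f|_p)\,\sigma(f)$, where $\sigma(f)$ is the permutation induced by $f$ on the first level, is a group isomorphism. Let $a$ be defined by $\psi(a)=(1,\dots,1)\sigma$ (of order $p$). For a non-zero vector $\mathbf e=(e_1,\dots,e_{p-1})\in\mathbb F_p^{p-1}$, let $b$ be the automorphism fixing the first level and defined recursively by $\psi(b)=(a^{e_1},\dots,a^{e_{p-1}},b)$. The GGS-group with defining vector $\mathbf e$ is $G=\langle a,b\rangle$. Put $\varepsilon=\sum_{i=1}^{p-1}e_i$ and $\delta=\sum_{i=1}^{p-1}ie_i$ in $\mathbb F_p$; $G$ is of FG-type if $\varepsilon\ne0$ and $\delta\ne 0$. For a profinite group $P$, $\gamma_i(P)$ denotes the closed subgroup generated by all $i$-fold commutators of elements of $P$. For a pro-$p$ group $P$ whose indices $|\gamma_i(P):\gamma_{i+1}(P)|$ are bounded, the lower central width is $\max_{i\ge1}\log_p|\gamma_i(P):\gamma_{i+1}(P)|$.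 *)

(* Defs.v *)
From HB Require Import structures.
From mathcomp Require Import all_boot all_algebra.
From mathcomp Require Import boolp classical_sets functions cardinality filter.
From mathcomp Require Import topology.

Set Implicit Arguments.
Unset Strict Implicit.
Unset Printing Implicit Defensive.

Local Open Scope classical_set_scope.
Local Open Scope group_scope.

Section Groups.
Variable G : groupType.
Implicit Types (H K N S : set G) (x y : G).

Definition is_subgroup H : Prop :=
  [/\ H 1, forall x y, H x -> H y -> H (x * y) & forall x, H x -> H x^-1].

Definition is_normal N : Prop :=
  is_subgroup N /\ forall x y, N x -> N (x ^ y).

Definition generated S : set G :=
  \bigcap_(H in [set H | is_subgroup H /\ S `<=` H]) H.

Definition rcoset_of H x : set G := [set h * x | h in H].

Definition rcosets_of K H : set (set G) := [set rcoset_of H x | x in K].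

(* |K : H| = n, for subgroups H `<=` K *)
Definition has_index K H (n : nat) : Prop := (rcosets_of K H #= `I_n)%card.

(* left-normed commutators [x_1, ..., x_(n.+1)] *)
Fixpoint commutators (n : nat) : set G :=
  if n is m.+1 then [set z | exists2 c, commutators m c & exists y, z = [~ c, y]]
  else setT.

Lemma generated_subgroup S : is_subgroup (generated S).
Proof.
split; first by move=> H [[? _ _] _].
- move=> x y Sx Sy H HS; have [[_ HM _] _] := HS.
  by apply: HM; [exact: Sx|exact: Sy].
- by move=> x Sx H HS; have [[_ _ HV] _] := HS; apply: HV; apply: Sx.
Qed.

Definition generated_type S : Type := set_type (generated S).
HB.instance Definition _ S := SubChoice.on (generated_type S).

Lemma generated_group_closed S : group_closed (mem (generated S) : {pred G}).
Proof.
have [S1 SM SV] := generated_subgroup S.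
split; first by apply/mem_set.
move=> x y /set_mem Sx /set_mem Sy; apply/mem_set.
exact: (SM x y^-1 Sx (SV y Sy)).
Qed.

HB.instance Definition _ S := SubChoice_isSubGroup.Build G _
  (generated_type S) (generated_group_closed S).

End Groups.

HB.structure Definition PreTopologicalGroup := {G of Group G & Topological G}.

HB.mixin Record PreTopologicalGroup_isTopologicalGroup G
    of PreTopologicalGroup G := {
  mulg_continuous : continuous (fun xy : G * G => xy.1 * xy.2);
  invg_continuous : continuous (fun x : G => x^-1)
}.

#[short(type="topologicalGroupType")]
HB.structure Definition TopologicalGroup :=
  {G of PreTopologicalGroup G & PreTopologicalGroup_isTopologicalGroup G}.

Definition profinite (P : topologicalGroupType) : Prop :=
  [/\ compact [set: P], hausdorff_space P & totally_disconnected [set: P]].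

Definition pro_p_group (p : nat) (P : topologicalGroupType) : Prop :=
  profinite P /\
  forall N : set P, is_normal N -> open N -> exists k, has_index setT N (p ^ k)%N.

(* gamma i is the i-th term of the lower central series for 0 < i *)
Definition gamma (P : topologicalGroupType) (i : nat) : set P :=
  \bigcap_(H in [set H | [/\ is_subgroup H, closed H & commutators i.-1 `<=` H]]) H.

Arguments gamma P i _ : clear implicits.

(* w is the maximum of log_p |gamma i : gamma i.+1| over 0 < i *)
Definition lower_central_width (p : nat) (P : topologicalGroupType) (w : nat) :=
  (forall i, (0 < i)%N -> exists2 k, (k <= w)%N &
     has_index (gamma P i) (gamma P i.+1) (p ^ k)%N) /\
  (exists2 i, (0 < i)%N & has_index (gamma P i) (gamma P i.+1) (p ^ w)%N).

Section ProfiniteCompletion.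
Variable G : groupType.

Definition finite_index_normal : Type :=
  set_type [set N : set G | is_normal N /\ finite_set (rcosets_of setT N)].
HB.instance Definition _ := Choice.on finite_index_normal.
Definition fin_set (N : finite_index_normal) : set G := set_val N.
Coercion fin_set : finite_index_normal >-> set.

(* The inverse limit of the finite discrete groups G / N, as a subset of the
   product over N. An element of G / N is a coset, i.e., a set in G, so the
   factors are embedded in the discrete space of all subsets of G; the map
   G / M -> G / N for M `<=` N sends a coset to the coset containing it. *)
Definition coset_families : Type :=
  prod_topology (fun _ : finite_index_normal => discrete_topology (set G)).

Definition inverse_limit : set coset_families :=
  [set c | (forall N : finite_index_normal, rcosets_of setT N (c N)) /\
           (forall M N : finite_index_normal, M `<=` N -> c M `<=` c N)].

Definition profinite_completion : Type := set_type inverse_limit.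
HB.instance Definition _ := Topological.on profinite_completion.

Implicit Types (c d : profinite_completion) (N : finite_index_normal) (x y : G).

Definition completion_fun c (N : finite_index_normal) : set G := set_val c N.
Coercion completion_fun : profinite_completion >-> Funclass.

Lemma completion_rep c N : exists x, c N = rcoset_of N x.
Proof. by have [/(_ N)[x _ xE] _] := set_valP c; exists x; exact: esym xE. Qed.

Lemma completion_sub c (M N : finite_index_normal) : M `<=` N -> c M `<=` c N.
Proof. by have [_ cP] := set_valP c; exact: cP. Qed.

Lemma completion_ext c d : (forall N, c N = d N) -> c = d.
Proof.
by move=> cd; apply: val_inj; apply: functional_extensionality_dep => N; apply: cd.
Qed.

Lemma fin_subgroup N : is_subgroup N.
Proof. by have [[]] := set_valP N. Qed.

Lemma rcoset_ofP (H : set G) x y : rcoset_of H x y <-> H (y * x^-1).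
Proof.
split=> [[h Hh <-]|Hyx]; first by rewrite mulgK.
by exists (y * x^-1) => //; rewrite mulgVK.
Qed.

Lemma rcoset_ofM N x y :
  [set u * v | u in rcoset_of N x & v in rcoset_of N y] = rcoset_of N (x * y).
Proof.
have [_ NM NV] := fin_subgroup N; have [[_ NJ] _] := set_valP N.
rewrite eqEsubset; split=> [_ [_ [h Nh <-]] [_ [k Nk <-] <-]|_ [h Nh <-]].
  exists (h * (k ^ x^-1)); first by apply: NM => //; apply: NJ.
  by rewrite /conjg invgK !mulgA mulgVK.
exists (h * x); first by exists h.
exists y; last by rewrite mulgA.
by exists 1; [have [] := fin_subgroup N|rewrite mul1g].
Qed.

Lemma rcoset_ofV N x : [set u^-1 | u in rcoset_of N x] = rcoset_of N x^-1.
Proof.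
have [_ NM NV] := fin_subgroup N; have [[_ NJ] _] := set_valP N.
rewrite eqEsubset; split=> [_ [_ [h Nh <-] <-]|_ [h Nh <-]].
  exists (h^-1 ^ x); first by apply/NJ/NV.
  by rewrite /conjg invgM !mulgA mulgK.
exists (h^-1 ^ x^-1 * x); last by rewrite /conjg !invgK !invgM !invgK !mulgA mulVg mul1g.
by exists (h^-1 ^ x^-1) => //; apply/NJ/NV.
Qed.

Lemma rcoset_of1 N : rcoset_of N 1 = N.
Proof. by rewrite eqEsubset; split=> [_ [h Nh <-]|h Nh]; rewrite ?mulg1//; exists h; rewrite ?mulg1. Qed.

Definition one_family : coset_families := fun N => fin_set N.
Definition mul_family (c d : coset_families) : coset_families :=
  fun N => [set x * y | x in c N & y in d N].
Definition inv_family (c : coset_families) : coset_families :=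
  fun N => [set x^-1 | x in c N].

Lemma one_family_subproof : inverse_limit one_family.
Proof. by split=> // N; exists 1 => //; rewrite rcoset_of1. Qed.

Lemma mul_family_subproof c d : inverse_limit (mul_family c d).
Proof.
split=> [N|M N MN _ [x cx [y dy <-]]].
  have [[x cE] [y dE]] := (completion_rep c N, completion_rep d N).
  by exists (x * y) => //; rewrite /mul_family cE dE rcoset_ofM.
by exists x; [exact: completion_sub cx|exists y => //; exact: completion_sub dy].
Qed.

Lemma inv_family_subproof c : inverse_limit (inv_family c).
Proof.
split=> [N|M N MN _ [x cx <-]].
  by have [x cE] := completion_rep c N; exists x^-1 => //; rewrite /inv_family cE rcoset_ofV.
by exists x => //; exact: completion_sub cx.
Qed.

Definition completion_one : profinite_completion :=
  exist _ one_family (mem_set one_family_subproof).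
Definition completion_mul c d : profinite_completion :=
  exist _ (mul_family c d) (mem_set (mul_family_subproof c d)).
Definition completion_inv c : profinite_completion :=
  exist _ (inv_family c) (mem_set (inv_family_subproof c)).

Lemma completion_oneE N : completion_one N = rcoset_of N 1.
Proof. by rewrite rcoset_of1. Qed.

Lemma completion_mulE c d N :
  completion_mul c d N = [set x * y | x in c N & y in d N].
Proof. by []. Qed.

Lemma completion_invE c N : completion_inv c N = [set x^-1 | x in c N].
Proof. by []. Qed.

Lemma completion_mulA : associative completion_mul.
Proof.
move=> c d f; apply: completion_ext => N; rewrite !completion_mulE.
have [[x ->] [y ->] [z ->]] :=
  And3 (completion_rep c N) (completion_rep d N) (completion_rep f N).
by rewrite !rcoset_ofM mulgA.
Qed.

Lemma completion_mul1g : left_id completion_one completion_mul.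
Proof.
move=> c; apply: completion_ext => N; rewrite completion_mulE completion_oneE.
by have [x ->] := completion_rep c N; rewrite rcoset_ofM mul1g.
Qed.

Lemma completion_mulg1 : right_id completion_one completion_mul.
Proof.
move=> c; apply: completion_ext => N; rewrite completion_mulE completion_oneE.
by have [x ->] := completion_rep c N; rewrite rcoset_ofM mulg1.
Qed.

Lemma completion_mulVg : left_inverse completion_one completion_inv completion_mul.
Proof.
move=> c; apply: completion_ext => N.
rewrite completion_mulE completion_oneE completion_invE.
by have [x ->] := completion_rep c N; rewrite rcoset_ofV rcoset_ofM mulVg.
Qed.

Lemma completion_mulgV : right_inverse completion_one completion_inv completion_mul.
Proof.
move=> c; apply: completion_ext => N.
rewrite completion_mulE completion_oneE completion_invE.
by have [x ->] := completion_rep c N; rewrite rcoset_ofV rcoset_ofM mulgV.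
Qed.

HB.instance Definition _ := isGroup.Build profinite_completion
  completion_mulA completion_mul1g completion_mulg1
  completion_mulVg completion_mulgV.

Lemma near_completion c N : nbhs c [set d : profinite_completion | d N = c N].
Proof.
have vc : continuous (set_val : profinite_completion -> coset_families).
  exact: (@initial_continuous profinite_completion coset_families set_val).
have pc := @proj_continuous _ (fun _ : finite_index_normal => discrete_topology (set G)) N.
have /(_ [set A | A = c N]) := continuous_comp (vc c) (pc _).
by apply; exact: discrete_set1.
Qed.

Lemma completion_continuous (T : topologicalType) (f : T -> profinite_completion) :
  (forall t N, nbhs t [set s | f s N = f t N]) -> continuous f.
Proof.
move=> fP; apply: (@continuous_comp_initial _ _ _ set_val) => t.
apply/cvg_sup => N A [B [[C oC <-]]] /= Cf CA.
apply: filterS (fP t N) => s fsE; apply: CA => /=.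
by move: fsE; rewrite /= /completion_fun => ->.
Qed.

Lemma completion_mul_continuous :
  continuous (fun cd : profinite_completion * profinite_completion => cd.1 * cd.2).
Proof.
apply: completion_continuous => -[c d] N.
exists ([set c' : profinite_completion | c' N = completion_fun c N],
        [set d' : profinite_completion | d' N = completion_fun d N]).
  by split; exact: near_completion.
by move=> [c' d'] [/= cE dE]; rewrite /= !completion_mulE cE dE.
Qed.

Lemma completion_inv_continuous : continuous (fun c : profinite_completion => c^-1).
Proof.
apply: completion_continuous => c N.
by apply: filterS (near_completion c N) => d dE; rewrite /= !completion_invE dE.
Qed.

HB.instance Definition _ := PreTopologicalGroup_isTopologicalGroup.Build
  profinite_completion completion_mul_continuous completion_inv_continuous.

End ProfiniteCompletion.

Section TreeAutomorphisms.
Variable X : choiceType.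
Implicit Types (u v w : seq X) (x y : X).

Definition adjacent u v : Prop := exists x, v = rcons u x \/ u = rcons v x.

Definition is_tree_aut (f : seq X -> seq X) : Prop :=
  bijective f /\ forall u v, adjacent (f u) (f v) <-> adjacent u v.

Definition tree_aut : Type := set_type [set f | is_tree_aut f].
HB.instance Definition _ := Choice.on tree_aut.
Definition tree_fun (f : tree_aut) : seq X -> seq X := set_val f.
Coercion tree_fun : tree_aut >-> Funclass.

Definition TreeAut f (fP : is_tree_aut f) : tree_aut := exist _ f (mem_set fP).

Lemma tree_autP (f : tree_aut) : is_tree_aut f.
Proof. exact: set_valP f. Qed.

Lemma tree_aut_ext (f g : tree_aut) : f =1 g -> f = g.
Proof. by move=> fg; apply: val_inj; apply/funext. Qed.

Lemma is_tree_aut_id : is_tree_aut id.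
Proof. by split=> //; exists id. Qed.

Lemma is_tree_aut_comp f g : is_tree_aut f -> is_tree_aut g -> is_tree_aut (g \o f).
Proof.
move=> [bf fP] [bg gP]; split; first exact: bij_comp.
by move=> u v; rewrite /= gP fP.
Qed.

Lemma tree_aut_inv_ex (f : tree_aut) :
  exists g, is_tree_aut g /\ cancel f g /\ cancel g f.
Proof.
have [[g fK gK] fP] := tree_autP f; exists g; split=> //; split; first by exists f.
by move=> u v; have [] := fP (g u) (g v); rewrite !gK.
Qed.

Definition tree_aut_one : tree_aut := TreeAut is_tree_aut_id.

(* automorphisms act on the right: f * g is f followed by g *)
Definition tree_aut_mul (f g : tree_aut) : tree_aut :=
  TreeAut (is_tree_aut_comp (tree_autP f) (tree_autP g)).

Definition tree_aut_inv (f : tree_aut) : tree_aut :=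
  TreeAut (proj1 (projT2 (cid (tree_aut_inv_ex f)))).

Lemma tree_aut_mulA : associative tree_aut_mul.
Proof. by move=> f g h; apply: tree_aut_ext. Qed.

Lemma tree_aut_mul1 : left_id tree_aut_one tree_aut_mul.
Proof. by move=> f; apply: tree_aut_ext. Qed.

Lemma tree_aut_mulr1 : right_id tree_aut_one tree_aut_mul.
Proof. by move=> f; apply: tree_aut_ext. Qed.

Lemma tree_aut_mulV : left_inverse tree_aut_one tree_aut_inv tree_aut_mul.
Proof.
move=> f; apply: tree_aut_ext => u; rewrite /tree_fun /= /tree_aut_inv.
by case: (cid _) => g [gP [fK gK]] /=; apply: gK.
Qed.

Lemma tree_aut_mulrV : right_inverse tree_aut_one tree_aut_inv tree_aut_mul.
Proof.
move=> f; apply: tree_aut_ext => u; rewrite /tree_fun /= /tree_aut_inv.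
by case: (cid _) => g [gP [fK gK]] /=; apply: fK.
Qed.

HB.instance Definition _ := isGroup.Build tree_aut
  tree_aut_mulA tree_aut_mul1 tree_aut_mulr1 tree_aut_mulV tree_aut_mulrV.

Lemma tree_aut_mulE (f g : tree_aut) u : tree_fun (f * g) u = g (f u).
Proof. by []. Qed.

Definition maps_children (f : seq X -> seq X) : Prop :=
  f [::] = [::] /\ forall u x, exists y, f (rcons u x) = rcons (f u) y.

Lemma maps_children_aut f g :
  cancel f g -> cancel g f -> maps_children f -> maps_children g -> is_tree_aut f.
Proof.
move=> fK gK fC gC; split; first by exists g.
have adjP h : maps_children h -> forall u v, adjacent u v -> adjacent (h u) (h v).
  by move=> hC u v [x [->|->]]; [have [y ->] := hC.2 u x|have [y ->] := hC.2 v x];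
    exists y; [left|right].
move=> u v; split; last exact: adjP.
by move=> /(adjP _ gC); rewrite !fK.
Qed.

Lemma maps_children_exp (f : tree_aut) n : maps_children f -> maps_children (tree_fun (f ^+ n)).
Proof.
move=> fC; elim: n => [|n IHn]; first by split=> // u x; exists x.
split=> [|u x]; rewrite expgS !tree_aut_mulE; first by rewrite fC.1 IHn.1.
by have [y ->] := fC.2 u x; apply: IHn.2.
Qed.

End TreeAutomorphisms.

(* The letters 1, ..., p are the ordinals 0, ..., p.-1 of 'I_p. *)

Definition rooted_fun p (s : 'I_p -> 'I_p) (v : seq 'I_p) : seq 'I_p :=
  if v is x :: w then s x :: w else [::].

Lemma rooted_fun_children p (s : 'I_p -> 'I_p) : maps_children (rooted_fun s).
Proof. by split=> // -[|z u] x; [exists (s x)|exists x]. Qed.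

Lemma rooted_is_tree_aut p (s t : 'I_p -> 'I_p) :
  cancel s t -> cancel t s -> is_tree_aut (rooted_fun s).
Proof.
move=> sK tK; apply: (@maps_children_aut _ _ (rooted_fun t)).
- by case=> //= x w; rewrite sK.
- by case=> //= x w; rewrite tK.
- exact: rooted_fun_children.
- exact: rooted_fun_children.
Qed.

(* trivial sections, and (1 2 ... p) on the first level *)
Definition ggs_a p : tree_aut 'I_p :=
  TreeAut (rooted_is_tree_aut (@ordSK p) (@ord_predK p)).

Section GGS.
Variables (p : nat) (e : 'rV['F_p]_p.-1).

(* For c = ggs_a p this is the automorphism b fixing the first level, with
   section a ^+ e_i at the letter i < p, and b itself at the letter p. In terms
   of ordinals, e_i is e 0 (i - 1), and insub is None only at the last letter. *)
Fixpoint directed_fun (c : tree_aut 'I_p) (v : seq 'I_p) : seq 'I_p :=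
  if v is x :: w then
    x :: (if insub (val x) is Some i then tree_fun (c ^+ e 0%R i) w else directed_fun c w)
  else [::].

Lemma directed_funK (c d : tree_aut 'I_p) :
  c * d = 1 -> cancel (directed_fun c) (directed_fun d).
Proof.
move=> cd1; elim=> //= x w IHw; congr (_ :: _).
case: insubP => [i _ _|_]; last exact: IHw.
have cdC : commute c d by rewrite /commute cd1 -[d](mulKg c) cd1 mulg1 mulVg.
by rewrite -tree_aut_mulE -expgMn // cd1 expg1n.
Qed.

Lemma directed_fun_children (c : tree_aut 'I_p) :
  maps_children c -> maps_children (directed_fun c).
Proof.
move=> cC; have eC n := maps_children_exp n cC.
split=> // u x; elim: u => [|z u [y IHu]] /=.
  by exists x; case: insubP => // i _ _; rewrite (eC _).1.
case: insubP => [i _ _|_]; last by exists y; rewrite IHu.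
by have [t ->] := (eC (e 0%R i)).2 u x; exists t.
Qed.

Lemma ggs_a_children : maps_children (ggs_a p).
Proof. exact: rooted_fun_children. Qed.

Lemma ggs_aV_children : maps_children (tree_fun (ggs_a p)^-1).
Proof.
suff -> : tree_fun (ggs_a p)^-1 = rooted_fun (@ord_pred p).
  exact: rooted_fun_children.
have ab : ggs_a p * TreeAut (rooted_is_tree_aut (@ord_predK p) (@ordSK p)) = 1.
  by apply: tree_aut_ext; case=> //= x w; congr (_ :: w); exact: ordSK.
by rewrite -[_^-1]mulg1 -ab mulKg.
Qed.

Lemma directed_is_tree_aut : is_tree_aut (directed_fun (ggs_a p)).
Proof.
apply: (@maps_children_aut _ _ (directed_fun (ggs_a p)^-1)).
- by apply: directed_funK; rewrite mulgV.
- by apply: directed_funK; rewrite mulVg.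
- exact/directed_fun_children/ggs_a_children.
- exact/directed_fun_children/ggs_aV_children.
Qed.

Definition ggs_b : tree_aut 'I_p := TreeAut directed_is_tree_aut.

Lemma ggs_bE x w : ggs_b (x :: w) =
  x :: (if insub (val x) is Some i then tree_fun (ggs_a p ^+ e 0%R i) w
        else ggs_b w).
Proof. by []. Qed.

Definition ggs_group : groupType := generated_type [set ggs_a p; ggs_b].

(* The sum of the e_i, and the sum of the i e_i, are nonzero in 'F_p. *)
Definition FG_type : Prop :=
  (\sum_(i < p.-1) e 0 i != 0)%R /\ (\sum_(i < p.-1) i.+1%:R * e 0 i != 0)%R.

End GGS.

(* Main.v *)
From HB Require Import structures.
From mathcomp Require Import fingroup perm pgroup cyclic.
From mathcomp Require Import all_boot all_algebra.
From mathcomp Require Import boolp classical_sets functions cardinality filter.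
From mathcomp Require Import topology.
From mathcomp Require Import zify ring.
Require Import Defs.

(* Put c = a^-1, replace b by the power of it with sum of exponents 1, and let
   X = b c and w_n = [c, X, ..., X] with n - 1 factors X. The group G is branch
   over G': any p elements of G' are the sections of an element of G fixing the
   first level. Let K_i be the group of such elements with sections in gamma_i.
   For x in gamma_i let x^(q) in K_i have the sections x^C(j, q), j < p, so that
   [x^(q+1), c] = x^(q) modulo K_(i+1). If gamma_i / gamma_(i+1) is spanned by
   w_i and y, then for n = p (i - 1) + l with 0 < l < p - 1 the factor
   gamma_n / gamma_(n+1) is spanned by w_i^(p-1-l) and y^(p-2-l): commutators with
   c lower q, and those with b vanish until the end of this range. Two further
   factors complete a block of p and lead from i to i + 1, delta being nonzero.
   By induction all the factors have rank at most 2, and G / G' has rank 2.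

   A normal subgroup N != 1 moves a vertex v, hence contains the copy of G'' at v,
   and for each g in G some g^(p^k) lies in N. As G has elements of infinite
   order, this applies to all N of finite index, so the completion P is pro-p.
   As all G / gamma_i(G) are finite, gamma_i(P) is the kernel of the projection
   of P onto G / gamma_i(G), and P has the same lower central factors as G. *)

Set Implicit Arguments.
Unset Strict Implicit.
Unset Printing Implicit Defensive.

Import GRing.Theory.
Local Open Scope classical_set_scope.
Local Open Scope group_scope.

(** * Lower central series *)

(** As epsilon is nonzero, [b] can be normalized so that the exponents of its sections in [c] sum to
    1. The commutators of x with all the sections of [b] then add up to [x, X]; this singles out X
    and makes w_i lead to w_(i+1) from one block to the next. The first moment of the exponents is
    delta / epsilon. That it is nonzero pushes K_i deep enough into the series, and it also prevents
    the exponents from being symmetric, the one case in which the branching argument breaks down.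

    If K_i lies in gamma_m, the class of an element of K_i in gamma_m / gamma_(m+1) depends only on
    its trace, the sum of its sections modulo gamma_(i+1). The resulting linear map E either is
    shown to vanish, so that K_i lies deeper, or serves to compare elements.

    The obstacle is the start of the induction: w_2, ..., w_p do not lie in K_2, since their
    sections are not all in G'. These sections are computed modulo G', where binomial coefficients
    appear, and the traces 2 delta and -delta found from them settle the degrees up to p + 1. *)

Section Subgroups.
Variable G : groupType.
Implicit Types (H N S : set G) (x y z g : G).

Lemma sub_gen S : S `<=` generated S.
Proof. by move=> x Sx H [_]; apply. Qed.

Lemma gen_min S H : is_subgroup H -> S `<=` H -> generated S `<=` H.
Proof. by move=> HG SH x; apply; split. Qed.

Lemma subgroupX H x n : is_subgroup H -> H x -> H (x ^+ n).
Proof. by case=> H1 HM _ Hx; elim: n => [|n IH] //; rewrite expgS; apply: HM. Qed.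

Lemma subgroup_conj H g : is_subgroup H -> is_subgroup [set x | H (x ^ g)].
Proof.
case=> H1 HM HV; split=> /= [|x y Hx Hy|x Hx]; first by rewrite conj1g.
  by rewrite conjMg; apply: HM.
by rewrite conjVg; apply: HV.
Qed.

Lemma gen_normal S : (forall x g, S x -> S (x ^ g)) -> is_normal (generated S).
Proof.
move=> SJ; split; first exact: generated_subgroup.
move=> x g Sx; have SG := subgroup_conj g (generated_subgroup S).
by apply: (gen_min SG) Sx => y Sy; apply: sub_gen; apply: SJ.
Qed.

Lemma normalR N x g : is_normal N -> N x -> N [~ x, g].
Proof.
by case=> -[_ NM NV] NJ Nx; apply: NM; [exact: NV|exact: NJ].
Qed.

Lemma commMg x y z : [~ x * y, z] = [~ x, z] ^ y * [~ y, z].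
Proof.
by rewrite /commg /conjg !gnorm.
Qed.

Lemma commgM x y z : [~ x, y * z] = [~ x, z] * [~ x, y] ^ z.
Proof.
by rewrite /commg /conjg !gnorm.
Qed.

Lemma commVg x y : [~ x^-1, y] = [~ x, y]^-1 ^ x^-1.
Proof. by rewrite /commg /conjg !gnorm. Qed.

Lemma commgV x y : [~ x, y^-1] = [~ x, y]^-1 ^ y^-1.
Proof. by rewrite /commg /conjg !gnorm. Qed.

(* 1-based: lc 1 = G, and lc 0 = G as well *)
Definition lc n : set G := generated (@commutators G n.-1).

Lemma commutatorsJ n x g : @commutators G n x -> @commutators G n (x ^ g).
Proof.
elim: n x => [//|n IHn] x /= [u uC [y ->]].
by exists (u ^ g); [exact: IHn|exists (y ^ g); rewrite conjRg].
Qed.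

Lemma lc_normal n : is_normal (lc n).
Proof. by apply: gen_normal => x g; apply: commutatorsJ. Qed.

Lemma lc_subgroup n : is_subgroup (lc n). Proof. by case: (lc_normal n). Qed.

Lemma lc1 n : lc n 1. Proof. by case: (lc_subgroup n). Qed.
Lemma lcM n x y : lc n x -> lc n y -> lc n (x * y).
Proof. by case: (lc_subgroup n) => _ + _; apply. Qed.
Lemma lcV n x : lc n x -> lc n x^-1.
Proof. by case: (lc_subgroup n) => _ _; apply. Qed.
Lemma lcX n x k : lc n x -> lc n (x ^+ k).
Proof. by move=> xL; exact: (subgroupX k (lc_subgroup n) xL). Qed.
Lemma lcJ n x g : lc n x -> lc n (x ^ g).
Proof. by case: (lc_normal n) => _; apply. Qed.

Lemma lcT n x : n <= 1 -> lc n x.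
Proof. by case: n => [|[|]]// _; exact: sub_gen. Qed.

Lemma lcR n x g : lc n x -> lc n.+1 [~ x, g].
Proof.
case: n => [|n] /=; first by move=> _; exact: lcT.
move=> xL.
apply: (@gen_min (@commutators G n) [set x | lc n.+2 [~ x, g]]) x xL.
  split=> /= [|x y Hx Hy|x Hx]; first by rewrite comm1g; exact: lc1.
    by rewrite commMg; apply: lcM; [apply: lcJ; exact: Hx|exact: Hy].
  by rewrite commVg; apply: lcJ; apply: lcV; exact: Hx.
by move=> x xC; apply: sub_gen => /=; exists x => //; exists g.
Qed.

Lemma lcS n : lc n.+1 `<=` lc n.
Proof.
case: n => [|n] x; first by [].
apply: gen_min; first exact: lc_subgroup.
by move=> y [u uC [z ->]]; exact: normalR (lc_normal n.+1) (sub_gen uC).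
Qed.

Lemma lc_le m n x : (m <= n)%N -> lc n x -> lc m x.
Proof. by move=> /subnK <-; elim: (n - m)%N => //= k IHk /lcS. Qed.

Lemma lcR_min n H : (0 < n)%N -> is_subgroup H ->
  (forall x y, lc n x -> H [~ x, y]) -> lc n.+1 `<=` H.
Proof.
case: n => // n _ HG HR; apply: gen_min => // x [u uC [y ->]].
by apply: HR; exact: (sub_gen uC).
Qed.

(** Modulo gamma_(n+2) the commutator of x in gamma_n with g is additive in g, so generators
    suffice. As [H] contains gamma_(n+2), it absorbs the conjugations in the commutator
    identities. *)
Lemma lc_ind_gen n S H : (0 < n)%N -> generated S = setT -> is_subgroup H ->
  lc n.+2 `<=` H -> (forall x g, lc n x -> S g -> H [~ x, g]) -> lc n.+1 `<=` H.
Proof.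
move=> n0 ST HG LH HR; have [H1 HM HV] := HG.
have HJ x g : lc n.+1 x -> H x -> H (x ^ g).
  by move=> xL Hx; rewrite -[x ^ g](mulVKg x); apply: HM => //; apply: LH; exact: lcR.
have K : generated S `<=` [set y | forall x, lc n x -> H [~ x, y]].
  apply: gen_min; last by move=> g Sg x xL; apply: HR.
  split=> /= [x _|y1 y2 Hy1 Hy2 x xL|y1 Hy x xL].
  - by rewrite commg1.
  - rewrite commgM; apply: HM; first exact: Hy2.
    by apply: HJ; [exact: lcR|exact: Hy1].
  - rewrite commgV; apply: HJ; first by apply: lcV; apply: lcR.
    by apply: HV; apply: Hy.
by apply: lcR_min => // x y xL; apply: (K y) => //; rewrite ST.
Qed.

End Subgroups.

(** * The factors gamma_n / gamma_(n+1) as abelian groups *)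

Section LowerCentralFactors.
Local Open Scope quotient_scope.
Variables (G : groupType) (n : nat).
Implicit Types (x y : G).

Let lcn := [set x : G | lc n x].
Let T := set_type lcn.
HB.instance Definition _ := SubChoice.on T.

Definition lcf_rel (x y : T) : bool := `[< lc n.+1 ((set_val x)^-1 * set_val y) >].

Lemma lcf_equiv : equiv_class_of lcf_rel.
Proof.
have sym (x y : T) : lcf_rel x y -> lcf_rel y x.
  by move=> /asboolP/lcV h; apply/asboolP; move: h; rewrite invgM invgK.
split=> [x|x y|y x z].
- by apply/asboolP; rewrite mulVg; apply: lc1.
- by apply/idP/idP; apply: sym.
- move=> /asboolP xy /asboolP yz; apply/asboolP.
  by have := lcM xy yz; rewrite mulgA mulgK.
Qed.

Canonical lcf_equiv_rel := EquivRelPack lcf_equiv.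
Definition lcf : Type := {eq_quot lcf_equiv_rel}.
HB.instance Definition _ := Choice.on lcf.
HB.instance Definition _ := EqQuotient.on lcf.

Let inT x : T :=
  if pselect (lc n x) is left h then exist _ x (mem_set (h : lcn x))
  else exist _ 1 (mem_set (@lc1 G n : lcn 1)).

(** Total on [G]: outside gamma_n it takes the class of 1, so the rules below assume membership. *)
Definition lcv x : lcf := \pi_lcf (inT x).

Let inTE x : lc n x -> set_val (inT x) = x.
Proof. by rewrite /inT; case: pselect. Qed.

Let valTP (x : T) : lc n (set_val x).
Proof. exact: (set_valP x). Qed.

Lemma lcvE x y : lc n x -> lc n y -> lcv x = lcv y <-> lc n.+1 (x^-1 * y).
Proof.
move=> xL yL; rewrite /lcv; split.
  by move=> /eqmodP/asboolP; rewrite !inTE.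
by move=> h; apply/eqmodP/asboolP; rewrite !inTE.
Qed.

Let rp (a : lcf) : G := set_val (repr a).

Let rpL a : lc n (rp a). Proof. exact: valTP. Qed.

Let rpK a : lcv (rp a) = a.
Proof.
rewrite -[RHS](@reprK _ lcf) /lcv; congr (\pi_lcf _).
by apply: val_inj; apply: inTE; exact: rpL.
Qed.

Lemma lcv_surj (a : lcf) : exists2 x, lc n x & a = lcv x.
Proof. by exists (rp a); [exact: rpL|rewrite rpK]. Qed.

Definition lcf_add (a b : lcf) := lcv (rp a * rp b).
Definition lcf_opp (a : lcf) := lcv (rp a)^-1.

Let congL x y : lc n x -> lc n y -> lcv x = lcv y ->
  exists2 u, lc n.+1 u & y = x * u.
Proof. by move=> xL yL /lcvE; exists (x^-1 * y); [auto|rewrite mulVKg]. Qed.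

Let rpv x : lc n x -> exists2 u, lc n.+1 u & rp (lcv x) = x * u.
Proof. by move=> xL; apply: congL => //; rewrite rpK. Qed.

Let addE x y : lc n x -> lc n y -> lcf_add (lcv x) (lcv y) = lcv (x * y).
Proof.
move=> xL yL; rewrite /lcf_add.
have [u uL ->] := rpv xL; have [w wL ->] := rpv yL; apply/esym/lcvE.
- exact: lcM.
- by apply: lcM; apply: lcM => //; apply: lcS.
- have -> : (x * y)^-1 * (x * u * (y * w)) = u ^ y * w.
    by rewrite /conjg !invgM !mulgA mulgVK.
  by apply: lcM => //; apply: lcJ.
Qed.

Let oppE x : lc n x -> lcf_opp (lcv x) = lcv x^-1.
Proof.
move=> xL; rewrite /lcf_opp; have [u uL ->] := rpv xL; apply/esym/lcvE.
- exact: lcV.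
- by apply: lcV; apply: lcM => //; apply: lcS.
- have -> : x^-1^-1 * (x * u)^-1 = u^-1 ^ x^-1.
    by rewrite /conjg !invgM !mulgA.
  by apply: lcJ; apply: lcV.
Qed.

Let addA : associative lcf_add.
Proof.
move=> a b d; have [[x xL ->] [y yL ->] [z zL ->]] := And3 (lcv_surj a) (lcv_surj b) (lcv_surj d).
by rewrite !addE ?mulgA//; apply: lcM.
Qed.

Let addC : commutative lcf_add.
Proof.
move=> a b; have [[x xL ->] [y yL ->]] := (lcv_surj a, lcv_surj b).
rewrite !addE//; apply/lcvE; [exact: lcM|exact: lcM|].
have -> : (x * y)^-1 * (y * x) = [~ y, x] by rewrite /commg /conjg invgM !mulgA.
exact: lcR.
Qed.

Let add0 : left_id (lcv 1) lcf_add.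
Proof.
by move=> a; have [x xL ->] := lcv_surj a; rewrite addE ?mul1g//; apply: lc1.
Qed.

Let addN : left_inverse (lcv 1) lcf_opp lcf_add.
Proof.
move=> a; have [x xL ->] := lcv_surj a; rewrite oppE// addE ?mulVg//; exact: lcV.
Qed.

HB.instance Definition _ := GRing.isZmodule.Build lcf addA addC add0 addN.

Lemma lcv1 : lcv 1 = 0%R. Proof. by []. Qed.

Lemma lcvM x y : lc n x -> lc n y -> lcv (x * y) = (lcv x + lcv y)%R.
Proof. by move=> xL yL; rewrite -[RHS]/(lcf_add _ _) addE. Qed.

Lemma lcvV x : lc n x -> lcv x^-1 = (- lcv x)%R.
Proof. by move=> xL; rewrite -[RHS]/(lcf_opp _) oppE. Qed.

Lemma lcvX x k : lc n x -> lcv (x ^+ k) = (lcv x *+ k)%R.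
Proof.
move=> xL; elim: k => [|k IHk]; first by rewrite expg0 mulr0n lcv1.
by rewrite expgS mulrS lcvM ?IHk//; apply: lcX.
Qed.

Lemma lcv0 x : lc n x -> lcv x = 0%R <-> lc n.+1 x.
Proof.
move=> xL; rewrite -lcv1; split=> [/esym/lcvE|xL'].
  by rewrite invg1 mul1g; apply=> //; exact: lc1.
apply/esym/lcvE; [exact: lc1|by []|by rewrite invg1 mul1g].
Qed.

Lemma lcvJ x g : lc n x -> lcv (x ^ g) = lcv x.
Proof. by move=> xL; apply/esym/lcvE => //; [exact: lcJ|exact: lcR]. Qed.

End LowerCentralFactors.
Arguments lcv {G} n x.

(** * Bilinearity of commutators modulo the next term *)

Section LowerCentralCommutators.
Variables (G : groupType) (n : nat).
Implicit Types (x y g : G).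
Local Open Scope ring_scope.

Lemma lcvRM x y g : lc n x -> lc n y ->
  lcv n.+1 [~ (x * y)%g, g] = lcv n.+1 [~ x, g] + lcv n.+1 [~ y, g].
Proof.
move=> xL yL; rewrite commMg lcvM; first by rewrite lcvJ//; exact: lcR.
  by apply: lcJ; apply: lcR.
exact: lcR.
Qed.

Lemma lcvRMr x g h : lc n x ->
  lcv n.+1 [~ x, (g * h)%g] = lcv n.+1 [~ x, g] + lcv n.+1 [~ x, h].
Proof.
move=> xL; rewrite commgM lcvM; first (rewrite lcvJ; first exact: addrC).
- exact: lcR.
- exact: lcR.
by apply: lcJ; apply: lcR.
Qed.

Lemma lcvRVr x g : lc n x -> lcv n.+1 [~ x, g^-1%g] = - lcv n.+1 [~ x, g].
Proof. by move=> xL; rewrite commgV lcvJ ?lcvV//; [exact: lcR|by apply: lcV; apply: lcR]. Qed.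

Lemma lcvRX x g k : lc n x -> lcv n.+1 [~ (x ^+ k)%g, g] = lcv n.+1 [~ x, g] *+ k.
Proof.
move=> xL; elim: k => [|k IHk]; first by rewrite comm1g lcv1.
by rewrite expgS lcvRM// ?IHk ?mulrS//; exact: lcX.
Qed.

Lemma lcvRXr x g k : lc n x -> lcv n.+1 [~ x, (g ^+ k)%g] = lcv n.+1 [~ x, g] *+ k.
Proof.
move=> xL; elim: k => [|k IHk]; first by rewrite commg1 lcv1.
by rewrite expgS lcvRMr// ?IHk ?mulrS//.
Qed.

End LowerCentralCommutators.

(** * Abstract GGS-groups *)

Section Levels.
Variables (p : nat) (G : groupType) (rho : G -> 'F_p) (sec : 'F_p -> G -> G).

(** The stabilizer of level n in terms of [rho] and [sec] alone, so that faithfulness can be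
    required without a tree. *)
Fixpoint level_stab n (g : G) : Prop :=
  if n is m.+1 then rho g = 0%R /\ forall j, level_stab m (sec j g) else True.

End Levels.

(* Positions on the first level are taken in 'F_p, the letter p being -1, and
   rho g is minus the rotation of the first level by g. Thus gc stands for a^-1
   and gb for a power of b; at the position j != -1 its section is
   a^(- gF (j + 1)). *)
Record ggs_data (p : nat) (G : groupType) := GgsData {
  ggs_prime : prime p;
  ggs_odd : odd p;
  rho : G -> 'F_p;
  sec : 'F_p -> G -> G;
  gc : G;
  gb : G;
  gF : 'F_p -> 'F_p;
  rhoM : forall g h, rho (g * h) = (rho g + rho h)%R;
  secM : forall j g h, sec j (g * h) = sec j g * sec (j - rho g)%R h;
  rho_c : rho gc = 1%R;
  sec_c : forall j, sec j gc = 1;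
  rho_b : rho gb = 0%R;
  sec_b : forall j, sec j gb = if j == (-1)%R then gb else gc ^+ gF (j + 1)%R;
  gF0 : gF 0%R = 0%R;
  gen_cb : generated [set gc; gb] = setT;
  faithful : forall g, (forall n, level_stab rho sec n g) -> g = 1;
  sum_gF : (\sum_d gF d = 1)%R;
  delta_gF : (\sum_d d * gF d != 0)%R }.

Section Basics.
Variables (p : nat) (G : groupType) (D : ggs_data p G).
Implicit Types (g h s t x y : G) (j d : 'F_p).

Local Notation c := (gc D).
Local Notation b := (gb D).
Local Notation F := (gF D).
Local Notation rho := (rho D).
Local Notation sec := (sec D).
Definition gX := b * c.
Local Notation X := gX.
Definition delta : 'F_p := (\sum_d d * F d)%R.

Lemma p_gt1 : (1 < p)%N. Proof. exact: prime_gt1 (ggs_prime D). Qed.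
Lemma p_gt2 : (2 < p)%N.
Proof. by have := ggs_odd D; have := p_gt1; case: p => [|[|[|]]]. Qed.

Lemma natFp0 k : ((k%:R : 'F_p) == 0)%R = (p %| k).
Proof. by rewrite -(dvdn_pcharf (pchar_Fp (ggs_prime D))). Qed.

Lemma natFpP k l : (k%:R = l%:R :> 'F_p)%R <-> k = l %[mod p].
Proof.
have Fm m : m %% p = (m%:R : 'F_p)%R by rewrite val_Fp_nat ?(ggs_prime D).
by rewrite !Fm; split=> [->|/val_inj].
Qed.

Lemma natFpK j : (j%:R = j :> 'F_p)%R. Proof. exact: natr_Zp. Qed.

Lemma val_FpD (a d : 'F_p) : (a + d)%R = (a + d) %% p :> nat.
Proof. by congr (_ %% _); exact: Fp_cast (ggs_prime D). Qed.

Lemma val_FpM (a d : 'F_p) : (a * d)%R = (a * d) %% p :> nat.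
Proof. by congr (_ %% _); exact: Fp_cast (ggs_prime D). Qed.

Lemma Fp_lt j : (j < p)%N.
Proof. by have := ltn_ord j; rewrite [X in (_ < X)%N -> _]Fp_cast ?(ggs_prime D). Qed.

Lemma rho1 : rho 1 = 0%R.
Proof. by have := rhoM D 1 1; rewrite mulg1 => /esym/eqP; rewrite -subr_eq0 addrK => /eqP. Qed.

Lemma rhoV g : rho g^-1 = (- rho g)%R.
Proof.
by apply/eqP; rewrite -addr_eq0 -rhoM mulVg rho1.
Qed.

Lemma rhoX g k : rho (g ^+ k) = (rho g *+ k)%R.
Proof. by elim: k => [|k IHk]; rewrite ?expg0 ?rho1 // expgS rhoM IHk mulrS. Qed.

Lemma rhoJ g h : rho (g ^ h) = rho g.
Proof. by rewrite !rhoM rhoV addrC addrK. Qed.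

Lemma rhoR g h : rho [~ g, h] = 0%R.
Proof. by rewrite /commg rhoM rhoJ rhoV addNr. Qed.

Lemma rho_X : rho X = 1%R. Proof. by rewrite rhoM rho_b rho_c add0r. Qed.

Lemma sec1 j : sec j 1 = 1.
Proof. by have := secM D j 1 1; rewrite mulg1 rho1 subr0 -{1}[sec j 1]mulg1 => /mulgI. Qed.

Lemma secV j g : sec j g^-1 = (sec (j + rho g)%R g)^-1.
Proof.
by have := secM D j g^-1 g; rewrite mulVg sec1 rhoV opprK => /esym/mulg1_eq <-; rewrite invgK.
Qed.

Lemma secMs j s g : rho s = 0%R -> sec j (s * g) = sec j s * sec j g.
Proof. by move=> s0; rewrite secM s0 subr0. Qed.

Lemma secVs j s : rho s = 0%R -> sec j s^-1 = (sec j s)^-1.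
Proof. by move=> s0; rewrite secV s0 addr0. Qed.

Lemma secXs j s k : rho s = 0%R -> sec j (s ^+ k) = sec j s ^+ k.
Proof.
move=> s0; elim: k => [|k IHk]; first by rewrite !expg0 sec1.
by rewrite !expgS secMs// IHk.
Qed.

Lemma secJ j s g : rho s = 0%R ->
  sec j (s ^ g) = sec (j + rho g)%R s ^ sec (j + rho g)%R g.
Proof. by move=> s0; rewrite /conjg !secM s0 subr0 secV rhoV opprK. Qed.

Lemma secJs j s t : rho s = 0%R -> rho t = 0%R -> sec j (s ^ t) = sec j s ^ sec j t.
Proof. by move=> s0 t0; rewrite secJ// t0 addr0. Qed.

Lemma secJc j s : rho s = 0%R -> sec j (s ^ c) = sec (j + 1)%R s.
Proof. by move=> s0; rewrite secJ// rho_c sec_c conjg1. Qed.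

Lemma secJcX j s k : rho s = 0%R -> sec j (s ^ (c ^+ k)) = sec (j + k%:R)%R s.
Proof.
move=> s0; elim: k j => [|k IHk] j; first by rewrite expg0 conjg1 addr0.
by rewrite expgSr conjgM secJc ?rhoJ// IHk -addrA -mulrS.
Qed.

Lemma secJX j s : rho s = 0%R -> sec j (s ^ X) = sec (j + 1)%R s ^ sec (j + 1)%R b.
Proof. by move=> s0; rewrite secJ// rho_X secM sec_c mulg1. Qed.

Lemma secR j s t : rho s = 0%R -> rho t = 0%R -> sec j [~ s, t] = [~ sec j s, sec j t].
Proof. by move=> s0 t0; rewrite /commg secMs ?rhoV ?s0 ?oppr0// secVs// secJs. Qed.

Lemma secRc j s : rho s = 0%R -> sec j [~ s, c] = (sec j s)^-1 * sec (j + 1)%R s.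
Proof. by move=> s0; rewrite /commg secMs ?rhoV ?s0 ?oppr0// secVs// secJc. Qed.

Lemma secRX j s : rho s = 0%R ->
  sec j [~ s, X] = (sec j s)^-1 * sec (j + 1)%R s ^ sec (j + 1)%R b.
Proof. by move=> s0; rewrite /commg secMs ?rhoV ?s0 ?oppr0// secVs// secJX. Qed.

Lemma sec_inj1 g : rho g = 0%R -> (forall j, sec j g = 1) -> g = 1.
Proof.
move=> g0 gs; apply: (@faithful _ _ D g) => -[|n]//=; split=> // j; rewrite gs.
by elim: n => //= n IHn; split=> [|k]; rewrite ?rho1 ?sec1.
Qed.

Lemma sec_inj g h : rho g = rho h -> (forall j, sec j g = sec j h) -> g = h.
Proof.
move=> gh ghs; apply: divg1_eq; apply: sec_inj1 => [|j].
  by rewrite rhoM rhoV gh subrr.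
by rewrite secM secV gh -addrA addNr addr0 ghs mulgV.
Qed.

Lemma expc_p : c ^+ p = 1.
Proof.
apply: sec_inj1 => [|j]; first by rewrite rhoX rho_c pchar_Fp_0 ?(ggs_prime D).
suff : forall k, sec j (c ^+ k) = 1 by apply.
by move=> k; elim: k j => [|k IHk] j; rewrite ?sec1// expgS secM sec_c mul1g IHk.
Qed.

(** The only section of [b ^+ p] that could be nontrivial is [b ^+ p] itself, so it fixes every
    level. *)
Lemma expb_p : b ^+ p = 1.
Proof.
have st0 n : level_stab rho sec n 1.
  by elim: n => //= n IHn; split=> [|j]; rewrite ?rho1 ?sec1.
apply: (@faithful _ _ D (b ^+ p)); elim=> //= n IHn; split.
  by rewrite rhoX rho_b mul0rn.
move=> j; rewrite secXs ?rho_b// sec_b; case: eqP => // _.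
by rewrite expgnAC expc_p expg1n.
Qed.

Lemma expc_mod k l : k = l %[mod p] -> c ^+ k = c ^+ l.
Proof.
by move=> kl; rewrite (divn_eq k p) (divn_eq l p) kl !expgnDr !(mulnC _ p) !expgnA !expc_p !expg1n.
Qed.

Lemma cb_ind (H : set G) : is_subgroup H -> H c -> H b -> forall g, H g.
Proof.
move=> HG Hc Hb g; have : [set: G] g by [].
by rewrite -(gen_cb D); apply: gen_min g => // x [->|->].
Qed.

Lemma sumF_shift (V : zmodType) (f : 'F_p -> V) d : (\sum_j f (j + d) = \sum_j f j)%R.
Proof.
rewrite [RHS](reindex_inj (h := fun j => (j + d)%R))//=.
exact: addIr.
Qed.

(** The exponent of [b] modulo p: rotations only permute the summands, and the normalization of [gF]
    gives the value 1 at [b]. With [rho], the exponent of [c], it provides coordinates on G / G'. *)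
Definition phi g : 'F_p := (\sum_j rho (sec j g))%R.

Lemma phiM g h : phi (g * h) = (phi g + phi h)%R.
Proof.
rewrite /phi; under eq_bigr do rewrite secM rhoM.
by rewrite big_split/= (sumF_shift (fun j => rho (sec j h))).
Qed.

Lemma phi1 : phi 1 = 0%R.
Proof. by rewrite /phi big1 // => j _; rewrite sec1 rho1. Qed.

Lemma phiV g : phi g^-1 = (- phi g)%R.
Proof. by apply/eqP; rewrite -addr_eq0 -phiM mulVg phi1. Qed.

Lemma phiX g k : phi (g ^+ k) = (phi g *+ k)%R.
Proof. by elim: k => [|k IHk]; rewrite ?expg0 ?phi1 // expgS phiM IHk mulrS. Qed.

Lemma phi_c : phi c = 0%R.
Proof. by rewrite /phi big1 // => j _; rewrite sec_c rho1. Qed.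

Lemma rho_secb j : rho (sec j b) = F (j + 1)%R.
Proof.
rewrite sec_b; case: eqP => [->|_]; first by rewrite addNr gF0 rho_b.
by rewrite rhoX rho_c natFpK.
Qed.

Lemma phi_b : phi b = 1%R.
Proof.
rewrite -(sum_gF D) -(sumF_shift F 1%R); apply: eq_bigr => j _.
exact: rho_secb.
Qed.

Lemma phi_X : phi X = 1%R. Proof. by rewrite phiM phi_b phi_c addr0. Qed.

Lemma phi_secb j : phi (sec j b) = (j == -1)%:R%R.
Proof.
by rewrite sec_b; case: eqP => _; rewrite ?phi_b// phiX phi_c mul0rn.
Qed.

Lemma lc2_rho g : lc 2 g -> rho g = 0%R.
Proof.
apply: (@gen_min _ _ [set g | rho g = 0%R]); last by move=> x [u _ [y ->]]; exact: rhoR.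
split=> /= [|x y|x]; first exact: rho1.
  by rewrite rhoM => -> ->; rewrite addr0.
by rewrite rhoV => ->; rewrite oppr0.
Qed.

Lemma lc2_phi g : lc 2 g -> phi g = 0%R.
Proof.
apply: (@gen_min _ _ [set g | phi g = 0%R]).
  split=> /= [|x y|x]; first exact: phi1.
    by rewrite phiM => -> ->; rewrite addr0.
  by rewrite phiV => ->; rewrite oppr0.
by move=> x [u _ [y ->]] /=; rewrite /commg !phiM !phiV; ring.
Qed.

(** For n = 1 the generators have order p. Further up, the p-th power of [x, g] is [x^p, g] modulo
    the next term, and x^p already lies one term deeper by induction. *)
Lemma lcf_torsion n (a : lcf G n) : (a *+ p = 0)%R.
Proof.
have [x xL ->] := lcv_surj a; elim: n x xL {a} => [|n IHn] x xL.
  by rewrite -lcvX//; apply/lcv0; [exact: lcX|exact: lcT].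
case: n => [|n] in IHn x xL *.
  have H : is_subgroup [set x : G | lcv 1 x *+ p = 0]%R.
    split=> /= [|y z yp zp|y yp]; first by rewrite lcv1 mul0rn.
      by rewrite lcvM ?mulrnDl ?yp ?zp ?addr0//; exact: lcT.
    by rewrite lcvV ?mulNrn ?yp ?oppr0//; exact: lcT.
  apply: (cb_ind H) => /=; rewrite -lcvX ?expc_p ?expb_p ?lcv1//; exact: lcT.
suff: [set x : G | lc n.+2 x /\ lcv n.+2 x *+ p = 0]%R x by case.
move: x xL; apply: (lc_ind_gen _ (gen_cb D)) => // [|x xL|x g xL _].
- split=> /= [|y z [yL yp] [zL zp]|y [yL yp]].
  + by rewrite lcv1 mul0rn; split=> //; exact: lc1.
  + by rewrite lcvM ?mulrnDl ?yp ?zp ?addr0//; split=> //; exact: lcM.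
  + by rewrite lcvV ?mulNrn ?yp ?oppr0//; split=> //; exact: lcV.
- split; first exact: lcS.
  by have /lcv0 -> := xL; [rewrite mul0rn|exact: lcS].
- split; first exact: lcR.
  rewrite -lcvRX//; apply/lcv0; first by apply: lcR; exact: lcX.
  apply: lcR; apply/lcv0; first exact: lcX.
  by rewrite lcvX// IHn.
Qed.

End Basics.

(* The dependence on D makes the 'F_p-space structure below inferable. *)
Definition layer p (G : groupType) (D : ggs_data p G) n : Type := lcf G n.

Section Layers.
Variables (p : nat) (G : groupType) (D : ggs_data p G) (n : nat).

Local Notation layer := (layer D n).
HB.instance Definition _ := GRing.Zmodule.on layer.

Let scale (a : 'F_p) (z : layer) : layer := (z *+ a)%R.

Let mod_scale k (z : layer) : (z *+ (k %% p) = z *+ k)%R.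
Proof.
rewrite [in RHS](divn_eq k p) mulrnDr mulnC mulrnA.
by rewrite (lcf_torsion D (z : lcf G n)) mul0rn add0r.
Qed.

Let scaleA a b z : scale a (scale b z) = scale (a * b)%R z.
Proof.
by rewrite /scale -mulrnA -(mod_scale (b * a)) -(val_FpM D) mulrC.
Qed.

Let scale1 : left_id 1%R scale.
Proof. by move=> z; rewrite /scale /= ?modn_small ?mulr1n. Qed.

Let scaleDr : right_distributive scale +%R.
Proof. by move=> a y z; rewrite /scale mulrnDl. Qed.

Let scaleDl z : {morph scale^~ z : a b / (a + b)%R}.
Proof.
by move=> a b; rewrite /scale -mulrnDr -(mod_scale (a + b)) -(val_FpD D).
Qed.

HB.instance Definition _ := GRing.Zmodule_isLmodule.Build 'F_p layer
  scaleA scale1 scaleDr scaleDl.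

Definition lv (x : G) : layer := lcv n x.

Lemma scaleFpE (a : 'F_p) (z : layer) : (a *: z = z *+ a)%R.
Proof. by []. Qed.

End Layers.
Arguments lv {p G} D n x.

(** * Linear maps induced by commutators on the factors *)

Section LayerTheory.
Variables (p : nat) (G : groupType) (D : ggs_data p G).
Implicit Types (g h x y : G).
Local Open Scope ring_scope.
Local Notation c := (gc D).
Local Notation b := (gb D).
Local Notation X := (gX D).
Local Notation lv := (lv D).

Lemma lv1 n : lv n 1%g = 0. Proof. exact: lcv1. Qed.

Lemma lvM n x y : lc n x -> lc n y -> lv n (x * y)%g = lv n x + lv n y.
Proof. exact: lcvM. Qed.

Lemma lvV n x : lc n x -> lv n x^-1%g = - lv n x.
Proof. exact: lcvV. Qed.

Lemma lvX n x k : lc n x -> lv n (x ^+ k)%g = lv n x *+ k.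
Proof. exact: lcvX. Qed.

Lemma lv0P n x : lc n x -> lv n x = 0 <-> lc n.+1 x.
Proof. exact: lcv0. Qed.

Lemma lv0 n x : lc n.+1 x -> lv n x = 0.
Proof. by move=> xL; apply/lv0P => //; apply: lcS. Qed.

Lemma lvJ n x g : lc n x -> lv n (x ^ g)%g = lv n x.
Proof. exact: lcvJ. Qed.

Lemma lv_surj n (a : layer D n) : exists2 x, lc n x & a = lv n x.
Proof. exact: lcv_surj. Qed.

Lemma lvE n x y : lc n x -> lc n y -> lv n x = lv n y -> lc n.+1 (x^-1 * y)%g.
Proof. by move=> xL yL /lcvE; apply. Qed.

Definition layer_map n (V : lmodType 'F_p) (t : G -> V) : Prop :=
  (forall x y, lc n x -> lc n y -> t (x * y)%g = t x + t y) /\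
  (forall x, lc n.+1 x -> t x = 0).

(** Additive maps between spaces over a prime field are linear. *)
Lemma layer_mapP n (V : lmodType 'F_p) (t : G -> V) : layer_map n t ->
  exists L : {linear layer D n -> V}, forall x, lc n x -> t x = L (lv n x).
Proof.
move=> [tM t0].
have t1 : t 1%g = 0 by apply: t0; exact: lc1.
have tE x y : lc n x -> lc n y -> lv n x = lv n y -> t x = t y.
  move=> xL yL xy; have uL := lvE xL yL xy.
  by rewrite -[y](mulVKg x) tM// ?(t0 _ uL) ?addr0//; exact: lcS.
pose L (z : layer D n) := t (s2val (cid2 (lv_surj z))).
have LE x : lc n x -> t x = L (lv n x).
  by move=> xL; rewrite /L; case: cid2 => y yL xy /=; exact: tE.
have tX x k : lc n x -> t (x ^+ k)%g = t x *+ k.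
  move=> xL; elim: k => [|k IHk]; first by rewrite expg0.
  by rewrite expgS tM ?IHk ?mulrS//; exact: lcX.
have Llin : linear L.
  move=> a y z; have [u uL ->] := lv_surj y; have [v vL ->] := lv_surj z.
  rewrite scaleFpE -lvX// -lvM//; last exact: lcX.
  rewrite -!LE// ?tM ?tX//; try (by apply: lcX); last by apply: lcM => //; apply: lcX.
  by rewrite -scaler_nat natFpK.
pose HL := GRing.isLinear.Build 'F_p _ _ _ L Llin.
pose LL : {linear layer D n -> V} := HB.pack L HL.
by exists LL.
Qed.

Lemma ad_layer_map n g : layer_map n (fun x => lv n.+1 [~ x, g]).
Proof.
split=> [x y xL yL|x xL]; first exact: lcvRM.
by apply: lv0; apply: lcR.
Qed.

Definition ad n g : {linear layer D n -> layer D n.+1} :=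
  projT1 (cid (layer_mapP (ad_layer_map n g))).

Lemma adE n g x : lc n x -> lv n.+1 [~ x, g] = ad n g (lv n x).
Proof. by move=> xL; rewrite /ad; case: cid => L /= ->. Qed.

Lemma adM n g h z : ad n (g * h)%g z = ad n g z + ad n h z.
Proof.
by have [x xL ->] := lv_surj z; rewrite -!adE//; exact: lcvRMr.
Qed.

Lemma adV n g z : ad n g^-1%g z = - ad n g z.
Proof.
by have [x xL ->] := lv_surj z; rewrite -!adE//; exact: lcvRVr.
Qed.

Lemma ad1 n z : ad n 1%g z = 0.
Proof. by have [x xL ->] := lv_surj z; rewrite -!adE// commg1 lv1. Qed.

Lemma adX n g k z : ad n (g ^+ k)%g z = k%:R *: ad n g z.
Proof.
have [x xL ->] := lv_surj z; rewrite -!adE// scaler_nat; exact: lcvRXr.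
Qed.

Lemma ad_X n z : ad n X z = ad n b z + ad n c z.
Proof. exact: adM. Qed.

Definition span2 n (u w : layer D n) :=
  forall z, exists r s : 'F_p, z = r *: u + s *: w.

(** Modulo gamma_(n+2), gamma_(n+1) is generated by the commutators of gamma_n with the two
    generators. *)
Lemma layer_ind n (P : layer D n.+1 -> Prop) : (0 < n)%N ->
  P 0 -> (forall y z : layer D n.+1, P y -> P z -> P (y + z)) -> (forall z, P z -> P (- z)) ->
  (forall z, P (ad n c z)) -> (forall z, P (ad n b z)) -> forall z, P z.
Proof.
move=> n0 P0 PD PN Pc Pb z; have [x xL ->] := lv_surj z.
suff: [set x | lc n.+1 x /\ P (lv n.+1 x)] x by case.
move: x xL; apply: (lc_ind_gen n0 (gen_cb D)).
- split=> /= [|x y [xL Px] [yL Py]|x [xL Px]].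
  + by split; [exact: lc1|rewrite lv1].
  + by split; [exact: lcM|rewrite lvM//; exact: PD].
  + by split; [exact: lcV|rewrite lvV//; exact: PN].
- by move=> x xL; split; [exact: lcS|rewrite lv0].
- move=> x g xL [->|->]; split; try exact: lcR; rewrite adE//.
Qed.

Lemma lv1_coord g : lv 1 g = rho D g *: lv 1 c + phi D g *: lv 1 b.
Proof.
have T x : lc 1 x by exact: lcT.
apply: (@cb_ind _ _ D [set g | lv 1 g = rho D g *: lv 1 c + phi D g *: lv 1 b]) => /=.
- split=> /= [|x y xE yE|x xE].
  + by rewrite lv1 rho1 phi1 !scale0r addr0.
  + by rewrite lvM// xE yE rhoM phiM !scalerDl addrACA.
  + by rewrite lvV// xE rhoV phiV !scaleNr opprD.
- by rewrite rho_c phi_c scale1r scale0r addr0.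
- by rewrite rho_b phi_b scale1r scale0r add0r.
Qed.

Lemma lc2P g : rho D g = 0 -> phi D g = 0 -> lc 2 g.
Proof.
move=> r0 f0; apply/lv0P; first exact: lcT.
by rewrite lv1_coord r0 f0 !scale0r addr0.
Qed.

(** The commutator form is alternating and G / G' is spanned by [c] and [b], whence the
    determinant. *)
Lemma lv2_comm g h : lv 2 [~ g, h] =
  (rho D g * phi D h - phi D g * rho D h) *: lv 2 [~ c, b].
Proof.
have T x : lc 1 x by exact: lcT.
have bc : ad 1 c (lv 1 b) = - lv 2 [~ c, b].
  by rewrite -adE// -invgR lvV//; exact: lcR.
have hE k (z : layer D 1) : ad 1 k z = rho D k *: ad 1 c z + phi D k *: ad 1 b z.
  move: k; apply: (@cb_ind _ _ D [set k | ad 1 k z = rho D k *: ad 1 c z + phi D k *: ad 1 b z]) => /=.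
  - split=> /= [|x y xE yE|x xE].
    + by rewrite ad1 rho1 phi1 !scale0r addr0.
    + by rewrite adM// xE yE rhoM phiM !scalerDl addrACA.
    + by rewrite adV// xE rhoV phiV !scaleNr opprD.
  - by rewrite rho_c phi_c scale1r scale0r addr0.
  - by rewrite rho_b phi_b scale1r scale0r add0r.
rewrite adE// lv1_coord linearD !linearZ/= !(hE h) bc.
have cc k : ad 1 k (lv 1 k) = 0 by rewrite -adE// commgg lv1.
rewrite !cc -adE// !scaler0 add0r addr0 scalerN scalerN !scalerA -scalerBl.
by congr (_ *: _); ring.
Qed.

End LayerTheory.

(** * Branching over the commutator subgroup *)

Section NormalGeneration.
Variables (p : nat) (G : groupType) (D : ggs_data p G).
Implicit Types (g h x y : G) (N : set G).
Local Notation c := (gc D).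
Local Notation b := (gb D).

Lemma centralizer_subgroup N x : is_normal N -> is_subgroup [set h | N [~ x, h]].
Proof.
case=> -[N1 NM NV] NJ; split=> /= [|h k Nh Nk|h Nh].
- by rewrite commg1.
- by rewrite commgM; apply: NM => //; apply: NJ.
- by rewrite commgV; apply: NJ; apply: NV.
Qed.

Lemma normal_commC N x y : is_normal N -> N [~ x, y] -> N [~ y, x].
Proof. by case=> -[_ _ NV] _ /NV; rewrite invgR. Qed.

Lemma normal_comm N : is_normal N -> N [~ c, b] -> forall g h, N [~ g, h].
Proof.
move=> NN Ncb g; have [[N1 _ _] _] := NN.
have Ncc h : N [~ h, h] by rewrite commgg.
have Ng k : k = c \/ k = b -> N [~ g, k].
  move=> kE; apply: normal_commC => //.
  by apply: (cb_ind (centralizer_subgroup k NN)); case: kE => -> //=; exact: normal_commC.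
by apply: (cb_ind (centralizer_subgroup g NN)) => /=; apply: Ng; [left|right].
Qed.

Lemma lc2_min N : is_normal N -> N [~ c, b] -> lc 2 `<=` N.
Proof.
move=> NN Ncb; have [NG _] := NN.
by apply: lcR_min => // x y _; exact: normal_comm.
Qed.

Lemma commutant_normal N : is_normal N -> is_normal [set x | forall g, N [~ x, g]].
Proof.
move=> NN; have [[N1 NM NV] NJ] := NN.
split=> [|x y Nx g] /=; last by rewrite -[g](conjgKV y) -conjRg; apply: NJ.
split=> /= [g|x y Nx Ny g|x Nx g]; first by rewrite comm1g.
- by rewrite commMg; apply: NM => //; apply: NJ.
- by rewrite commVg; apply: NJ; apply: NV.
Qed.

Lemma commutant_mem N x : is_normal N -> N [~ x, c] -> N [~ x, b] ->
  forall g, N [~ x, g].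
Proof. by move=> NN Nc Nb; exact: (cb_ind (centralizer_subgroup x NN) Nc Nb). Qed.

Lemma expcF (a d : 'F_p) : (c ^+ a) ^+ d = c ^+ (a * d)%R.
Proof. by rewrite -expgnA (val_FpM D); apply: expc_mod; rewrite modn_mod. Qed.

Lemma expcD (a d : 'F_p) : c ^+ a * c ^+ d = c ^+ (a + d)%R.
Proof. by rewrite -expgnDr (val_FpD D); apply: expc_mod; rewrite modn_mod. Qed.

Lemma expc1 : c ^+ (1%R : 'F_p) = c. Proof. by []. Qed.

Lemma expc_gen (a : 'F_p) : (a != 0)%R -> (c ^+ a) ^+ (a^-1)%R = c.
Proof. by move=> a0; rewrite expcF mulfV// expc1. Qed.

Lemma normal_expc N (a : 'F_p) : is_normal N -> (a != 0)%R -> N [~ b, c ^+ a] ->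
  N [~ c, b].
Proof.
move=> NN a0 Na; apply: normal_commC => //; rewrite -(expc_gen a0).
exact: (subgroupX _ (centralizer_subgroup b NN) Na).
Qed.

End NormalGeneration.

(** * Sections realized by the stabilizer of the first level *)

Section Branch.
Variables (p : nat) (G : groupType) (D : ggs_data p G).
Implicit Types (g s t x y : G) (h k : 'F_p -> G) (i j d m : 'F_p) (e : 'F_p -> 'F_p).
Local Notation c := (gc D).
Local Notation b := (gb D).
Local Notation F := (gF D).
Local Notation rho := (rho D).
Local Notation sec := (sec D).

Definition stab_sections h : Prop :=
  exists s, rho s = 0%R /\ forall j, sec j s = h j.
Local Notation R := stab_sections.

Lemma stab_sections_ext h k : h =1 k -> R h -> R k.
Proof. by move=> hk [s [s0 sE]]; exists s; split=> // j; rewrite sE hk. Qed.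

Lemma stab_sectionsM h k : R h -> R k -> R (fun j => h j * k j).
Proof.
move=> [s [s0 sE]] [t [t0 tE]]; exists (s * t).
by rewrite rhoM s0 t0 addr0; split=> // j; rewrite secMs// sE tE.
Qed.

Lemma stab_sectionsV h : R h -> R (fun j => (h j)^-1).
Proof.
move=> [s [s0 sE]]; exists s^-1.
by rewrite rhoV s0 oppr0; split=> // j; rewrite secVs// sE.
Qed.

Lemma stab_sectionsX h (n : nat) : R h -> R (fun j => h j ^+ n).
Proof.
move=> [s [s0 sE]]; exists (s ^+ n).
by rewrite rhoX s0 mul0rn; split=> // j; rewrite secXs// sE.
Qed.

Lemma stab_sections_shift h d : R h -> R (fun j => h (j + d)%R).
Proof.
move=> [s [s0 sE]]; exists (s ^ (c ^+ d)); rewrite rhoJ; split=> // j.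
by rewrite secJcX// natFpK sE.
Qed.

Definition single i x : 'F_p -> G := fun j => if j == i then x else 1.

Lemma stab_sections_single i x : R (single 0%R x) -> R (single i x).
Proof.
move=> /(stab_sections_shift (- i)%R); apply: stab_sections_ext => j.
by rewrite /single subr_eq0.
Qed.

Lemma stab_sections_all h : (forall i, R (single 0%R (h i))) -> R h.
Proof.
move=> Rh.
suff: forall r : seq 'F_p, uniq r -> R (fun j => if j \in r then h j else 1).
  move/(_ _ (enum_uniq 'F_p)); apply: stab_sections_ext => j.
  by rewrite mem_enum.
elim=> [_|i r IHr /= /andP[ir ur]].
  by exists 1; rewrite rho1; split=> // j; rewrite sec1 in_nil.
have := stab_sectionsM (stab_sections_single i (Rh i)) (IHr ur).
apply: stab_sections_ext => j; rewrite /single in_cons.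
by have [->|] := eqVneq j i; rewrite ?(negbTE ir) ?mulg1 ?mul1g.
Qed.

(** Conjugation by c^k shifts positions by k; the exponent -1 - i moves the recursive section [b]
    from -1 to i. *)
Definition bb i := b ^ (c ^+ (-1 - i)%R).

Lemma rho_bb i : rho (bb i) = 0%R. Proof. by rewrite rhoJ rho_b. Qed.

Lemma sec_bb i j : sec j (bb i) = if j == i then b else c ^+ F (j - i)%R.
Proof.
rewrite secJcX ?rho_b// natFpK sec_b.
have -> : (j + (-1 - i) == -1)%R = (j == i) by rewrite -subr_eq0 -[RHS]subr_eq0; congr (_ == _); ring.
by case: eqP => // _; congr (c ^+ F _); ring.
Qed.

Lemma gF_neq0 : exists d, (F d != 0)%R.
Proof.
apply: contrapT => nF; have := sum_gF D; rewrite big1 => [/esym/eqP|d _].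
  by rewrite oner_eq0.
by apply/eqP/negPn/negP => Fd; apply: nF; exists d.
Qed.

Lemma neqFp0 d : (F d != 0)%R -> (d != 0)%R.
Proof. by apply: contraNneq => ->; rewrite gF0. Qed.

(** The conjugates of [b] provide both generators at position 0: [bb 0] has section [b] there, and a
    suitable [bb (- d)] a nontrivial power of [c]. *)
Lemma sec0_surj g : exists2 t, rho t = 0%R & sec 0%R t = g.
Proof.
apply: (@cb_ind _ _ D [set g | exists2 t, rho t = 0%R & sec 0%R t = g]) => /=.
- split=> [|_ _ [s s0 <-] [t t0 <-]|_ [s s0 <-]].
  + by exists 1; rewrite ?rho1 ?sec1.
  + by exists (s * t); rewrite ?rhoM ?s0 ?t0 ?addr0// secMs.
  + by exists s^-1; rewrite ?rhoV ?s0 ?oppr0// secVs.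
- have [d Fd] := gF_neq0; exists (bb (- d)%R ^+ (F d)^-1%R).
    by rewrite rhoX rho_bb mul0rn.
  rewrite secXs ?rho_bb// sec_bb eq_sym oppr_eq0 (negbTE (neqFp0 Fd)).
  by rewrite sub0r opprK expc_gen.
- by exists (bb 0%R); rewrite ?rho_bb// sec_bb eqxx.
Qed.

(** The rigid stabilizer of a first level vertex, seen through its section. Branching over G' means
    that it contains G'. *)
Definition rist0 : set G := [set x | R (single 0%R x)].

Lemma rist0_normal : is_normal rist0.
Proof.
split; first split.
- exists 1; rewrite rho1; split=> // j.
  by rewrite sec1 /single; case: eqP.
- move=> x y Rx Ry; have := stab_sectionsM Rx Ry; apply: stab_sections_ext => j.
  by rewrite /single; case: eqP; rewrite ?mulg1.
- move=> x Rx; have := stab_sectionsV Rx; apply: stab_sections_ext => j.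
  by rewrite /single; case: eqP; rewrite ?invg1.
- move=> x g [s [s0 sE]]; have [t t0 tg] := sec0_surj g.
  exists (s ^ t); rewrite rhoJ; split=> // j; rewrite secJs// sE /single.
  by case: eqP => [->|_]; rewrite ?tg ?conj1g.
Qed.

Lemma Fp_oddN d : (d = - d)%R -> d = 0%R.
Proof.
move=> dd; have : (d *+ 2 = 0)%R by rewrite mulr2n {2}dd subrr.
move/eqP; rewrite -mulr_natr mulf_eq0 (natFp0 D) => /orP[/eqP//|].
by move=> /(dvdn_leq (isT : 0 < 2)); rewrite leqNgt (p_gt2 D).
Qed.

(** If [gF] were even, substituting -d for d would give delta = - delta, hence delta = 0 as p is
    odd. The sign of d is then chosen to make F d nonzero. *)
Lemma gF_asym : exists d, (F d != F (- d) /\ F d != 0)%R.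
Proof.
suff [d Fd] : exists d, (F d != F (- d))%R.
  have [Fd0|] := eqVneq (F d) 0%R; last by exists d.
  by exists (- d)%R; rewrite opprK eq_sym Fd; split=> //; move: Fd; rewrite Fd0 eq_sym.
apply: contrapT => nF; move/negP: (delta_gF D); apply; apply/eqP/Fp_oddN.
rewrite [LHS](reindex_inj oppr_inj)/= -sumrN; apply: eq_bigr => d _.
rewrite mulNr; congr (- (_ * _))%R; apply/eqP/negPn/negP => Fd; apply: nF.
by exists d; rewrite eq_sym.
Qed.

End Branch.

(** * Realizing the commutator subgroup at a single position *)

Section BranchTheorem.
Variables (p : nat) (G : groupType) (D : ggs_data p G).
Implicit Types (g s t x y : G) (h : 'F_p -> G) (i j d m : 'F_p) (e : 'F_p -> 'F_p).
Local Notation c := (gc D).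
Local Notation b := (gb D).
Local Notation F := (gF D).
Local Notation rho := (rho D).
Local Notation sec := (sec D).
Local Notation lv := (lv D).
Local Notation R := (stab_sections D).
Local Notation H := (rist0 D).
Local Notation bb := (bb D).

Lemma lc3_min (N : set G) : is_normal N -> (forall g, N [~ [~ c, b], g]) ->
  lc 3 `<=` N.
Proof.
move=> NN Ncb; have [NG _] := NN.
apply: lcR_min => // y z yL; move: z.
exact: (lc2_min (commutant_normal NN) Ncb yL).
Qed.

Lemma Fp_expp (a : 'F_p) : (a ^+ p = a)%R.
Proof.
rewrite -[a in LHS]natFpK -[RHS]natFpK -natrX; apply/(natFpP D).
exact: fermat_little (ggs_prime D).
Qed.

(* Otherwise F would be a geometric progression along the multiples of d,
   whose ratio is then 1 as sum_gF is nonzero. *)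
Lemma gF_independent d : (F d != 0)%R -> (F (- d) != 0)%R -> (F d != F (- d))%R ->
  exists m n : 'F_p, [/\ m != 0, n != 0, m != d, n != d &
    F m * F (n - d) - F n * F (m - d) != 0]%R.
Proof.
move=> Fd FNd Fasym; have d0 := neqFp0 Fd; apply: contrapT => nF.
pose r := (F (d + d) / F d)%R.
have dd0 : (d + d != 0)%R.
  by apply: contra_neq d0 => dd; apply: (Fp_oddN D); apply/eqP; rewrite -addr_eq0 dd.
have FE m : (m != 0 -> m != d -> F m = r * F (m - d))%R.
  move=> m0 md; apply: (mulIf Fd); apply/eqP; rewrite -subr_eq0; apply/negPn/negP => ne.
  apply: nF; exists m, (d + d)%R; split=> //.
    by rewrite -subr_eq0 addrK.
  by rewrite addrK; move: ne; rewrite /r mulrAC mulfVK.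
have Fk n : (n < p.-1)%N -> (F (d *+ n.+1) = r ^+ n * F d)%R.
  elim: n => [|n IHn] np; first by rewrite mulr1n mul1r.
  rewrite FE.
  - by rewrite mulrS addrC addrK IHn ?exprS ?mulrA//; exact: ltnW.
  - rewrite -mulr_natr mulf_neq0// (natFp0 D) gtnNdvd//.
    by move: np; have := p_gt1 D; lia.
  - rewrite mulrS -subr_eq0 addrAC subrr add0r -mulr_natr mulf_neq0//.
    by rewrite (natFp0 D) gtnNdvd//; move: np; have := p_gt1 D; lia.
have p2 : (p = p.-2.+2)%N by have := p_gt1 D; lia.
have FNE : (F (- d) = r ^+ p.-2 * F d)%R.
  rewrite -Fk; last by rewrite {2}p2.
  congr (F _); apply/eqP; rewrite -subr_eq0 -opprD oppr_eq0 -mulrS -p2.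
  by rewrite -mulr_natr pchar_Fp_0 ?mulr0// (ggs_prime D).
have r0 : (r != 0)%R.
  apply: contraNneq FNd => r0; rewrite FNE r0 expr0n mulIr_eq0; last exact/rregP.
  by have := p_gt2 D; case: p.-2 p2 => [->|].
have rFN : (r * F (- d) = F d)%R.
  have rp : (r ^+ p.-2.+2 = r)%R by rewrite -p2 Fp_expp.
  apply: (mulfI r0); have -> : (r * (r * F (- d)) = r ^+ p.-2.+2 * F d)%R.
    by rewrite FNE !exprS; ring.
  by rewrite rp.
have sum1 : (\sum_(m | (m != 0) && (m != d)) F m = 1 - F d)%R.
  by rewrite -(sum_gF D) [in RHS](bigD1 0%R)//= [in RHS](bigD1 d) ?d0//= gF0 add0r addrAC subrr add0r.
have sum2 : (\sum_(m | (m != 0) && (m != d)) F (m - d) = 1 - F (- d))%R.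
  rewrite -(sum_gF D) -(sumF_shift F (- d)%R) [in RHS](bigD1 0%R)//= [in RHS](bigD1 d) ?d0//=.
  by rewrite subrr gF0 !add0r addrAC subrr add0r.
(* Summing F m = r F(m - d) over m other than 0 and d gives 1 - F d = r - r F(-d), where r F(-d) = F
   d; hence r = 1. *)
have : (1 - F d = r - F d)%R.
  have -> : (r - F d = r * (1 - F (- d)))%R by rewrite mulrBr mulr1 rFN.
  rewrite -sum1 -sum2 big_distrr/=.
  by apply: eq_bigr => m /andP[m0 md]; exact: FE.
move/addIr => r1; move: rFN; rewrite -r1 mul1r => /esym/eqP.
by rewrite (negbTE Fasym).
Qed.

(** The sections of [bb 0] and [bb (- d)] are powers of [c] away from 0 and -d, and at -d the
    exponent F(-d) vanishes; their commutator lives at 0 alone. *)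
Lemma rist0_comm_expF d : (F d != 0)%R -> (F d != F (- d))%R ->
  (F (- d) = 0)%R -> H [~ b, c ^+ F d].
Proof.
move=> Fd _ FN; exists [~ bb 0%R, bb (- d)%R]; rewrite rhoR; split=> // j.
rewrite secR ?rho_bb// !sec_bb /single opprK subr0.
have [->|j0] := eqVneq j 0%R.
  by rewrite eq_sym oppr_eq0 (negbTE (neqFp0 Fd)) add0r.
have [->|_] := eqVneq j (- d)%R; first by rewrite FN comm1g.
by apply/eqP/commgP; exact: commuteX2.
Qed.

Lemma cramer2 (K : fieldType) (x y z w A B : K) (dt := (x * w - y * z)%R) :
  (dt != 0 -> x * ((A * w - B * y) / dt) + y * ((B * x - A * z) / dt) = A /\
  z * ((A * w - B * y) / dt) + w * ((B * x - A * z) / dt) = B)%R.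
Proof. by rewrite {}/dt => nz; split; field. Qed.

(** The commutator of [bb 0] and [bb (- d)] lives at 0 and -d. A further commutator with an element
    whose section at -d is trivial leaves only position 0. By [gF_independent], such elements exist
    with section [c] or [b] at 0. *)
Lemma lc3_rist0 d : (F d != 0)%R -> (F d != F (- d))%R ->
  (F (- d) != 0)%R -> lc 3 `<=` H.
Proof.
move=> Fd Fasym FN.
have [m [n [m0 n0 md nd det]]] := gF_independent Fd FN Fasym.
set dt := (_ - _)%R in det.
have cE (u v : 'F_p) : u = v -> c ^+ u = c ^+ v by move->.
have solve (A B : 'F_p) : exists k, [/\ rho k = 0%R, sec 0%R k = c ^+ A &
    sec (- d)%R k = c ^+ B].
  exists (bb (- m)%R ^+ ((A * F (n - d) - B * F n) / dt)%R *
          bb (- n)%R ^+ ((B * F m - A * F (m - d)) / dt)%R).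
  rewrite rhoM !rhoX !rho_bb !mul0rn addr0; split=> //;
    rewrite secMs ?rhoX ?rho_bb ?mul0rn// !secXs ?rho_bb// !sec_bb !opprK.
    rewrite ![0%R == _]eq_sym !oppr_eq0 (negbTE m0) (negbTE n0) !add0r !expcF expcD.
    by apply: cE; have [] := cramer2 A B det.
  rewrite !eqr_opp ![d == _]eq_sym (negbTE md) (negbTE nd) !expcF expcD.
  apply: cE; rewrite [(- d + m)%R]addrC [(- d + n)%R]addrC.
  by have [] := cramer2 A B det.
pose u := [~ b, c ^+ F d].
have kP k : rho k = 0%R -> sec (- d)%R k = 1 -> H [~ u, sec 0%R k].
  move=> k0 kd; exists [~ [~ bb 0%R, bb (- d)%R], k]; rewrite rhoR; split=> // j.
  rewrite !secR ?rhoR ?rho_bb// !sec_bb /single opprK subr0.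
  have [->|j0] := eqVneq j 0%R.
    by rewrite eq_sym oppr_eq0 (negbTE (neqFp0 Fd)) add0r.
  have [->|_] := eqVneq j (- d)%R; first by rewrite kd commg1.
  by rewrite (_ : [~ c ^+ _, _] = 1) ?comm1g//; apply/eqP/commgP; exact: commuteX2.
have HN := rist0_normal D.
have Hc : H [~ u, c].
  have [k [k0 kc kd]] := solve 1%R 0%R.
  by have := kP k k0 kd; rewrite kc expc1.
have Hb : H [~ u, b].
  (* [bb 0] has section [b] at 0 and c^(F(-d)) at -d; [k] cancels the latter. *)
  have [k [k0 kc kd]] := solve 0%R (- F (- d))%R.
  have := kP (bb 0%R * k); rewrite rhoM rho_bb k0 addr0 !(secMs _ k (rho_bb D 0%R)) kc kd !sec_bb.
  rewrite eqxx oppr_eq0 (negbTE (neqFp0 Fd)) subr0 expcD subrr mulg1.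
  by apply.
apply: lc3_min => //.
apply: (normal_expc (commutant_normal HN) Fd).
exact: (commutant_mem HN Hc Hb).
Qed.

(** Modulo gamma_3, sections in G' become multiples of [b, c]. The commutator of [bb 0] and
    [bb (- d)] has F d at 0 and - F(-d) at -d. Weighted sums of its shifts telescope, and after p of
    them both positions are 0, which leaves F(d)^p - F(-d)^p = F d - F(-d), not 0. *)
Lemma rist0_lc2_nondegenerate d : (F d != 0)%R -> (F d != F (- d))%R ->
  lc 3 `<=` H -> H [~ c, b].
Proof.
move=> Fd Fasym L3H.
pose u := lv 2 [~ b, c].
pose P e := exists2 h, R h & forall j, lc 2 (h j) /\ lv 2 (h j) = (e j *: u)%R.
have PD e1 e2 : P e1 -> P e2 -> P (fun j => e1 j + e2 j)%R.
  move=> [h1 R1 E1] [h2 R2 E2]; exists (fun j => h1 j * h2 j); first exact: stab_sectionsM.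
  move=> j; have [[L1 v1] [L2 v2]] := (E1 j, E2 j).
  by split; [exact: lcM|rewrite lvM// v1 v2 scalerDl].
have PZ (a : 'F_p) e1 : P e1 -> P (fun j => a * e1 j)%R.
  move=> [h1 R1 E1]; exists (fun j => h1 j ^+ a); first exact: stab_sectionsX.
  move=> j; have [L1 v1] := E1 j.
  by split; [exact: lcX|rewrite lvX// v1 -scaleFpE scalerA].
have PS d' e1 : P e1 -> P (fun j => e1 (j + d')%R).
  by move=> [h1 R1 E1]; exists (fun j => h1 (j + d')%R) => //; exact: stab_sections_shift.
have L2 x y : lc 2 [~ x, y] by apply: lcR; exact: lcT.
have uE (a : 'F_p) : lv 2 [~ b, c ^+ a] = (a *: u)%R.
  by rewrite lv2_comm rhoX phiX rho_b phi_b rho_c phi_c natFpK mul0rn mul0r mul1r sub0r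
    scaleNr -scalerN -lvV ?invgR.
have P1 : P (fun j => (j == 0)%:R * F d - (j == - d)%:R * F (- d))%R.
  exists (fun j => sec j [~ bb 0%R, bb (- d)%R]).
    by exists [~ bb 0%R, bb (- d)%R]; rewrite rhoR.
  move=> j; rewrite secR ?rho_bb// !sec_bb opprK subr0; split; first exact: L2.
  have [->|j0] := eqVneq j 0%R.
    rewrite eq_sym oppr_eq0 (negbTE (neqFp0 Fd)) add0r.
    by rewrite mul1r mul0r subr0.
  have [->|jd] := eqVneq j (- d)%R.
    by rewrite -invgR lvV// uE mul0r sub0r mul1r scaleNr.
  rewrite !mul0r subr0 scale0r (_ : [~ _, _] = 1) ?lv1//.
  by apply/eqP/commgP; exact: commuteX2.
have Pk k : P (fun j => (j == 0)%:R * F d ^+ k.+1 - (j == - d *+ k.+1)%:R * F (- d) ^+ k.+1)%R.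
  elim: k => [//|k IHk].
  have [h Rh hE] := PD _ _ (PZ (F d) _ IHk) (PZ (F (- d) ^+ k.+1)%R _ (PS (d *+ k.+1)%R _ P1)).
  exists h => // j; have [hL ->] := hE j; split=> //; congr (_ *: _)%R.
  have -> : (j + d *+ k.+1 == 0)%R = (j == - d *+ k.+1)%R by rewrite addr_eq0 mulNrn.
  have -> : (j + d *+ k.+1 == - d)%R = (j == - d *+ k.+2)%R.
    by rewrite -subr_eq0 -[RHS]subr_eq0 mulNrn !opprK [in RHS]mulrSr addrA.
  by rewrite [in RHS](exprS _ k.+1) [in RHS](exprS _ k.+1); ring.
have [q pE] : exists q, p = q.+1 by exists p.-1; rewrite prednK// prime_gt0// (ggs_prime D).
have [h Rh hE] := Pk q; rewrite -pE in hE.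
pose a := (F d - F (- d))%R.
have a0 : (a != 0)%R by rewrite subr_eq0.
have dp : (- d *+ p = 0)%R.
  by rewrite -mulr_natr pchar_Fp_0 ?mulr0// (ggs_prime D).
(* The sections away from 0 now lie in gamma_3, hence in [H], and can be divided out. *)
have h0 : H (h 0%R).
  apply: (@stab_sections_ext _ _ D (fun j => h j * (if j == 0%R then 1 else (h j)^-1))).
    by move=> j; rewrite /single; case: eqP => [->|_]; rewrite ?mulg1 ?mulgV.
  apply: stab_sectionsM => //; apply: stab_sections_all => j.
  case: (eqVneq j 0%R) => [_|j0].
    by have [[]] := rist0_normal D.
  have [[_ _ HV] _] := rist0_normal D; apply/HV/L3H.
  have [hL hv] := hE j; apply/(lv0P D) => //; rewrite hv (negbTE j0).
  rewrite dp (negbTE j0).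
  by rewrite !mul0r subr0 scale0r.
have HN := rist0_normal D.
apply: normal_commC => //.
have [hL hv] := hE 0%R; have [[H1 HM HV] _] := HN.
have /L3H Hu : lc 3 ((h 0%R ^+ (a^-1)%R)^-1 * [~ b, c]).
  apply: (lvE (D := D)); rewrite ?lvX//; first exact: lcX.
  rewrite hv dp eqxx !mul1r !Fp_expp -/a.
  by rewrite -scaleFpE scalerA mulVf// scale1r.
rewrite -[[~ b, c]](mulVKg (h 0%R ^+ (a^-1)%R)); apply: HM => //.
exact: (subgroupX _ (proj1 HN) h0).
Qed.

Lemma rist0_comm : H [~ c, b].
Proof.
have [d [Fasym Fd]] := gF_asym D; have HN := rist0_normal D.
have [FN|FN] := eqVneq (F (- d)%R) 0%R.
  exact: (normal_expc HN Fd (rist0_comm_expF Fd Fasym FN)).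
exact: (rist0_lc2_nondegenerate Fd Fasym (lc3_rist0 Fd Fasym FN)).
Qed.

(* G is a branch group over its commutator subgroup. *)
Lemma lc2_sections h : (forall j, lc 2 (h j)) -> R h.
Proof.
move=> hL; apply: stab_sections_all => i.
exact: (lc2_min (rist0_normal D) rist0_comm (hL i)).
Qed.

End BranchTheorem.

(** * Lower central series and rigid stabilizers *)

Section Rigid.
Variables (p : nat) (G : groupType) (D : ggs_data p G).
Implicit Types (g k s t x y : G) (h : 'F_p -> G) (i m n q : nat) (j : 'F_p).
Local Notation c := (gc D).
Local Notation rho := (rho D).
Local Notation sec := (sec D).
Local Notation lv := (lv D).

(** Sections in G' can always be prescribed; the lemmas below assume them there, so the default 1
    does not matter. *)
Definition with_sections h : G :=
  if pselect (stab_sections D h) is left hP then projT1 (cid hP) else 1.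
Local Notation ws := with_sections.

Lemma with_sectionsP h : (forall j, lc 2 (h j)) ->
  rho (ws h) = 0%R /\ forall j, sec j (ws h) = h j.
Proof.
move=> /lc2_sections-/(_ D) Rh; rewrite /ws; case: pselect => // Rh'.
by case: cid.
Qed.

Lemma rho_ws h : (forall j, lc 2 (h j)) -> rho (ws h) = 0%R.
Proof. by move=> /with_sectionsP[]. Qed.

Lemma sec_ws h : (forall j, lc 2 (h j)) -> forall j, sec j (ws h) = h j.
Proof. by move=> /with_sectionsP[]. Qed.

Lemma ws_eq h s : rho s = 0%R -> (forall j, lc 2 (h j)) -> (forall j, sec j s = h j) ->
  ws h = s.
Proof. by move=> s0 hL sE; apply: (sec_inj (D := D)) => [|j]; rewrite ?rho_ws ?s0// sec_ws. Qed.

Definition rigid i : set G := [set k | rho k = 0%R /\ forall j, lc i (sec j k)].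
Local Notation K := rigid.

Lemma rigid_subgroup i : is_subgroup (K i).
Proof.
split=> [|x y [x0 xL] [y0 yL]|x [x0 xL]].
- by split=> [|j]; rewrite ?rho1 ?sec1//; exact: lc1.
- by split=> [|j]; rewrite ?rhoM ?x0 ?y0 ?addr0// secMs//; exact: lcM.
- by split=> [|j]; rewrite ?rhoV ?x0 ?oppr0// secVs//; exact: lcV.
Qed.

Lemma rigidM i x y : K i x -> K i y -> K i (x * y).
Proof. by case: (rigid_subgroup i) => _ + _; apply. Qed.
Lemma rigidV i x : K i x -> K i x^-1.
Proof. by case: (rigid_subgroup i) => _ _; apply. Qed.

Lemma rigidJ i x g : K i x -> K i (x ^ g).
Proof.
by move=> [x0 xL]; split=> [|j]; rewrite ?rhoJ// secJ//; exact: lcJ.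
Qed.

Lemma rigidR i x g : K i x -> K i [~ x, g].
Proof. by move=> Kx; apply: rigidM; [exact: rigidV|exact: rigidJ]. Qed.

Lemma rigid_le i m x : (i <= m)%N -> K m x -> K i x.
Proof. by move=> im [x0 xL]; split=> // j; exact: lc_le (xL j). Qed.

Lemma rigidRs i x t : rho t = 0%R -> K i x -> K i.+1 [~ x, t].
Proof.
move=> t0 [x0 xL]; split=> [|j]; first exact: rhoR.
by rewrite secR//; exact: lcR.
Qed.

Lemma rigid_lv0 i x : K i x -> (forall j, lv i (sec j x) = 0%R) -> K i.+1 x.
Proof. by move=> [x0 xL] v0; split=> // j; apply/(lv0P D). Qed.

Lemma rigid_ws i h : (1 < i)%N -> (forall j, lc i (h j)) -> K i (ws h).
Proof.
move=> i1 hL; have hL2 j : lc 2 (h j) by exact: lc_le (hL j).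
by split=> [|j]; rewrite ?rho_ws// sec_ws.
Qed.

Lemma single_lc i (j : 'F_p) x : lc i x -> forall l, lc i (single j x l).
Proof. by move=> xL l; rewrite /single; case: eqP => // _; exact: lc1. Qed.

Definition at_letter (j : 'F_p) x := ws (single j x).

Lemma at_letterM j x y : lc 2 x -> lc 2 y ->
  at_letter j (x * y) = at_letter j x * at_letter j y.
Proof.
move=> xL yL; have [xS yS] := (single_lc j xL, single_lc j yL).
apply: ws_eq; first by rewrite rhoM !rho_ws// addr0.
  by apply: single_lc; exact: lcM.
by move=> l; rewrite secMs ?rho_ws// !sec_ws// /single; case: eqP; rewrite ?mulg1.
Qed.

Lemma at_letterV j x : lc 2 x -> at_letter j x^-1 = (at_letter j x)^-1.
Proof.
move=> xL; have xS := single_lc j xL.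
apply: ws_eq; first by rewrite rhoV rho_ws// oppr0.
  by apply: single_lc; exact: lcV.
by move=> l; rewrite secVs ?rho_ws// !sec_ws// /single; case: eqP; rewrite ?invg1.
Qed.

Lemma at_letterJ j x t : rho t = 0%R -> lc 2 x ->
  at_letter j (x ^ sec j t) = at_letter j x ^ t.
Proof.
move=> t0 xL; have xS := single_lc j xL.
apply: ws_eq; first by rewrite rhoJ rho_ws.
  by apply: single_lc; exact: lcJ.
move=> l; rewrite secJs ?rho_ws// !sec_ws// /single.
by case: eqP => [->//|]; rewrite ?conj1g.
Qed.

Lemma at_letterR j x t : rho t = 0%R -> lc 2 x ->
  at_letter j [~ x, sec j t] = [~ at_letter j x, t].
Proof.
by move=> t0 xL; rewrite /commg at_letterM ?at_letterV ?at_letterJ//; [exact: lcV|exact: lcJ].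
Qed.

Lemma at_letter0 j x : lc 2 x -> at_letter 0%R x = at_letter j x ^ (c ^+ j).
Proof.
move=> xL; have xS := single_lc j xL.
apply: ws_eq; first by rewrite rhoJ rho_ws.
  exact: single_lc.
move=> l; rewrite secJcX ?rho_ws// sec_ws// /single natFpK.
by rewrite -subr_eq0 addrK.
Qed.

Lemma rigid_at i j x : (1 < i)%N -> lc i x -> K i (at_letter j x).
Proof. by move=> i1 xL; apply: rigid_ws => //; exact: single_lc. Qed.

Lemma ws_rcons h (r : seq 'F_p) j : (forall l, lc 2 (h l)) -> j \notin r ->
  ws (fun l => if l \in j :: r then h l else 1) =
  at_letter j (h j) * ws (fun l => if l \in r then h l else 1).
Proof.
move=> hL jr; have S l : lc 2 (if l \in r then h l else 1).
  by case: ifP => _ //; exact: lc1.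
have jS := single_lc j (hL j).
apply: ws_eq; first by rewrite rhoM !rho_ws// addr0.
  by move=> l; case: ifP => _ //; exact: lc1.
move=> l; rewrite secMs ?rho_ws// !sec_ws// /single in_cons.
by have [->|_] := eqVneq l j; rewrite ?(negbTE jr) ?mulg1 ?mul1g.
Qed.

Lemma rigid_prod i k : (1 < i)%N -> K i k ->
  k = ws (fun l => if l \in enum 'F_p then sec l k else 1).
Proof.
move=> i1 [k0 kL]; apply/esym/ws_eq => // l; rewrite mem_enum//.
exact: lc_le (kL l).
Qed.

Lemma rigid_mem k (H : set G) : is_subgroup H -> K 2 k ->
  (forall j, H (at_letter j (sec j k))) -> H k.
Proof.
move=> [H1 HM HV] Kk Hat; rewrite (rigid_prod (isT : 1 < 2)%N Kk).
have kL l : lc 2 (sec l k) by case: Kk.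
elim: (enum 'F_p) (enum_uniq 'F_p) => [_|j r IHr /= /andP[jr ur]].
  suff -> : ws (fun l => if l \in [::] then sec l k else 1) = 1 by [].
  by apply: ws_eq; rewrite ?rho1// => j; rewrite ?sec1//; exact: lc1.
by rewrite ws_rcons//; apply: HM; [exact: Hat|exact: IHr].
Qed.

Lemma rigid_min i (H : set G) : (1 < i)%N -> is_subgroup H ->
  (forall j x, lc i x -> H (at_letter j x)) -> K i `<=` H.
Proof.
move=> i1 HG Hat k Kk; apply: rigid_mem => // [|j]; first exact: rigid_le Kk.
by apply: Hat; case: Kk.
Qed.

(** The element [x, g] placed at 0 is the commutator of x placed at 0 with a stabilizing element
    whose section at 0 is g. *)
Lemma rigidS i m : (1 < i)%N -> K i `<=` lc m -> K i.+1 `<=` lc m.+1.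
Proof.
move=> i1 KL; apply: rigid_min; [exact: ltnW|exact: lc_subgroup|].
move=> j x xL.
suff: [set x | lc 2 x /\ lc m.+1 (at_letter 0%R x)] x.
  move=> [x2 x0]; rewrite -[at_letter j x](conjgK (c ^+ j)).
  by rewrite -at_letter0//; exact: lcJ.
move: x xL; apply: lcR_min; first exact: ltnW.
  split=> [|x y [x2 xL] [y2 yL]|x [x2 xL]] /=.
  - split; first exact: lc1.
    suff -> : at_letter 0%R (1 : G) = 1 by exact: lc1.
    apply: ws_eq; rewrite ?rho1// => l; rewrite ?sec1 /single.
      by case: ifP => _; exact: lc1.
    by case: ifP.
  - by split; [exact: lcM|rewrite at_letterM//; exact: lcM].
  - by split; [exact: lcV|rewrite at_letterV//; exact: lcV].
move=> x g xL; have x2 : lc 2 x by exact: lc_le xL.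
split; first by apply: lcS; exact: lcR.
have [t t0 <-] := sec0_surj D g.
by rewrite at_letterR//; apply: lcR; apply: KL; exact: rigid_at.
Qed.

(** Conjugation by [c] moves a section to another position without changing the class modulo
    gamma_(m+1), so all positions contribute through the same [E]; [rigidS] makes it well
    defined. *)
Lemma rigid_layer i m : (1 < i)%N -> K i `<=` lc m ->
  exists E : {linear layer D i -> layer D m},
    forall k, K i k -> lv m k = (\sum_j E (lv i (sec j k)))%R.
Proof.
move=> i1 KL; have atL j x : lc i x -> lc m (at_letter j x).
  by move=> xL; apply: KL; exact: rigid_at.
have i2 x : lc i x -> lc 2 x by exact: lc_le.
have t_map : layer_map i (fun x => lv m (at_letter 0%R x)).
  split=> [x y xL yL|x xL].
    by rewrite at_letterM ?lvM//; auto.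
  by apply: lv0; apply: (rigidS i1 KL); apply: rigid_at => //; exact: ltnW.
have [E EE] := layer_mapP D t_map; exists E => k Kk; have [k0 kL] := Kk.
have kL2 j : lc 2 (sec j k) by exact: i2.
have rL (r : seq 'F_p) l : lc i (if l \in r then sec l k else 1).
  by case: ifP => _ //; exact: lc1.
rewrite {1}(rigid_prod i1 Kk) -[in RHS]big_enum.
elim: (enum 'F_p) (enum_uniq 'F_p) => [_|j r IHr /= /andP[jr ur]].
  rewrite big_nil (_ : ws _ = 1) ?lv1//.
  by apply: ws_eq; rewrite ?rho1// => j; rewrite ?sec1//; exact: lc1.
rewrite ws_rcons// lvM ?IHr// ?big_cons; last by apply: KL; exact: rigid_ws.
  by rewrite -EE// (at_letter0 j)// lvJ//; exact: atL.
exact: atL.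
Qed.

End Rigid.

(** * The depth of the rigid stabilizers in the lower central series *)

Section LowerBounds.
Variables (p : nat) (G : groupType) (D : ggs_data p G).
Implicit Types (g s t x y : G) (h : 'F_p -> G) (i k m n q : nat) (j : 'F_p).
Local Notation c := (gc D).
Local Notation b := (gb D).
Local Notation X := (gX D).
Local Notation F := (gF D).
Local Notation rho := (rho D).
Local Notation sec := (sec D).
Local Notation lv := (lv D).
Local Notation ad := (ad D).
Local Notation K := (rigid D).
Local Notation ws := (with_sections D).

Lemma ad_secb n j (z : layer D n) :
  ad n (sec j b) z = (F (j + 1) *: ad n c z + (j == -1)%:R *: ad n b z)%R.
Proof.
rewrite sec_b; case: eqP => [->|_].
  by rewrite addNr gF0 scale0r add0r scale1r.
by rewrite adX natFpK scale0r addr0.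
Qed.

(** The exponents [gF] sum to 1 and the recursive section contributes [b] once, so together the
    sections of [b] act as [X]. *)
Lemma sum_ad_secb n (z : layer D n) : (\sum_j ad n (sec j b) z = ad n X z)%R.
Proof.
under eq_bigr do rewrite ad_secb.
rewrite big_split/= -!scaler_suml (sumF_shift F 1%R) sum_gF scale1r.
rewrite -[in X in (_ + X)%R]natr_sum (bigD1 (-1)%R)//= big1 ?eqxx => [|j /negbTE->//].
by rewrite addn0 scale1r ad_X addrC.
Qed.

Lemma sum_index_ad_secb n (z : layer D n) :
  (\sum_j j *: ad n (sec j b) z = delta D *: ad n c z - ad n X z)%R.
Proof.
under eq_bigr do rewrite ad_secb scalerDr !scalerA.
rewrite big_split/= -!scaler_suml.
have -> : (\sum_j j * F (j + 1) = delta D - 1)%R.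
  transitivity (delta D - \sum_d F d)%R; last by rewrite sum_gF.
  rewrite /delta -sumrB -[RHS](sumF_shift _ 1%R); apply: eq_bigr => j _.
  by rewrite mulrDl mul1r addrK.
have -> : (\sum_j j * (j == -1)%:R = -1 :> 'F_p)%R.
  rewrite (bigD1 (-1)%R)//= eqxx mulr1 big1 ?addr0// => j /negbTE->.
  by rewrite mulr0.
by rewrite ad_X scalerBl scale1r scaleN1r opprD addrA addrAC.
Qed.

(** Binomial coefficients are chosen because commuting with [c] takes the difference of sections at
    j + 1 and j, which lowers q by 1. *)
Definition bin q x := ws (fun j => x ^+ 'C(j, q)).

Lemma rho_bin q x : lc 2 x -> rho (bin q x) = 0%R.
Proof. by move=> xL; apply: rho_ws => j; exact: lcX. Qed.

Lemma sec_bin q x j : lc 2 x -> sec j (bin q x) = x ^+ 'C(j, q).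
Proof. by move=> xL; rewrite sec_ws// => l; exact: lcX. Qed.

Lemma rigid_bin i q x : (1 < i)%N -> lc i x -> K i (bin q x).
Proof. by move=> i1 xL; apply: rigid_ws => // j; exact: lcX. Qed.

Lemma lv_sec_bin i q x j : (1 < i)%N -> lc i x ->
  lv i (sec j (bin q x)) = ('C(j, q)%:R *: lv i x)%R.
Proof. by move=> i1 xL; rewrite sec_bin; [rewrite lvX// scaler_nat|exact: lc_le xL]. Qed.

(** Pascal's rule, except at j = p - 1, where j + 1 wraps to 0; there p divides the binomial
    coefficient of p over q + 1. *)
Lemma bin_shift q j : (q.+1 < p)%N ->
  ('C((j + 1)%R, q.+1)%:R - 'C(j, q.+1)%:R = 'C(j, q)%:R :> 'F_p)%R.
Proof.
move=> qp; have jp := Fp_lt D j.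
have -> : (j + 1)%R = (j.+1 %% p) :> nat.
  by rewrite (val_FpD D) -[j.+1]addn1.
have [jp1|jp1] := ltnP j.+1 p.
  by rewrite modn_small// binS natrD addrAC subrr add0r.
have {jp1} jE : j.+1 = p by apply/eqP; rewrite eqn_leq jp jp1.
rewrite jE modnn bin0n/= sub0r; apply/eqP; rewrite eq_sym -addr_eq0 -natrD.
rewrite addnC -binS jE (natFp0 D) prime_dvd_bin//; exact: (ggs_prime D).
Qed.

Lemma comm_bin0 x : lc 2 x -> [~ bin 0 x, c] = 1.
Proof.
move=> xL; apply: (sec_inj1 (D := D)) => [|j]; first exact: rhoR.
by rewrite secRc ?rho_bin// !sec_bin// !bin0 mulVg.
Qed.

Lemma comm_bin i q x : (1 < i)%N -> (q.+1 < p)%N -> lc i x ->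
  K i.+1 ((bin q x)^-1 * [~ bin q.+1 x, c]).
Proof.
move=> i1 qp xL; have x2 := lc_le i1 xL.
apply: rigid_lv0 => [|j].
  by apply: rigidM; [apply: rigidV; exact: rigid_bin|apply: rigidR; exact: rigid_bin].
have b0 := rho_bin _ x2.
rewrite secMs ?rhoV ?b0 ?oppr0// secVs// secRc// !sec_bin//.
rewrite !(lvM, lvV, lvX)//; try (by repeat first [exact: lcX | apply: lcV | apply: lcM]).
by rewrite -!scaler_nat [X in (_ + X)%R]addrC -scalerBl (bin_shift _ qp) addNr.
Qed.

Lemma comm_bin_lc i q x m : (1 < i)%N -> (q.+1 < p)%N -> lc i x ->
  K i.+1 `<=` lc m.+1 -> lc m (bin q.+1 x) -> lc m.+1 (bin q x).
Proof.
move=> i1 qp xL KL bL; have /KL/lcV kL := comm_bin i1 qp xL.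
have := lcM (lcR c bL) kL; rewrite invgM invgK mulgA mulgV mul1g; exact.
Qed.

Lemma ad_bin i q x m : (1 < i)%N -> (q.+1 < p)%N -> lc i x ->
  K i.+1 `<=` lc m.+2 -> lc m (bin q.+1 x) ->
  ad m c (lv m (bin q.+1 x)) = lv m.+1 (bin q x).
Proof.
move=> i1 qp xL KL bL; have kL := KL _ (comm_bin i1 qp xL).
have bL' := comm_bin_lc i1 qp xL (fun u Ku => lcS (KL u Ku)) bL.
rewrite -adE// -[[~ _, c]](mulVKg (bin q x)) lvM//; last exact: lcS kL.
by rewrite (lv0 D kL) addr0.
Qed.

(** Each commutator with [c] lowers q and raises the degree by 1. The error terms lie in K_(i+1),
    which caps the degree at m. *)
Lemma bin_desc i x n m l : (1 < i)%N -> lc i x -> (l < p)%N ->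
  K i.+1 `<=` lc m -> lc n (bin p.-1 x) -> lc (minn (n + l) m) (bin (p.-1 - l) x).
Proof.
move=> i1 xL lp KL bL; elim: l lp => [|l IHl] lp.
  by rewrite addn0 subn0; apply: lc_le bL; exact: geq_minl.
have {}IHl := IHl (ltnW lp).
have lE : (p.-1 - l = (p.-1 - l.+1).+1)%N by lia.
rewrite lE in IHl.
have qp : ((p.-1 - l.+1).+1 < p)%N by lia.
case: (leqP m (n + l)) => nm.
  have /minn_idPr mE := leq_trans nm (leqnSn (n + l)); rewrite addnS mE.
  move: IHl; rewrite (minn_idPr nm) => IHl.
  have /KL/lcV kL := comm_bin i1 qp xL.
  have := lcM (lcS (lcR c IHl)) kL; rewrite invgM invgK mulgA mulgV mul1g; exact.
rewrite addnS (minn_idPl nm); rewrite (minn_idPl (ltnW nm)) in IHl.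
by apply: (comm_bin_lc i1 qp xL) IHl => k /KL; exact: lc_le.
Qed.

Definition engel n : G := iter n.-1 (fun x => [~ x, X]) c.
Local Notation w := engel.

Lemma engelS n : w n.+2 = [~ w n.+1, X]. Proof. by []. Qed.

Lemma engel_lc n : lc n (w n).
Proof.
by case: n => [|n]; [exact: lcT|elim: n => [|n IHn]; [exact: lcT|exact: lcR]].
Qed.

Lemma lv_engelS n : (0 < n)%N -> lv n.+1 (w n.+1) = ad n X (lv n (w n)).
Proof. by case: n => // n _; rewrite -adE//; exact: engel_lc. Qed.

(* gamma_(n+1) / gamma_(n+2) = [gamma_n, X] + <[w_n, c]> *)
Definition layer_gen n := forall z : layer D n,
  exists z' (r : 'F_p), ad n c z = (ad n X z' + r *: ad n c (lv n (w n)))%R.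

Definition layer_rank2 n := exists y : layer D n, span2 (lv n (w n)) y.

Lemma layer_gen0 n (V : lmodType 'F_p) (E : {linear layer D n.+1 -> V}) :
  (0 < n)%N -> layer_gen n -> (forall z, E (ad n X z) = 0%R) ->
  E (ad n c (lv n (w n))) = 0%R -> forall z, E z = 0%R.
Proof.
move=> n0 gen EX Ew.
have Ec z : E (ad n c z) = 0%R.
  have [z' [r ->]] := gen z.
  by rewrite linearD linearZ/= EX Ew scaler0 addr0.
apply: layer_ind => //=; first exact: linear0.
- by move=> y z Ey Ez; rewrite linearD Ey Ez addr0.
- by move=> z Ez; rewrite linearN Ez oppr0.
- by move=> z; have := EX z; rewrite ad_X linearD/= Ec addr0.
Qed.

(** All sections of [bin 0 x] equal x, so [sum_ad_secb] computes the trace of the commutator. *)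
Lemma rigid_bin0_comm i m (E : {linear layer D i.+1 -> layer D m}) x :
  (forall k : G, K i.+1 k -> lv m k = (\sum_j E (lv i.+1 (sec j k)))%R) ->
  (1 < i)%N -> lc i x -> lv m [~ bin 0 x, b] = E (ad i X (lv i x)).
Proof.
move=> EE i1 xL; have x2 : lc 2 x by exact: lc_le xL.
rewrite EE; last by apply: rigidRs; [exact: rho_b|exact: rigid_bin].
rewrite -sum_ad_secb linear_sum; apply: eq_bigr => j _.
by rewrite secR ?rho_b ?rho_bin// sec_bin// bin0 expg1 adE.
Qed.

(** The extra degree for w_(k+1) explains why w^(q+1) and y^(q) pass through the factors
    together. *)
Definition rigid_bound k :=
  K k.+1 `<=` lc (p * k).-1 /\ lc (p * k) (bin p.-1 (w k.+1)).

(** The degree of K_(k+2) is raised one by one, by showing E = 0. By [layer_gen] it suffices that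
    [E] kills all [x, X] and [w_(k+1), c]. *)
Lemma rigid_boundS k : (0 < k)%N -> layer_gen k.+1 -> rigid_bound k -> rigid_bound k.+1.
Proof.
move=> k0 gen [KL wL]; have wk : lc k.+1 (w k.+1) by exact: engel_lc.
have x2 x : lc k.+1 x -> lc 2 x by exact: lc_le.
have p2 := p_gt2 D; have i1 : (1 < k.+1)%N by [].
have pk : (p <= p * k)%N by rewrite leq_pmulr.
have KL' : K k.+2 `<=` lc (p * k.+1).-1.
  suff: forall m, (m <= (p * k.+1).-1)%N -> K k.+2 `<=` lc m by apply.
  elim=> [_ x _|m IHm mp]; first exact: lcT.
  have {}IHm := IHm (ltnW mp).
  have [E EE] := rigid_layer (ltnW i1 : 1 < k.+2)%N IHm.
  have bin0L x : lc k.+1 x -> lc m (bin 0 x).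
    move=> xL; have := bin_desc i1 xL (_ : p.-1 < p)%N IHm (KL _ (rigid_bin p.-1 i1 xL)).
    by rewrite subnn => /(_ _)/lc_le; apply; lia.
  (* E([x, X]) is the class in degree m of [x^(0), b], which has degree at least m + 1. *)
  have EX z : E (ad k.+1 X z) = 0%R.
    have [x xL ->] := lv_surj z; have bL := bin0L x xL.
    by rewrite -(rigid_bin0_comm EE) // (lv0 D (lcR b bL)).
  have E0 : forall z, E z = 0%R.
    (* The sections of w^(1) are the powers w^j, so the trace of [w^(1), b] is the first moment
       delta [w, c] - [w, X]. As [E] kills [w, X], delta times E([w, c]) vanishes. *)
    apply: (layer_gen0 (isT : 0 < k.+1) gen EX).
    have wL2 := x2 _ wk.
    have bL : lc m (bin 1 (w k.+1)).
      have := bin_desc i1 wk (_ : p.-2 < p)%N IHm wL.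
      have -> : (p.-1 - p.-2 = 1)%N by lia.
      by move=> /(_ _)/lc_le; apply; lia.
    have KR : K k.+2 [~ bin 1 (w k.+1), b].
      by apply: rigidRs; [exact: rho_b|exact: rigid_bin].
    have := EE _ KR; rewrite (lv0 D (lcR b bL)) => /esym.
    under eq_bigr => j _.
      rewrite secR ?rho_b ?rho_bin// sec_bin// bin1.
      rewrite adE ?lvX -?scaleFpE//; last exact: lcX.
      rewrite linearZ/=.
      over.
    rewrite -linear_sum/= sum_index_ad_secb linearB linearZ/= EX subr0 => /eqP.
    by rewrite scaler_eq0 (negbTE (delta_gF D)) => /eqP.
  move=> k' Kk; apply/(lv0P D); first exact: IHm.
  by rewrite EE// big1.
split=> //.
have [E EE] := rigid_layer (ltnW i1 : 1 < k.+2)%N KL'.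
have bL : lc (p * k.+1).-1 (bin 0 (w k.+1)).
  have := bin_desc i1 wk (_ : p.-1 < p)%N KL' wL.
  by rewrite subnn => /(_ _)/lc_le; apply; lia.
have pkS : ((p * k.+1).-1.+1 = p * k.+1)%N by rewrite prednK// muln_gt0; lia.
rewrite -pkS; apply/(lv0P D); first by apply: KL'; apply: rigid_bin; [|exact: engel_lc].
(* Here w^(0) has degree p (k + 1) - 1, one more than a general x^(0), and [w^(0), b] has trace
   w_(k+2). *)
have Ew : E (lv k.+2 (w k.+2)) = 0%R.
  by rewrite lv_engelS// -(rigid_bin0_comm EE)// (lv0 D (lcR b bL)).
rewrite EE; last by apply: rigid_bin; [|exact: engel_lc].
apply: big1 => j _; rewrite lv_sec_bin ?linearZ//=; last exact: engel_lc.
by rewrite Ew scaler0.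
Qed.

End LowerBounds.

(** * Ranks of the lower central factors *)

Section LayerStates.
Variables (p : nat) (G : groupType) (D : ggs_data p G).
Implicit Types (i m n q : nat).
Local Notation c := (gc D).
Local Notation b := (gb D).
Local Notation lv := (lv D).
Local Notation ad := (ad D).
Local Notation w := (engel D).
Local Open Scope ring_scope.

Definition in_span2 (V : lmodType 'F_p) (u v z : V) := exists r s : 'F_p, z = r *: u + s *: v.

Lemma in_span2D (V : lmodType 'F_p) (u v y z : V) :
  in_span2 u v y -> in_span2 u v z -> in_span2 u v (y + z).
Proof.
move=> [r [s ->]] [r' [s' ->]]; exists (r + r'), (s + s').
by rewrite !scalerDl addrACA.
Qed.

Lemma in_span2Z (V : lmodType 'F_p) (u v z : V) a :
  in_span2 u v z -> in_span2 u v (a *: z).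
Proof. by move=> [r [s ->]]; exists (a * r), (a * s); rewrite scalerDr !scalerA. Qed.

Lemma in_span2r (V : lmodType 'F_p) (u v : V) s : in_span2 u v (s *: v).
Proof. by exists 0, s; rewrite scale0r add0r. Qed.

Lemma in_span2_0 (V : lmodType 'F_p) (u v : V) : in_span2 u v 0.
Proof. by exists 0, 0; rewrite !scale0r addr0. Qed.

Lemma span2S n (A B : layer D n) (A' B' : layer D n.+1) : (0 < n)%N -> span2 A B ->
  in_span2 A' B' (ad n c A) -> in_span2 A' B' (ad n b A) ->
  in_span2 A' B' (ad n c B) -> in_span2 A' B' (ad n b B) -> span2 A' B'.
Proof.
move=> n0 AB cA bA cB bB; apply: (layer_ind (P := in_span2 A' B')) => //.
- exact: in_span2_0.
- exact: in_span2D.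
- by move=> z; rewrite -scaleN1r; exact: in_span2Z.
- move=> z; have [r [s ->]] := AB z; rewrite linearD !linearZ/=.
  by apply: in_span2D; exact: in_span2Z.
- move=> z; have [r [s ->]] := AB z; rewrite linearD !linearZ/=.
  by apply: in_span2D; exact: in_span2Z.
Qed.

(** The nonzero coordinate on A keeps w_n and B a spanning pair, whatever multiple of B has
    accumulated in w_n. *)
Definition layer_state n (A B : layer D n) : Prop :=
  span2 A B /\ exists r s : 'F_p, r != 0 /\ lv n (w n) = r *: A + s *: B.

Lemma layer_state_rank2 n (A B : layer D n) : layer_state A B -> layer_rank2 D n.
Proof.
move=> [AB [r [s [r0 wE]]]]; exists B => z; have [t [u ->]] := AB z.
exists (t / r), (u - t / r * s); rewrite wE scalerDr !scalerA mulfVK//.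
by rewrite scalerBl -addrA; congr (_ + _); rewrite addrC subrK.
Qed.

Section Steps.
Variables (n : nat) (A B : layer D n) (A' B' : layer D n.+1).
Hypotheses (n0 : (0 < n)%N) (st : layer_state A B).

(** Inside a block [b] acts as zero, so [X] acts as [c]. *)
Lemma layer_state_shift :
  ad n c A = A' -> ad n c B = B' -> ad n b A = 0 -> ad n b B = 0 ->
  layer_state A' B' /\ layer_gen D n.
Proof.
move: st => [AB [r [s [r0 wE]]]] cA cB bA bB; split; first split.
- apply: (span2S n0 AB); rewrite ?bA ?bB ?cA ?cB; try exact: in_span2_0.
    by exists 1, 0; rewrite scale1r scale0r addr0.
  by exists 0, 1; rewrite scale1r scale0r add0r.
- exists r, s; split=> //; rewrite lv_engelS// wE linearD !linearZ/= !ad_X.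
  by rewrite bA bB cA cB !add0r.
- move=> z; exists z, 0; rewrite scale0r addr0 ad_X.
  have [t [u ->]] := AB z; rewrite ![ad n b _]linearD/= !linearZ/= bA bB.
  by rewrite !scaler0 addr0 add0r.
Qed.

(** Used with A = w^(1) and B = y^(0), while B' already comes from K_(k+2): [c] kills B, and all
    errors are multiples of B'. *)
Lemma layer_state_end (s1 s2 s3 : 'F_p) :
  ad n c A = A' + s1 *: B' -> ad n c B = 0 -> ad n b A = s2 *: B' ->
  ad n b B = s3 *: B' -> layer_state A' B' /\ layer_gen D n.
Proof.
move: st => [AB [r [s [r0 wE]]]] cA cB bA bB; split; first split.
- apply: (span2S n0 AB); rewrite ?bA ?bB ?cA ?cB; try exact: in_span2r.
    by exists 1, s1; rewrite scale1r.
  exact: in_span2_0.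
- exists r, (r * (s1 + s2) + s * s3); split=> //.
  rewrite lv_engelS// wE linearD !linearZ/= !ad_X bA bB cA cB addr0.
  by rewrite addrCA -scalerDl [s2 + s1]addrC scalerDr !scalerA -addrA -scalerDl.
(* Since [c] kills B and w_n has A-coordinate r, [z, c] is t / r times [w_n, c]. *)
- move=> z; have [t [u zE]] := AB z; exists 0, (t / r).
  rewrite linear0 add0r wE zE !linearD/= !linearZ/= cB !scaler0 !addr0.
  by rewrite scalerA mulrC mulfVK.
Qed.

(** Used with A = w_(k+1)^(0) and B = y'^(p-1): here [b] carries A on to w_(k+2)^(p-1), while [c]
    acts on B. *)
Lemma layer_state_next (s1 : 'F_p) :
  ad n c A = 0 -> ad n c B = B' -> ad n b A = A' + s1 *: B' -> ad n b B = 0 ->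
  layer_state A' B' /\ layer_gen D n.
Proof.
move: st => [AB [r [s [r0 wE]]]] cA cB bA bB; split; first split.
- apply: (span2S n0 AB); rewrite ?bA ?bB ?cA ?cB; try exact: in_span2_0.
    by exists 1, s1; rewrite scale1r.
  by exists 0, 1; rewrite scale1r scale0r add0r.
- exists r, (r * s1 + s); split=> //.
  rewrite lv_engelS// wE linearD !linearZ/= !ad_X bA bB cA cB addr0 add0r.
  by rewrite scalerDl scalerDr scalerA addrA.
- move=> z; have [t [u zE]] := AB z; exists (u *: B), 0.
  rewrite scale0r addr0 zE !linearD/= !linearZ/= ad_X cA cB bB.
  by rewrite scaler0 !add0r.
Qed.

End Steps.

End LayerStates.

(** * Passing from one factor to the next *)

Section Recursion.
Variables (p : nat) (G : groupType) (D : ggs_data p G).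
Implicit Types (i k m n q : nat) (x y : G) (j : 'F_p).
Local Notation c := (gc D).
Local Notation b := (gb D).
Local Notation rho := (rho D).
Local Notation sec := (sec D).
Local Notation lv := (lv D).
Local Notation ad := (ad D).
Local Notation w := (engel D).
Local Notation K := (rigid D).
Local Notation bin := (bin D).

Lemma val_FpS j : (j + 1)%R = (if j.+1 == p then 0 else j.+1)%N :> nat.
Proof.
have jp := Fp_lt D j; rewrite (val_FpD D).
rewrite -[(1%R : 'F_p) : nat]/1%N addn1; case: eqP => [->|/eqP ne]; first exact: modnn.
by rewrite modn_small// ltn_neqAle ne.
Qed.

Lemma Fp_last j : (j == -1)%R = (j.+1 == p).
Proof.
rewrite -subr_eq0 opprK -(inj_eq val_inj) [val _]val_FpS.
by case: (j.+1 == p).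
Qed.

(** Hence [bin p.-1 x] is x placed at position -1 alone. *)
Lemma bin_top j : 'C(j, p.-1) = (j == -1)%R.
Proof.
rewrite Fp_last; have jp := Fp_lt D j; have p1 := p_gt1 D.
have [jE|jN] := eqVneq j.+1 p; first by rewrite -[p.-1]/(p.-1)%N (_ : p.-1 = j) ?binn//; lia.
by rewrite bin_small//; lia.
Qed.

Lemma sum_bin_top : (\sum_(j : 'F_p) 'C(j, p.-1)%:R = 1 :> 'F_p)%R.
Proof.
rewrite (bigD1 (-1)%R)// bin_top eqxx big1 => [|j /negbTE jN]; first exact: addr0.
by rewrite bin_top jN.
Qed.

(* Modulo K i.+1, an element of K i whose sections have trivial product is a
   commutator [u, c], where the sections of u are the partial products. *)
Lemma rigid_trace0 i n (E : {linear layer D i -> layer D n}) x :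
  (1 < i)%N -> K i `<=` lc n -> K i.+1 `<=` lc n.+2 ->
  (forall y : G, K i y -> lv n y = (\sum_j E (lv i (sec j y)))%R) ->
  K i x -> (\sum_j lv i (sec j x) = 0)%R ->
  lc n.+1 x /\ exists2 u, K i u & lv n.+1 x = ad n c (lv n u) /\
    lv n u = (\sum_j - (j + 1) *: E (lv i (sec j x)))%R.
Proof.
move=> i1 KL KL2 EE Kx x0.
pose f (j : 'F_p) := lv i (sec j x).
pose P (j : 'F_p) := (\sum_(l : 'F_p | (l < j)%N) f l)%R.
(* At the wrap from p - 1 to 0 this is the vanishing of the trace. *)
have PS (j : 'F_p) : P (j + 1)%R = (P j + f j)%R.
  have -> : (P j + f j = \sum_(l : 'F_p | (l < j.+1)%N) f l)%R.
    rewrite [RHS](bigD1 j)//= addrC; congr (_ + _)%R; apply: eq_bigl => l.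
    by rewrite ltnS [in RHS]leq_eqVlt -val_eqE /=; case: ltngtP.
  rewrite /P val_FpS; case: eqP => [jp|_] //.
  rewrite big_pred0 ?jp//; rewrite -[LHS]x0; apply: eq_bigl => l.
  by rewrite (Fp_lt D).
have /choice[h hP] : forall j, exists g, lc i g /\ P j = lv i g.
  by move=> j; have [g gL ->] := lv_surj (P j); exists g.
have h2 j : lc 2 (h j) by have [hL _] := hP j; exact: lc_le hL.
set u := with_sections D h.
have Ku : K i u by apply: rigid_ws => // j; have [] := hP j.
have u0 : rho u = 0%R by exact: rho_ws.
have xR : K i.+1 ([~ u, c]^-1 * x).
  have Kc := rigidR c Ku; have [[r0 rL] [s0 sL]] := (Kc, Kx).
  apply: rigid_lv0 => [|j]; first by apply: rigidM => //; exact: rigidV.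
  have [hL hv] := hP j; have [hLS hvS] := hP (j + 1)%R.
  rewrite secMs ?rhoV ?r0 ?oppr0// secVs// lvM//; last exact: lcV.
  rewrite lvV// secRc// !sec_ws// lvM//; last exact: lcV.
  by rewrite lvV// -hv -hvS PS addKr addNr.
have uL := KL _ Ku; have xL := KL2 _ xR.
have cL := lcR c uL.
split; first by rewrite -[x](mulVKg [~ u, c]); apply: lcM => //; exact: lcS.
exists u => //; split.
  rewrite -adE// -[in LHS](mulVKg [~ u, c] x) lvM//; last exact: lcS.
  by rewrite (lv0 D xL) addr0.
(* Summation by parts, with the weights j + 1 and j. *)
have sumP : (\sum_j P j = \sum_j - (j + 1) *: f j)%R.
  have -> : (\sum_j - (j + 1) *: f j = \sum_j ((j + 1) *: P j - (j + 1) *: P (j + 1)))%R.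
    by apply: eq_bigr => j _; rewrite PS scaleNr scalerDr opprD addrA subrr sub0r.
  rewrite sumrB (sumF_shift (fun j => j *: P j)%R 1%R) -sumrB.
  by apply: eq_bigr => j _; rewrite scalerDl scale1r addrAC subrr add0r.
rewrite EE//; under eq_bigr => j _ do rewrite sec_ws// -(proj2 (hP j)).
by rewrite -linear_sum sumP linear_sum; apply: eq_bigr => j _; rewrite linearZ.
Qed.

Section Steps.
Variables (k : nat) (y y' : G).
Hypotheses (k0 : (0 < k)%N) (yL : lc k.+1 y) (y'L : lc k.+2 y').
Hypothesis y'_span : span2 (lv k.+2 (w k.+2)) (lv k.+2 y').
Hypotheses (bd : rigid_bound D k) (bdS : rigid_bound D k.+1) (bdSS : rigid_bound D k.+2).

Let i1 : (1 < k.+1)%N. Proof. exact: k0. Qed.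
Let wL : lc k.+1 (w k.+1). Proof. exact: engel_lc. Qed.
Let w'L : lc k.+2 (w k.+2). Proof. exact: engel_lc. Qed.
Let p2 : (2 < p)%N. Proof. exact: p_gt2 D. Qed.
Let pk : (p <= p * k)%N. Proof. by rewrite leq_pmulr. Qed.
Let pkS : (p * k.+1 = p * k + p)%N. Proof. by rewrite mulnS addnC. Qed.
Let KL : K k.+1 `<=` lc (p * k).-1. Proof. by case: bd. Qed.
Let KLS : K k.+2 `<=` lc (p * k.+1).-1. Proof. by case: bdS. Qed.
Let KLSS : K k.+3 `<=` lc (p * k.+2).-1. Proof. by case: bdSS. Qed.

Let bin_w l : (l < p)%N -> lc (p * k + l) (bin (p.-1 - l) (w k.+1)).
Proof.
case: bd => _ bL lp; have := bin_desc i1 wL lp KLS bL.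
by apply: lc_le; rewrite leq_min; lia.
Qed.

Let bin_y l : (l < p)%N -> lc ((p * k).-1 + l) (bin (p.-1 - l) y).
Proof.
move=> lp; have := bin_desc i1 yL lp KLS (KL (rigid_bin D p.-1 i1 yL)).
by apply: lc_le; rewrite leq_min; lia.
Qed.

(** K_(k+2) lies in degree n + 2 here, which removes the commutators with [b] as well as the errors
    of [ad_bin]. *)
Lemma layer_step_shift n q : (q.+2 < p)%N -> (n + q.+2 = p * k + p.-1)%N ->
  layer_state (lv n (bin q.+2 (w k.+1))) (lv n (bin q.+1 y)) ->
  layer_state (lv n.+1 (bin q.+1 (w k.+1))) (lv n.+1 (bin q y)) /\ layer_gen D n.
Proof.
move=> qp nq st.
have wB : lc n (bin q.+2 (w k.+1)).
  have := bin_w (_ : p.-1 - q.+2 < p)%N; rewrite subKn; last by lia.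
  by move=> /(_ _)/lc_le; apply; lia.
have yB : lc n (bin q.+1 y).
  have := bin_y (_ : p.-1 - q.+1 < p)%N; rewrite subKn; last by lia.
  by move=> /(_ _)/lc_le; apply; lia.
have KLn : K k.+2 `<=` lc n.+2 by move=> u /KLS/lc_le; apply; lia.
have bR q' x : lc k.+1 x -> lc n (bin q' x) -> ad n b (lv n (bin q' x)) = 0%R.
  move=> xL xB; rewrite -adE// lv0//; apply: KLn; apply: rigidRs; first exact: rho_b.
  exact: rigid_bin.
apply: (layer_state_shift _ st); rewrite ?bR//; first lia.
  exact: (ad_bin i1 qp wL KLn wB).
exact: (ad_bin i1 (ltnW qp) yL KLn yB).
Qed.

(** w_(k+2)^(p-1) lies one degree deeper, so [E] kills w_(k+2) and K_(k+2) contributes at most a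
    line in degree p (k + 1) - 1. *)
Let span_y : exists E : {linear layer D k.+2 -> layer D (p * k.+1).-1},
  [/\ forall u : G, K k.+2 u -> lv _ u = (\sum_j E (lv k.+2 (sec j u)))%R,
   E (lv k.+2 (w k.+2)) = 0%R &
   forall z, exists s : 'F_p, E z = (s *: lv (p * k.+1).-1 (bin p.-1 y'))%R].
Proof.
have [E EE] := rigid_layer (isT : 1 < k.+2)%N KLS; exists E.
have Etop x : lc k.+2 x -> lv (p * k.+1).-1 (bin p.-1 x) = E (lv k.+2 x).
  move=> xL; rewrite EE; last exact: rigid_bin.
  under eq_bigr do rewrite lv_sec_bin// linearZ/=.
  by rewrite -scaler_suml sum_bin_top scale1r.
have Ew : E (lv k.+2 (w k.+2)) = 0%R.
  by rewrite -Etop// lv0//; case: bdS => _; apply: lc_le; lia.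
split=> // z; have [r [s ->]] := y'_span z; exists s.
by rewrite linearD !linearZ/= Ew scaler0 add0r Etop.
Qed.

Lemma layer_step_end n : (n.+2 = p * k.+1)%N ->
  layer_state (lv n (bin 1 (w k.+1))) (lv n (bin 0 y)) ->
  layer_state (lv n.+1 (bin 0 (w k.+1))) (lv n.+1 (bin p.-1 y')) /\ layer_gen D n.
Proof.
move=> nE st; have [E [EE _ Ey]] := span_y.
have n1E : (p * k.+1).-1 = n.+1 by rewrite -nE.
rewrite n1E in E EE Ey.
have Ky u : K k.+2 u -> exists s : 'F_p, lv n.+1 u = (s *: lv n.+1 (bin p.-1 y'))%R.
  move=> Ku; rewrite EE// -linear_sum; exact: Ey.
have wB : lc n (bin 1 (w k.+1)).
  have := bin_w (_ : p.-2 < p)%N; rewrite (_ : (p.-1 - p.-2 = 1)%N); last by lia.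
  by move=> /(_ _)/lc_le; apply; lia.
have yB : lc n (bin 0 y).
  have := bin_y (_ : p.-1 < p)%N; rewrite subnn.
  by move=> /(_ _)/lc_le; apply; lia.
have p1 : (1 < p)%N := ltnW p2.
have [s1 cA] := Ky _ (comm_bin D i1 p1 wL).
have bR q x : lc k.+1 x -> K k.+2 [~ bin q x, b].
  by move=> xL; apply: rigidRs; [exact: rho_b|exact: rigid_bin].
have [s2 bA] := Ky _ (bR 1%N _ wL); have [s3 bB] := Ky _ (bR 0%N _ yL).
have n0 : (0 < n)%N by lia.
have y2 : lc 2 y := lc_le i1 yL.
have w0L : lc n.+1 (bin 0 (w k.+1)).
  have := bin_w (_ : p.-1 < p)%N; rewrite subnn.
  by move=> /(_ _)/lc_le; apply; lia.
apply: (layer_state_end n0 st (s1 := s1) (s2 := s2) (s3 := s3)); rewrite -adE//.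
  rewrite -[[~ _, c]](mulVKg (bin 0 (w k.+1))) lvM ?cA//.
  by rewrite -n1E; apply: KLS; exact: comm_bin.
by rewrite comm_bin0// lv1.
Qed.

Lemma layer_step_next n : (n.+1 = p * k.+1)%N ->
  layer_state (lv n (bin 0 (w k.+1))) (lv n (bin p.-1 y')) ->
  layer_state (lv n.+1 (bin p.-1 (w k.+2))) (lv n.+1 (bin p.-2 y')) /\ layer_gen D n.
Proof.
move=> nE st; have [E [EE _ Ey]] := span_y.
have n1E : (p * k.+1).-1 = n by rewrite -nE.
rewrite n1E in E EE Ey.
have KLn : K k.+2 `<=` lc n by rewrite -n1E.
have KLn2 : K k.+3 `<=` lc n.+2 by move=> u /KLSS/lc_le; apply; lia.
have wB : lc n (bin 0 (w k.+1)).
  have := bin_w (_ : p.-1 < p)%N; rewrite subnn.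
  by move=> /(_ _)/lc_le; apply; lia.
have yB : lc n (bin p.-1 y') by apply: KLn; exact: rigid_bin.
have n0 : (0 < n)%N by lia.
have w2 : lc 2 (w k.+1) := lc_le i1 wL.
have w'B : lc n.+1 (bin p.-1 (w k.+2)) by rewrite nE; case: bdS.
have pE : p.-2.+1 = p.-1 by lia.
have cB : ad n c (lv n (bin p.-1 y')) = lv n.+1 (bin p.-2 y').
  move: yB; rewrite -pE => yB'; apply: (ad_bin _ _ y'L KLn2 yB') => //; lia.
have Kb : K k.+2 [~ bin 0 (w k.+1), b].
  by apply: rigidRs; [exact: rho_b|exact: rigid_bin].
have Kw' : K k.+2 (bin p.-1 (w k.+2)) by exact: rigid_bin.
have Kz := rigidM (rigidV Kw') Kb.
(* [w_(k+1)^(0), b] and w_(k+2)^(p-1) have the same trace w_(k+2), so they differ by some [u, c] in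
   this degree, with u in the line of y'^(p-1). *)
have [|zL [u Ku [zv uv]]] := rigid_trace0 (isT : 1 < k.+2)%N KLn KLn2 EE Kz.
  have [[r0 rL] [s0 sL]] := (Kw', Kb).
  under eq_bigr => j _.
    rewrite secMs ?rhoV ?r0 ?oppr0// secVs// lvM//; last exact: lcV.
    rewrite lvV// lv_sec_bin// secR ?rho_b ?rho_bin// sec_bin// bin0 expg1 adE//.
    over.
  rewrite big_split/= sum_ad_secb sumrN -scaler_suml sum_bin_top scale1r.
  by rewrite lv_engelS// addNr.
have [s uE] : exists s : 'F_p, lv n u = (s *: lv n (bin p.-1 y'))%R.
  by rewrite EE// -linear_sum; exact: Ey.
apply: (layer_state_next n0 st (s1 := s)) => //.
- by rewrite -adE// comm_bin0// lv1.
- rewrite -adE// -[[~ _, b]](mulVKg (bin p.-1 (w k.+2))) lvM// zv uE linearZ/=.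
  by rewrite cB.
- rewrite -adE// lv0//; apply: KLn2; apply: rigidRs; first exact: rho_b.
  exact: rigid_bin.
Qed.

End Steps.
End Recursion.

(** * Induction over the blocks of p factors *)

Section Blocks.
Variables (p : nat) (G : groupType) (D : ggs_data p G).
Implicit Types (i k m n q : nat) (x y : G).
Local Notation lv := (lv D).
Local Notation w := (engel D).
Local Notation bin := (bin D).

Definition layer_good n := layer_rank2 D n /\ layer_gen D n.

(* The block is the run of p layers from the degree p k + 1 on, with spanning
   vectors in rigid k.+1 and, for the last two layers, in rigid k.+2. *)
Definition layer_block k := exists y,
  [/\ lc k.+1 y, span2 (lv k.+1 (w k.+1)) (lv k.+1 y),
      layer_state (lv (p * k).+1 (bin (p - 2) (w k.+1))) (lv (p * k).+1 (bin (p - 3) y)),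
      rigid_bound D k & forall n, (1 < n <= p * k)%N -> layer_good n].

Lemma layer_blockS k : (0 < k)%N -> layer_block k -> layer_block k.+1.
Proof.
move=> k0 [y [yL y_span st bd good]]; have p2 := p_gt2 D.
have pk3 : (3 * k <= p * k)%N by rewrite leq_mul2r p2 orbT.
have pk : (p <= p * k)%N by rewrite leq_pmulr.
have pkS : (p * k.+1 = p * k + p)%N by rewrite mulnS addnC.
(* As k + 2 <= 3 k <= p k, the degrees k + 1 and k + 2 have already been treated. *)
have [_ gen1] : layer_good k.+1 by apply: good; lia.
have [[y'0 y'_span] gen2] : layer_good k.+2 by apply: good; lia.
have [y' y'L y'E] := lv_surj y'0; rewrite {}y'E {y'0} in y'_span.
have bdS := rigid_boundS k0 gen1 bd.
have bdSS := rigid_boundS (isT : 0 < k.+1)%N gen2 bdS.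
(* Here l counts the steps from the start of the block, where q = p - 3. Degree n itself is
   excluded: its [layer_gen] comes from the step that leaves it. *)
have run l : forall q n, (q + l = p - 3)%N -> (n + q.+1 = p * k + p.-1)%N ->
    layer_state (lv n (bin q.+1 (w k.+1))) (lv n (bin q y)) /\
    forall m, (1 < m < n)%N -> layer_good m.
  elim: l => [|l IHl] q n ql nq.
    have -> : n = (p * k).+1 by lia.
    have -> : q.+1 = (p - 2)%N by lia.
    have -> : q = (p - 3)%N by lia.
    by split=> // m mn; apply: good; lia.
  have [st' good'] := IHl q.+1 n.-1 ltac:(lia) ltac:(lia).
  have nE : n = n.-1.+1 by lia.
  have qp : (q.+2 < p)%N by lia.
  have nq' : (n.-1 + q.+2 = p * k + p.-1)%N by lia.
  have [st'' gen''] := layer_step_shift k0 yL bd bdS qp nq' st'.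
  rewrite nE; split=> // m /andP[m1]; rewrite ltnS leq_eqVlt => /predU1P[->|mn].
    by split=> //; exact: layer_state_rank2 st'.
  by apply: good'; rewrite m1.
have [N NE] : exists N, N = (p * k + p.-2)%N by exists (p * k + p.-2)%N.
have [st1 good1] := run (p - 3)%N 0%N N ltac:(lia) ltac:(lia).
have nE : N.+2 = (p * k.+1)%N by lia.
have [st2 gen_2] := layer_step_end k0 yL y'L y'_span bd bdS nE st1.
have [st3 gen_3] := layer_step_next k0 y'L y'_span bd bdS bdSS nE st2.
have pE1 : p.-1 = (p - 3).+2 by lia.
have st3' := st3; rewrite pE1 in st3'.
have qp : ((p - 3).+2 < p)%N by lia.
have nq : (N.+2 + (p - 3).+2 = p * k.+1 + p.-1)%N by lia.
have [st4 gen_4] := layer_step_shift (isT : 0 < k.+1)%N y'L bdS bdSS qp nq st3'.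
exists y'; split=> //.
  by rewrite -nE (_ : p - 2 = (p - 3).+1)%N//; lia.
move=> n; rewrite -nE => /andP[n1]; rewrite leq_eqVlt => /predU1P[->|].
  by split=> //; exact: layer_state_rank2 st3.
rewrite ltnS leq_eqVlt => /predU1P[->|].
  by split=> //; exact: layer_state_rank2 st2.
rewrite ltnS leq_eqVlt => /predU1P[->|nn]; last by apply: good1; rewrite n1.
by split=> //; exact: layer_state_rank2 st1.
Qed.

Lemma layer_block_rank2 : layer_block 1 -> forall n, (1 < n)%N -> layer_rank2 D n.
Proof.
move=> b1 n n1; have b k : layer_block k.+1.
  by elim: k => // k IHk; exact: layer_blockS.
have [y [_ _ _ _ good]] := b n.
have [] : layer_good n by apply: good; rewrite n1 (leq_trans (leqnSn n)) ?leq_pmull// (ltnW (p_gt1 D)).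
by [].
Qed.

End Blocks.

(** * The first p lower central factors *)

Section FirstBlock.
Variables (p : nat) (G : groupType) (D : ggs_data p G).
Implicit Types (i k m n q : nat) (g h s x y : G) (j : 'F_p).
Local Notation c := (gc D).
Local Notation b := (gb D).
Local Notation X := (gX D).
Local Notation F := (gF D).
Local Notation rho := (rho D).
Local Notation phi := (phi D).
Local Notation sec := (sec D).
Local Notation lv := (lv D).
Local Notation w := (engel D).
Local Notation K := (rigid D).
Local Notation zeta := (lv 2 [~ c, b]).

Let p2 : (2 < p)%N. Proof. exact: p_gt2 D. Qed.

Lemma lc2R g h : lc 2 [~ g, h]. Proof. by apply: lcR; exact: lcT. Qed.

(** Modulo gamma_3, (g h)^p is g^p h^p times [h, g] to the power p (p - 1) / 2, a multiple of p as p
    is odd; the generators have order p. *)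
Lemma lc3_expp g : lc 3 (g ^+ p).
Proof.
move: g; apply: (cb_ind (D := D)) => /=; rewrite ?expc_p ?expb_p; try exact: lc1.
split=> [|g h gp hp|g gp] /=.
- by rewrite expg1n; exact: lc1.
- have E n : lc 2 ((g ^+ n * h ^+ n)^-1 * (g * h) ^+ n) /\
      lv 2 ((g ^+ n * h ^+ n)^-1 * (g * h) ^+ n) = ('C(n, 2)%:R *: lv 2 [~ h, g])%R.
    elim: n => [|n [IL IE]].
      by rewrite !expg0 !gsimp lv1 bin_small// scale0r; split=> //; exact: lc1.
    set e := _^-1 * _ in IL IE.
    have -> : (g ^+ n.+1 * h ^+ n.+1)^-1 * (g * h) ^+ n.+1 = ([~ h ^+ n, g] * e ^ g) ^ h.
      have -> : (g * h) ^+ n.+1 = g ^+ n * h ^+ n * e * (g * h).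
        by rewrite /e mulVKg expgSr.
      by rewrite (expgSr g) (expgSr h) /commg /conjg !gnorm.
    have L1 := lc2R (h ^+ n) g; have L2 := lcJ g IL.
    split; first by apply: lcJ; exact: lcM.
    rewrite lvJ; last exact: lcM.
    have -> : lv 2 ([~ h ^+ n, g] * e ^ g) = (n%:R *: lv 2 [~ h, g] + lv 2 e)%R.
      rewrite lvM// lvJ//; congr (_ + _)%R.
      rewrite (lv2_comm D (h ^+ n)) (lv2_comm D h) rhoX phiX scalerA.
      by congr (_ *: _)%R; ring.
    by rewrite IE -scalerDl -natrD binS bin1 addnC.
  have [EL EE] := E p.
  have : lc 3 ((g ^+ p * h ^+ p)^-1 * (g * h) ^+ p).
    apply/(lv0P D) => //; rewrite EE (_ : 'C(p, 2)%:R = 0 :> 'F_p)%R ?scale0r//.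
    by apply/eqP; rewrite (natFp0 D) prime_dvd_bin// (ggs_prime D).
  by move=> /(lcM (lcM gp hp)); rewrite mulVKg.
- by rewrite expVgn; exact: lcV.
Qed.

Lemma layer2_span (z : layer D 2) : exists a : 'F_p, z = (a *: zeta)%R.
Proof.
move: z; apply: layer_ind => //.
- by exists 0%R; rewrite scale0r.
- by move=> y z [a ->] [a' ->]; exists (a + a')%R; rewrite scalerDl.
- by move=> z [a ->]; exists (- a)%R; rewrite scaleNr.
- by move=> z; have [x xL ->] := lv_surj z; rewrite -adE// lv2_comm; eexists.
- by move=> z; have [x xL ->] := lv_surj z; rewrite -adE// lv2_comm; eexists.
Qed.

Lemma lv2_engel : lv 2 (w 2) = zeta.
Proof.
by rewrite -[w 2]/(commg c X) (lv2_comm D c X) rho_c phi_X phi_c rho_X !mulr1 subr0 scale1r.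
Qed.

(** Powers of [c] enter the sections only through conjugates of [b], so their exponents are a
    convolution of the exponents of [b] with [gF]. *)
Lemma rho_sec g j : rho (sec j g) = (\sum_l phi (sec l g) * F (j - l))%R.
Proof.
move: g j; apply: (cb_ind (D := D)) => /=.
- split=> [j|g h gE hE j|g gE j] /=.
  + by rewrite sec1 rho1 big1// => l _; rewrite sec1 phi1 mul0r.
  + rewrite secM rhoM gE hE; under [RHS]eq_bigr do rewrite secM phiM mulrDl.
    rewrite big_split/=; congr (_ + _)%R.
    rewrite -[RHS](sumF_shift _ (rho g)); apply: eq_bigr => l _.
    by rewrite addrK opprD addrA addrAC.
  + rewrite secV rhoV gE -sumrN -[RHS](sumF_shift _ (- rho g)%R).
    apply: eq_bigr => l _; rewrite secV subrK phiV mulNr.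
    by congr (- (_ * F _))%R; ring.
- by move=> j; rewrite sec_c rho1 big1// => l _; rewrite sec_c phi1 mul0r.
- move=> j; rewrite rho_secb (bigD1 (-1)%R)//= big1 => [|l /negbTE lN].
    by rewrite phi_secb eqxx mul1r opprK addr0.
  by rewrite phi_secb lN mul0r.
Qed.

Lemma rho_engel n : rho (w n.+2) = 0%R.
Proof. exact: rhoR. Qed.

Lemma phiJ g h : phi (g ^ h) = phi g.
Proof. by rewrite !phiM phiV addrC addrK. Qed.

(** Commuting with [X] acts on the b-exponents of the sections as a difference operator, and
    Pascal's rule applies. The induction starts from w_2 as a product of conjugates of b^-1 and
    b. *)
Lemma phi_sec_engel n j : (n.+2 <= p)%N ->
  phi (sec j (w n.+2)) = (- 'C((j + 1)%R, p - n.+2)%:R)%R.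
Proof.
elim: n j => [|n IHn] j np; last first.
  rewrite engelS secRX ?rho_engel// phiM phiV phiJ !IHn ?(ltnW np)//.
  have -> : (p - n.+2 = (p - n.+3).+1)%N by lia.
  rewrite -[in RHS](bin_shift D); last by lia.
  by rewrite opprK opprB.
have -> : w 2 = (b^-1) ^ (c ^+ 2) * b ^ c.
  by rewrite -[w 2]/(commg c X) /gX /commg /conjg expgS expg1 !gnorm.
have r0 : rho b^-1 = 0%R by rewrite rhoV rho_b oppr0.
rewrite secMs ?rhoJ// secJcX// secVs ?rho_b// secJc ?rho_b// phiM phiV !phi_secb.
have -> : (p - 2 = p.-2)%N by lia.
rewrite -(bin_shift D); last by lia.
have -> : (p.-2.+1 = p.-1)%N by lia.
rewrite !(bin_top D) opprB addrC; congr (_%:R - _%:R)%R.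
by rewrite -addrA -mulr2n.
Qed.

Lemma rho_sec_engel j : rho (sec j (w p.-1)) = (delta D - (j + 1))%R.
Proof.
have [n nE] : exists n, p.-1 = n.+2 by exists (p - 3)%N; lia.
rewrite rho_sec.
have E l : phi (sec l (w p.-1)) = (- (l + 1))%R.
  rewrite nE phi_sec_engel; last by lia.
  have -> : (p - n.+2 = 1)%N by lia.
  by rewrite bin1 natFpK.
under eq_bigr do rewrite E.
rewrite (reindex_inj (h := fun d : 'F_p => (j - d)%R)) /=; last by move=> d d' /addrI/oppr_inj.
have -> : (delta D - (j + 1) = \sum_d (d * F d - (j + 1) * F d))%R.
  by rewrite sumrB -big_distrr/= sum_gF mulr1.
by apply: eq_bigr => d _; rewrite opprB addrCA subrr addr0; ring.
Qed.

Lemma phi_sec_engel_pred j : phi (sec j (w p.-1)) = (- (j + 1))%R.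
Proof.
have [n nE] : exists n, p.-1 = n.+2 by exists (p - 3)%N; lia.
rewrite nE phi_sec_engel; last by lia.
have -> : (p - n.+2 = 1)%N by lia.
by rewrite bin1 natFpK.
Qed.

Lemma phi_sec_engel_p j : phi (sec j (w p)) = (-1)%R.
Proof.
have E m : (1 < m <= p)%N -> phi (sec j (w m)) = (- 'C((j + 1)%R, p - m)%:R)%R.
  by case: m => [|[|m]]// /andP[_]; exact: phi_sec_engel.
by rewrite E ?subnn ?bin0//; lia.
Qed.

(** With [phi_sec_engel_p], every section of w_p is congruent to X^-1 modulo G'. So w_p is outside
    K_2, but its commutators with [b] and [c] are inside. *)
Lemma rho_sec_engel_p j : rho (sec j (w p)) = (-1)%R.
Proof.
rewrite rho_sec; under eq_bigr do rewrite phi_sec_engel_p mulN1r.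
rewrite sumrN -(sum_gF D); congr (- _)%R.
rewrite [RHS](reindex_inj (h := fun d : 'F_p => (j - d)%R))//=.
by move=> d d' /addrI/oppr_inj.
Qed.

Lemma rho_engel_gt1 n : (1 < n)%N -> rho (w n) = 0%R.
Proof. by case: n => [|[|n]]// _; exact: rho_engel. Qed.

Lemma engel_p : w p = [~ w p.-1, X].
Proof.
have E m : (0 < m)%N -> w m.+1 = [~ w m, X] by case: m.
by rewrite -E; [congr (w _)|]; lia.
Qed.

Lemma lv2_sec_commb s j : lv 2 [~ sec j s, sec j b] =
  ((rho (sec j s) * (j == -1)%:R - phi (sec j s) * F (j + 1)) *: zeta)%R.
Proof. by rewrite (lv2_comm D (sec j s)) phi_secb rho_secb. Qed.

(** One delta is the c-exponent at -1, which meets the recursive section [b]; the other is the first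
    moment of [gF] against the b-exponents - (j + 1). *)
Lemma sum_engel_commb :
  (\sum_j lv 2 [~ sec j (w p.-1), sec j b] = (delta D *+ 2) *: zeta)%R.
Proof.
under eq_bigr do rewrite lv2_sec_commb phi_sec_engel_pred.
rewrite -scaler_suml; congr (_ *: _)%R; rewrite sumrB.
rewrite (bigD1 (-1)%R)//= big1 => [|j /negbTE jN]; last by rewrite jN mulr0.
rewrite rho_sec_engel eqxx mulr1 addr0 addNr subr0 mulr2n; congr (_ + _)%R.
rewrite -sumrN -(sumF_shift _ (-1)%R); apply: eq_bigr => j _.
by rewrite subrK mulNr opprK.
Qed.

Lemma rigid2_comm s : rho s = 0%R -> K 2 [~ s, b].
Proof.
by move=> s0; split=> [|j]; [exact: rhoR|rewrite secR ?rho_b//; exact: lc2R].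
Qed.

Lemma delta2_neq0 : (delta D *+ 2 != 0)%R.
Proof.
rewrite -mulr_natl mulf_neq0 ?(delta_gF D)// (natFp0 D) gtnNdvd//.
Qed.

(** [w_(p-1), b] lies in gamma_p and in K_2, with trace 2 delta [c, b]. Below degree p its class is
    0, so [E] kills [c, b], which spans gamma_2 / gamma_3. *)
Lemma rigid2_lc : K 2 `<=` lc p.
Proof.
suff: forall m, (m <= p)%N -> K 2 `<=` lc m by apply.
elim=> [_ x _|m IHm mp]; first exact: lcT.
have {}IHm := IHm (ltnW mp).
have [E EE] := rigid_layer (isT : 1 < 2)%N IHm.
have W0 : rho (w p.-1) = 0%R by apply: rho_engel_gt1; lia.
have WL : lc m.+1 [~ w p.-1, b].
  apply: (@lc_le _ _ p.-1.+1); first by lia.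
  by apply: lcR; exact: engel_lc.
have := EE _ (rigid2_comm W0); rewrite (lv0 D WL) => /esym.
under eq_bigr => j _ do rewrite secR ?rho_b//.
rewrite -linear_sum sum_engel_commb linearZ => /eqP.
rewrite scaler_eq0 (negbTE delta2_neq0) => /eqP Ez.
move=> k Kk; apply/(lv0P D); first exact: IHm.
rewrite EE// big1// => j _; have [a ->] := layer2_span (lv 2 (sec j k)).
by rewrite linearZ/= Ez scaler0.
Qed.

Lemma sum_Fp_nat (V : zmodType) (f : 'F_p -> V) :
  (\sum_j f j = \sum_(l < p) f l%:R)%R.
Proof.
have gen m : m = (Zp_trunc (pdiv p)).+2 -> (\sum_j f j = \sum_(l < m) f l%:R)%R.
  by move=> ->; apply: eq_bigr => j _; rewrite natFpK.
by apply: gen; rewrite Fp_cast// (ggs_prime D).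
Qed.

(* The product of the sections of W = w (p - 1) along the cycle telescopes. *)
Lemma sum_engel_diff : (\sum_j lv 2 ((sec 0%R (w p))^-1 * sec j (w p)) =
  (delta D *+ 2) *: zeta)%R.
Proof.
set h := w p; set W := w p.-1.
have W0 : rho W = 0%R by apply: rho_engel_gt1; lia.
pose z j := (sec 0%R h)^-1 * sec j h.
pose r j := [~ sec (j + 1)%R W, sec (j + 1)%R b].
have zL j : lc 2 (z j).
  by apply: (lc2P (D := D)); rewrite ?(rhoM, rhoV) ?(phiM, phiV) ?rho_sec_engel_p ?phi_sec_engel_p addNr.
have rL j : lc 2 (r j) by exact: lc2R.
have WS j : sec (j + 1)%R W = sec j W * sec 0%R h * z j * (r j)^-1.
  rewrite /z -!mulgA mulVKg /h engel_p secRX// /r /commg /conjg.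
  by rewrite !gnorm.
have T n : lc 2 (((sec 0%R W)^-1 * sec n%:R%R W)^-1 * sec 0%R h ^+ n) /\
    (lv 2 (((sec 0%R W)^-1 * sec n%:R%R W)^-1 * sec 0%R h ^+ n) =
     \sum_(l < n) (lv 2 (r l%:R) - lv 2 (z l%:R)))%R.
  elim: n => [|n [IL IE]].
    rewrite expg0 mulVg invg1 mulg1 big_ord0 lv1; split=> //; exact: lc1.
  set e := _^-1 * _ in IL IE.
  have -> : ((sec 0%R W)^-1 * sec n.+1%:R%R W)^-1 * sec 0%R h ^+ n.+1 =
      r n%:R%R * (z n%:R%R)^-1 * e ^ sec 0%R h.
    rewrite mulrSr WS expgSr /e /conjg !gnorm.
    done.
  split; first by apply: lcM; [apply: lcM => //; exact: lcV|exact: lcJ].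
  rewrite big_ord_recr/= -IE lvM; first last.
  - exact: lcJ.
  - by apply: lcM => //; exact: lcV.
  rewrite lvJ// lvM//; last exact: lcV.
  rewrite lvV//; exact: addrC.
(* For n = p the product closes up and the p-th power lies in gamma_3, so z and r have the same
   sum. *)
have [_] := T p; rewrite pchar_Fp_0 ?(ggs_prime D)// mulVg invg1 mul1g.
rewrite (lv0 D (lc3_expp _)) sumrB => /esym/eqP; rewrite subr_eq0 => /eqP E.
rewrite sum_Fp_nat -[LHS]E -(sum_Fp_nat (fun j => lv 2 (r j))).
by rewrite (sumF_shift (fun j => lv 2 [~ sec j W, sec j b])) sum_engel_commb.
Qed.

End FirstBlock.

(** * Degree p and the start of the induction *)

Section FirstBlockEnd.
Variables (p : nat) (G : groupType) (D : ggs_data p G).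
Implicit Types (i k m n q : nat) (g h s x y : G) (j : 'F_p).
Local Notation c := (gc D).
Local Notation b := (gb D).
Local Notation X := (gX D).
Local Notation F := (gF D).
Local Notation rho := (rho D).
Local Notation sec := (sec D).
Local Notation lv := (lv D).
Local Notation ad := (ad D).
Local Notation w := (engel D).
Local Notation K := (rigid D).
Local Notation bin := (bin D).
Local Notation zeta := (lv 2 [~ c, b]).

Let p2 : (2 < p)%N. Proof. exact: p_gt2 D. Qed.

Lemma layer_gen_span1 n : span2 (lv n (w n)) 0%R -> layer_gen D n.
Proof.
move=> span z; have [r [s ->]] := span z; exists 0%R, r.
by rewrite linear0 add0r scaler0 addr0 linearZ.
Qed.

(** [w_n, b] lies in K_2, hence in gamma_p, so below degree p only the Engel words survive. *)
Lemma low_layer_state n : (1 < n < p)%N -> layer_state (lv n (w n)) 0%R.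
Proof.
elim: n => [//|[//|n] IHn] /andP[_ np].
have w1 m : lv m (w m) = (1 *: lv m (w m) + 0 *: 0)%R by rewrite scale1r scaler0 addr0.
case: n => [|n] in IHn np *.
  split; last by exists 1%R, 0%R; rewrite oner_neq0; split.
  move=> z; have [a ->] := layer2_span z; exists a, 0%R.
  by rewrite lv2_engel scaler0 addr0.
have st := IHn (ltnW np).
have w0 : rho (w n.+2) = 0%R by exact: rho_engel.
have bw : ad n.+2 b (lv n.+2 (w n.+2)) = 0%R.
  rewrite -adE; last exact: engel_lc.
  by apply: lv0; have /rigid2_lc := rigid2_comm w0; exact: lc_le.
apply: (proj1 (layer_state_shift (isT : 0 < n.+2)%N st _ _ bw _)); rewrite ?linear0//.
by rewrite [RHS]lv_engelS// ad_X bw add0r.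
Qed.

Lemma low_layer_good n : (1 < n < p)%N -> layer_good D n.
Proof.
move=> /low_layer_state st; split; first exact: layer_state_rank2 st.
by apply: layer_gen_span1; case: st.
Qed.

Lemma rigid_bound1 : rigid_bound D 1.
Proof.
have wK : K 2 (bin p.-1 (w 2)) by apply: rigid_bin => //; exact: engel_lc.
split; rewrite muln1; last exact: rigid2_lc wK.
by move=> x /rigid2_lc; apply: lc_le; lia.
Qed.

Lemma rigid_bound2 : rigid_bound D 2.
Proof.
by apply: rigid_boundS rigid_bound1 => //; have [] : layer_good D 2 by apply: low_layer_good.
Qed.

(** In degree p the factor is spanned by w_p and d = w_2^(p-1). Both [w_p, b] and [w_p, c] have
    trace 0, which makes them multiples of d' = w_2^(p-2), by - delta and 2 delta; so [w_p, X] is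
    delta times d' and w_(p+1) spans the next factor. *)
Lemma layer_block1 : layer_block D 1.
Proof.
have w2L : lc 2 (w 2) by exact: engel_lc.
pose d := bin p.-1 (w 2); pose d' := bin p.-2 (w 2).
have Kd : K 2 d by exact: rigid_bin.
have dL : lc p d by exact: rigid2_lc Kd.
have [K3 _] := rigid_bound2.
have K3L : K 3 `<=` lc p.+2 by move=> x /K3; apply: lc_le; lia.
have [E EE] := rigid_layer (isT : 1 < 2)%N (rigid2_lc (D := D)).
have Ez : E zeta = lv p d.
  rewrite EE//; under eq_bigr do rewrite lv_sec_bin// linearZ/= lv2_engel.
  by rewrite -scaler_suml (sum_bin_top D) scale1r.
have E2 z : exists a : 'F_p, E z = (a *: lv p d)%R.
  by have [a ->] := layer2_span z; exists a; rewrite linearZ/= Ez.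
have K2v x : K 2 x -> exists a : 'F_p, lv p x = (a *: lv p d)%R.
  by move=> Kx; rewrite EE// -linear_sum; exact: E2.
have cd : ad p c (lv p d) = lv p.+1 d'.
  have pE : p.-2.+1 = p.-1 by lia.
  by move: dL; rewrite /d -pE => dL; apply: (ad_bin _ _ w2L K3L dL) => //; lia.
have bd : ad p b (lv p d) = 0%R.
  by rewrite -adE// lv0//; apply: K3L; apply: rigidRs => //; exact: rho_b.
have hL : lc p (w p) by exact: engel_lc.
have h0 : rho (w p) = 0%R by apply: rho_engel_gt1; lia.
have trace0 x : K 2 x -> (\sum_j lv 2 (sec j x) = 0)%R -> lc p.+1 x /\
    exists u : layer D p, [/\ lv p.+1 x = ad p c u, exists a : 'F_p, u = (a *: lv p d)%R
      & u = (\sum_j - (j + 1) *: E (lv 2 (sec j x)))%R].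
  move=> Kx x0; have [xL [u Ku [ux uE]]] :=
    rigid_trace0 (isT : 1 < 2)%N (rigid2_lc (D := D)) K3L EE Kx x0.
  by split=> //; exists (lv p u); split=> //; exact: K2v.
have Kb := rigid2_comm h0.
have bS j : lv 2 (sec j [~ w p, b]) = ((F (j + 1) - (j == -1)%:R) *: zeta)%R.
  rewrite secR ?rho_b// lv2_sec_commb rho_sec_engel_p phi_sec_engel_p.
  by rewrite !mulN1r opprK addrC.
have sum_last (f : 'F_p -> 'F_p) : (\sum_j f j * (j == -1)%:R = f (-1))%R.
  by rewrite (bigD1 (-1)%R)//= eqxx mulr1 big1 ?addr0// => j /negbTE->; rewrite mulr0.
have [|_ [ub [ubE [ab ubd] ubS]]] := trace0 _ Kb.
  under eq_bigr do rewrite bS.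
  rewrite -scaler_suml sumrB (sumF_shift F 1%R) sum_gF.
  under [X in (_ - X)%R]eq_bigr do rewrite -[_%:R%R]mul1r.
  by rewrite (sum_last (fun=> 1%R)) subrr scale0r.
have {}ubS : ub = (- delta D *: lv p d)%R.
  rewrite ubS; under eq_bigr do rewrite bS linearZ/= Ez scalerA.
  rewrite -scaler_suml; congr (_ *: _)%R.
  under eq_bigr do rewrite mulrBr mulNr.
  rewrite sumrB (sum_last (fun j => - (j + 1)))%R addNr oppr0 subr0 sumrN.
  by rewrite (sumF_shift (fun j => j * F j)%R).
pose Z j := lv 2 ((sec 0%R (w p))^-1 * sec j (w p)).
have hh j l : lc 2 ((sec j (w p))^-1 * sec l (w p)).
  by apply: (lc2P (D := D)); rewrite ?(rhoM, rhoV) ?(phiM, phiV)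
    ?rho_sec_engel_p ?phi_sec_engel_p addNr.
have Kc : K 2 [~ w p, c] by split=> [|j]; rewrite ?rhoR// secRc.
have cS j : lv 2 (sec j [~ w p, c]) = (Z (j + 1) - Z j)%R.
  rewrite secRc// [RHS]addrC /Z -lvV// -lvM//; last exact: lcV.
  by congr (lv 2 _); rewrite !gnorm.
have [|_ [uc [ucE [ac ucd] ucS]]] := trace0 _ Kc.
  by under eq_bigr do rewrite cS; rewrite sumrB (sumF_shift Z) subrr.
have {}ucS : uc = ((delta D *+ 2) *: lv p d)%R.
  rewrite ucS -Ez -linearZ -sum_engel_diff linear_sum.
  (* Summation by parts turns the weighted differences of Z into the plain sum of Z. *)
  transitivity (\sum_j ((j + 1) *: E (Z j) - (j + 1) *: E (Z (j + 1))))%R.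
    by apply: eq_bigr => j _; rewrite cS linearB scaleNr scalerBr opprB.
  rewrite sumrB (sumF_shift (fun j => j *: E (Z j))%R 1%R) -sumrB.
  by apply: eq_bigr => j _; rewrite scalerDl scale1r addrAC subrr add0r.
have adb : ad p b (lv p (w p)) = (ab *: lv p.+1 d')%R.
  by rewrite -adE// ubE ubd linearZ/= cd.
have adc : ad p c (lv p (w p)) = (ac *: lv p.+1 d')%R.
  by rewrite -adE// ucE ucd linearZ/= cd.
have adX : ad p X (lv p (w p)) = (delta D *: lv p.+1 d')%R.
  rewrite ad_X -!adE// ubE ucE -linearD ubS ucS -scalerDl linearZ/= cd.
  by congr (_ *: _)%R; rewrite mulr2n addKr.
have span_p : span2 (lv p (w p)) (lv p d).
  (* The degree is generalized so that it can be written as a successor inside dependent types. *)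
  suff: forall n, n = p -> span2 (lv n (w n)) (lv n d) by apply.
  have K2v' n x : n = p -> K 2 x -> exists a : 'F_p, lv n x = (a *: lv n d)%R.
    by move=> ->; exact: K2v.
  case=> [|m] mE; first by lia.
  have m1 : (1 < m < p)%N by lia.
  have [span _] := low_layer_state m1.
  have [a aE] := K2v' _ _ mE (rigid2_comm (rho_engel_gt1 D (proj1 (andP m1)))).
  have mb : ad m b (lv m (w m)) = (a *: lv m.+1 d)%R by rewrite -adE//; exact: engel_lc.
  have mc : ad m c (lv m (w m)) = (1 *: lv m.+1 (w m.+1) + - a *: lv m.+1 d)%R.
    by rewrite [in RHS]lv_engelS ?ad_X ?mb; [rewrite scale1r scaleNr addrAC subrr add0r|lia].
  apply: (span2S _ span); rewrite ?linear0 ?mb ?mc; try exact: in_span2_0.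
  - by lia.
  - by exists 1%R, (- a)%R.
  - exact: in_span2r.
have bin1 q : bin q 1 = 1.
  by apply: ws_eq; rewrite ?rho1// => j; rewrite expg1n ?sec1//; exact: lc1.
have p0 : (0 < p)%N by lia.
have d0 := delta_gF D.
(* gamma_2 / gamma_3 is spanned by w_2 alone, so 1 serves as the second vector. *)
exists 1; split; first exact: lc1.
- move=> z; have [a ->] := layer2_span z; exists a, 0%R.
  by rewrite lv2_engel scale0r addr0.
- rewrite muln1 bin1 lv1 subn2; split.
    apply: (span2S p0 span_p); rewrite ?adb ?adc ?cd ?bd; try exact: in_span2_0.
    + by exists ac, 0%R; rewrite scale0r addr0.
    + by exists ab, 0%R; rewrite scale0r addr0.
    + by exists 1%R, 0%R; rewrite scale1r scale0r addr0.
  by exists (delta D), 0%R; split=> //; rewrite lv_engelS// adX scaler0 addr0.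
- exact: rigid_bound1.
- move=> n; rewrite muln1 => /andP[n1]; rewrite leq_eqVlt => /predU1P[->|np].
    split; first by exists (lv p d).
    move=> z; have [r [s ->]] := span_p z.
    exists (((r * ac + s) / delta D) *: lv p (w p))%R, 0%R.
    by rewrite scale0r addr0 linearD !linearZ/= adc cd adX !scalerA mulfVK// scalerDl.
  by apply: low_layer_good; rewrite n1.
Qed.

Theorem layer_rank2_all n : (1 < n)%N -> layer_rank2 D n.
Proof. exact: (layer_block_rank2 layer_block1). Qed.

End FirstBlockEnd.

(** * Quotients by nontrivial normal subgroups *)

Section Torsion.
Variables (p : nat) (G : groupType) (D : ggs_data p G).
Implicit Types (k n : nat) (g h s x y : G) (j : 'F_p) (N M : set G) (v : seq 'F_p).
Local Notation c := (gc D).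
Local Notation b := (gb D).
Local Notation F := (gF D).
Local Notation rho := (rho D).
Local Notation phi := (phi D).
Local Notation sec := (sec D).
Local Notation K := (rigid D).
Local Notation at_letter := (at_letter D).
Local Notation bb := (bb D).

Lemma rigid2_lc2 x : K 2 x -> lc 2 x.
Proof. by move=> /rigid2_lc; apply: lc_le; exact: p_gt1 D. Qed.

Lemma at_letter_lc2 j x : lc 2 x -> lc 2 (at_letter j x).
Proof. by move=> xL; apply: rigid2_lc2; exact: rigid_at. Qed.

Lemma rho_at_letter j x : lc 2 x -> rho (at_letter j x) = 0%R.
Proof. by move=> xL; apply: lc2_rho; exact: at_letter_lc2. Qed.

Lemma sec_at_letter j l x : lc 2 x -> sec l (at_letter j x) = single j x l.
Proof. by move=> xL; apply: sec_ws; exact: single_lc. Qed.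

(** Quotients of two conjugates of [b] lie in G'. At 0 they yield c to the power F d - F(-d), which
    generates the powers of [c], and then [b] up to such a power. *)
Lemma sec0_surj_lc2 g : exists2 s, lc 2 s & sec 0%R s = g.
Proof.
have bbL i j : lc 2 ((bb i)^-1 * bb j).
  apply: (lc2P (D := D)); first by rewrite rhoM rhoV !rho_bb oppr0 addr0.
  by rewrite phiM phiV !phiJ addNr.
have bbE i j : sec 0%R ((bb i)^-1 * bb j) = (sec 0%R (bb i))^-1 * sec 0%R (bb j).
  by rewrite secMs ?rhoV ?rho_bb ?oppr0// secVs// rho_bb.
have HG : is_subgroup [set g | exists2 s, lc 2 s & sec 0%R s = g].
  split=> [|_ _ [s sL <-] [t tL <-]|_ [s sL <-]].
  - by exists 1; [exact: lc1|rewrite sec1].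
  - by exists (s * t); [exact: lcM|rewrite secMs// (lc2_rho D sL)].
  - by exists s^-1; [exact: lcV|rewrite secVs// (lc2_rho D sL)].
have [HG1 HGM _] := HG.
have [d [Fd Fd0]] := gF_asym D; have d0 := neqFp0 Fd0.
have dN0 : (- d != 0)%R by rewrite oppr_eq0.
have secbb (l : 'F_p) : (l != 0)%R -> sec 0%R (bb l) = c ^+ F (- l)%R.
  by move=> l0; rewrite sec_bb eq_sym (negbTE l0) sub0r.
have Hc : exists2 s, lc 2 s & sec 0%R s = c.
  have nz : (F d - F (- d) != 0)%R by rewrite subr_eq0.
  rewrite -(expc_gen D nz); apply: (subgroupX _ HG).
  exists ((bb d)^-1 * bb (- d)%R) => //; rewrite bbE !secbb// opprK.
  have -> : c ^+ F d = c ^+ F (- d)%R * c ^+ (F d - F (- d))%R.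
    by rewrite expcD addrC subrK.
  by rewrite mulKg.
suff Hb : exists2 s, lc 2 s & sec 0%R s = b by exact: (cb_ind HG Hc Hb).
have -> : b = c ^+ F d * ((c ^+ F d)^-1 * b) by rewrite mulVKg.
apply: HGM; first exact: (subgroupX _ HG).
exists ((bb (- d)%R)^-1 * bb 0%R) => //.
by rewrite bbE secbb// opprK sec_bb eqxx.
Qed.

Definition p_cofinal N := forall g, exists k, N (g ^+ (p ^ k)).

(** g^p fixes the first level, and the p-th powers of its sections lie in gamma_3, so g^(p^2) is in
    K_3. Moreover K_3 lies in [N]: [x, g'] placed at 0 is a commutator of x placed at 0 with an
    element of G' that has section g'. *)
Lemma p_cofinal_comm N : is_normal N ->
  (forall x y, lc 2 x -> lc 2 y -> N [~ x, y]) -> p_cofinal N.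
Proof.
move=> NN NR g; have [NG NJ] := NN; exists 2; rewrite -mulnn expgnA.
have g0 : rho (g ^+ p) = 0%R.
  by rewrite rhoX -mulr_natl pchar_Fp_0 ?mul0r// (ggs_prime D).
have Kg : K 3 ((g ^+ p) ^+ p).
  split=> [|j]; first by rewrite rhoX g0 mul0rn.
  by rewrite secXs//; exact: (lc3_expp D).
suff: K 3 `<=` N by apply.
apply: rigid_min => // j x xL.
suff: [set x | lc 2 x /\ N (at_letter 0%R x)] x.
  move=> [x2 x0]; rewrite -[at_letter j x](conjgK (c ^+ j)).
  by rewrite -at_letter0//; exact: NJ.
have [N1 NM NV] := NG.
move: x xL; apply: lcR_min => //.
  split=> [|x y [x2 xL] [y2 yL]|x [x2 xL]] /=.
  - split; first exact: lc1.
    suff -> : at_letter 0%R (1 : G) = 1 by [].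
    apply: ws_eq; rewrite ?rho1// => l; rewrite ?sec1 /single.
      by case: ifP => _; exact: lc1.
    by case: ifP.
  - by split; [exact: lcM|rewrite at_letterM//; exact: NM].
  - by split; [exact: lcV|rewrite at_letterV//; exact: NV].
move=> x g' xL; split; first by apply: lcS; exact: lcR.
have [t tL <-] := sec0_surj_lc2 g'.
rewrite at_letterR//; last exact: (lc2_rho D tL).
by apply: NR => //; exact: at_letter_lc2.
Qed.

(** Restricting to the subtree at one letter lowers the level of a vertex by 1. *)
Definition letter_part N : set G := [set x | lc 2 x /\ N (at_letter 0%R x)].

Lemma letter_partP N j x : is_normal N -> lc 2 x -> N (at_letter j x) ->
  letter_part N x.
Proof.
move=> [_ NJ] xL Nx; split=> //; rewrite (at_letter0 D j)//; exact: NJ.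
Qed.

Lemma letter_part_at N j x : is_normal N -> letter_part N x -> N (at_letter j x).
Proof.
move=> [_ NJ] [xL Nx]; rewrite -[at_letter j x](conjgK (c ^+ j)).
by rewrite -at_letter0//; exact: NJ.
Qed.

Lemma letter_part_normal N : is_normal N -> is_normal (letter_part N).
Proof.
move=> [[N1 NM NV] NJ]; split; first split=> [|x y [x2 xL] [y2 yL]|x [x2 xL]].
- split; first exact: lc1.
  suff -> : at_letter 0%R (1 : G) = 1 by [].
  apply: ws_eq; rewrite ?rho1// => l; rewrite ?sec1 /single.
    by case: ifP => _; exact: lc1.
  by case: ifP.
- by split; [exact: lcM|rewrite at_letterM//; exact: NM].
- by split; [exact: lcV|rewrite at_letterV//; exact: NV].
- move=> x g [x2 xL]; split; first exact: lcJ.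
  have [t t0 <-] := sec0_surj D g.
  by rewrite at_letterJ//; exact: NJ.
Qed.

Lemma p_cofinal_letter N : is_normal N -> p_cofinal (letter_part N) -> p_cofinal N.
Proof.
move=> NN cof g; have [NG _] := NN; have LN := letter_part_normal NN.
have [k kP] := choice (fun j => cof (sec j (g ^+ p))).
pose m := \max_j k j.
exists m.+1; rewrite expnS expgnA.
have g0 : rho (g ^+ p) = 0%R.
  by rewrite rhoX -mulr_natl pchar_Fp_0 ?mul0r// (ggs_prime D).
have sE j : letter_part N (sec j ((g ^+ p) ^+ (p ^ m))).
  rewrite secXs// -(subnK (leq_bigmax j : (k j <= m)%N)) addnC expnD expgnA.
  exact: subgroupX (proj1 LN) (kP j).
apply: rigid_mem => // [|j]; last exact: letter_part_at.
by split=> [|j]; [rewrite rhoX g0 mul0rn|case: (sE j)].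
Qed.

Definition at_vertex v x := foldr at_letter x v.

Lemma at_vertex_lc2 v x : lc 2 x -> lc 2 (at_vertex v x).
Proof. by move=> xL; elim: v => //= l v IHv; exact: at_letter_lc2. Qed.

Lemma p_cofinal_vertex v N : is_normal N ->
  (forall x y, lc 2 x -> lc 2 y -> N (at_vertex v [~ x, y])) -> p_cofinal N.
Proof.
elim: v N => [|j v IHv] N NN NR; first exact: p_cofinal_comm.
apply: p_cofinal_letter => //; apply: IHv; first exact: letter_part_normal.
move=> x y xL yL; apply: letter_partP (NR x y xL yL) => //.
by apply: at_vertex_lc2; exact: lc2R.
Qed.

(* If g moves the vertex v then [g, x@v] is the product of x@v and an element
   supported at the subtree of another vertex, hence commuting with y@v. *)
Lemma moved_vertex n g : ~ level_stab rho sec n g -> exists v, forall x y,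
  lc 2 x -> lc 2 y ->
  [~ [~ g, at_vertex v x], at_vertex v y] = at_vertex v [~ x, y].
Proof.
elim: n g => [|n IHn] g /=; first by case.
have [g0|g0] := eqVneq (rho g) 0%R.
  move=> gn; have [j gj] : exists j, ~ level_stab rho sec n (sec j g).
    by apply/existsNP => gj; apply: gn.
  have [v vP] := IHn _ gj; exists (j :: v) => x y xL yL /=.
  have [xv yv] := (at_vertex_lc2 v xL, at_vertex_lc2 v yL).
  have -> : [~ g, at_letter j (at_vertex v x)] = at_letter j [~ sec j g, at_vertex v x].
    rewrite -invgR -at_letterR// -at_letterV//; last exact: lc2R.
    by rewrite invgR.
  rewrite -vP//.
  have := at_letterR j (rho_at_letter j yv) (lc2R (sec j g) (at_vertex v x)).
  by rewrite sec_at_letter// /single eqxx => ->.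
move=> _; exists [:: 0%R] => x y xL yL /=.
set s := at_letter _ x; set t := at_letter _ y.
have [s0 t0] : rho s = 0%R /\ rho t = 0%R by split; exact: rho_at_letter.
have -> : [~ g, s] = s^-1 ^ g * s by rewrite /commg /conjg !mulgA.
have st : [~ s^-1 ^ g, t] = 1.
  apply: (sec_inj1 (D := D)) => [|j]; first exact: rhoR.
  rewrite secR ?rhoJ ?rhoV ?s0 ?oppr0// secJ ?rhoV ?s0 ?oppr0// secVs//.
  rewrite !sec_at_letter// /single; have [->|_] := eqVneq j 0%R; last by rewrite commg1.
  by rewrite add0r (negbTE g0) invg1 conj1g comm1g.
rewrite commMg st conj1g mul1g.
have := at_letterR 0%R t0 xL; rewrite sec_at_letter// /single eqxx => ->.
Qed.

Lemma p_cofinal_normal N g : is_normal N -> N g -> g <> 1 -> p_cofinal N.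
Proof.
move=> NN Ng g1.
have [n gn] : exists n, ~ level_stab rho sec n g.
  by apply/existsNP => gn; apply: g1; exact: (faithful gn).
have [v vP] := moved_vertex gn.
apply: (p_cofinal_vertex (v := v)) => // x y xL yL; rewrite -vP//.
by apply: normalR => //; exact: normalR.
Qed.

Lemma sum_phi_sec g : (\sum_j phi (sec j g) = phi g)%R.
Proof.
move: g; apply: (cb_ind (D := D)) => /=.
- split=> [|g h gE hE|g gE] /=.
  + by rewrite phi1 big1// => j _; rewrite sec1 phi1.
  + under eq_bigr do rewrite secM phiM.
    by rewrite big_split/= (sumF_shift (fun j => phi (sec j h))) gE hE phiM.
  + under eq_bigr do rewrite secV phiV.
    by rewrite sumrN (sumF_shift (fun j => phi (sec j g))) gE phiV.
- by rewrite phi_c big1// => j _; rewrite sec_c phi1.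
- rewrite phi_b (bigD1 (-1)%R)//= big1 ?phi_secb ?eqxx ?addr0// => j /negbTE jN.
  by rewrite phi_secb jN.
Qed.

(** When g rotates, a section of g^p is a product of all sections of g, each once. *)
Lemma sec_expp (f : G -> 'F_p) j g : (forall x y, f (x * y)%g = f x + f y)%R ->
  (rho g != 0)%R -> f (sec j (g ^+ p)) = (\sum_l f (sec l g))%R.
Proof.
move=> fM g0; have f1 : f 1 = 0%R.
  by have := fM 1 1; rewrite mulg1 => /esym/eqP; rewrite -subr_eq0 addrK => /eqP.
have E n : f (sec j (g ^+ n)) = (\sum_(l < n) f (sec (j - l%:R * rho g) g))%R.
  elim: n => [|n IHn]; first by rewrite expg0 sec1 big_ord0.
  rewrite expgSr secM fM IHn big_ord_recr/=; congr (_ + f (sec (_ - _) g))%R.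
  by rewrite rhoX mulr_natl.
rewrite E -(sum_Fp_nat D (fun l => f (sec (j - l * rho g)%R g))).
rewrite [RHS](reindex_inj (h := fun l : 'F_p => (j - l * rho g)%R))//=.
by move=> l l' /addrI/oppr_inj/(mulIf g0).
Qed.

(** Descent: g^k = 1 forces p to divide k, and the section h of g^p at 0 satisfies h^(k/p) = 1,
    while [rho h] and [phi h] both equal [phi g], again nonzero. *)
Lemma infinite_order g k : (rho g != 0)%R -> (phi g != 0)%R -> (0 < k)%N -> g ^+ k <> 1.
Proof.
elim/ltn_ind: k g => k IHk g rg fg k0 gk.
have /eqP : rho (g ^+ k) = 0%R by rewrite gk rho1.
rewrite rhoX -mulr_natr mulf_eq0 (negbTE rg) /= (natFp0 D) => /dvdnP[k' kE].
move: gk; rewrite kE mulnC expgnA => /(congr1 (sec 0%R)).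
have r0 : rho (g ^+ p) = 0%R.
  by rewrite rhoX -mulr_natl pchar_Fp_0 ?mul0r// (ggs_prime D).
rewrite secXs// sec1; apply: IHk.
- by rewrite kE ltn_Pmulr ?(p_gt1 D)//; move: k0; rewrite kE muln_gt0 => /andP[].
- by rewrite (sec_expp _ (rhoM D)).
- by rewrite (sec_expp _ (phiM D))// sum_phi_sec.
- by move: k0; rewrite kE muln_gt0 => /andP[].
Qed.

End Torsion.

(** * Indices that are powers of p *)

Section FiniteIndex.
Variables (G : groupType).
Implicit Types (H K : set G) (x y : G).

Lemma rcoset_of_eq H x y : is_subgroup H ->
  rcoset_of H x = rcoset_of H y <-> H (x * y^-1).
Proof.
move=> [H1 HM HV]; split=> [xy|Hxy].
  by apply/rcoset_ofP; rewrite -xy; apply/rcoset_ofP; rewrite mulgV.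
rewrite eqEsubset; split=> z /rcoset_ofP Hz; apply/rcoset_ofP.
  by have := HM _ _ Hz Hxy; rewrite mulgA mulgVK.
by have := HM _ _ Hz (HV _ Hxy); rewrite invgM invgK mulgA mulgVK.
Qed.

(* K acts on the cosets of H by right translations; this identifies K / H with
   a group of permutations, to which Cauchy's theorem applies. *)
Lemma index_p_power (p : nat) H K : prime p -> is_subgroup K -> is_subgroup H ->
  H `<=` K -> (forall h x, H h -> K x -> H (h ^ x)) -> finite_set (rcosets_of K H) ->
  (forall x, K x -> exists k, H (x ^+ (p ^ k))) -> exists k, has_index K H (p ^ k).
Proof.
move=> pp [K1 KM KV] HG HK HJ [n Kn] Kp; have [H1 HM HV] := HG.
suff [k nE] : exists k, n = (p ^ k)%N by exists k; rewrite /has_index -nE.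
have /card_set_bijP[f [fI finj fsurj]] := Kn.
have KfI x : K x -> (f (rcoset_of H x) < n)%N by move=> Kx; apply: fI; exists x.
pose i1 : 'I_n := Ordinal (KfI 1 K1).
pose idx x : 'I_n := insubd i1 (f (rcoset_of H x)).
have idxE x : K x -> idx x = f (rcoset_of H x) :> nat.
  by move=> Kx; rewrite [LHS](val_insubd i1) KfI.
have idxP x y : K x -> K y -> idx x = idx y <-> H (x * y^-1).
  move=> Kx Ky; rewrite -rcoset_of_eq//; split=> [/(congr1 val)/=|xy].
    by rewrite !idxE// => /finj; apply; rewrite inE; [exists x|exists y].
  by apply: val_inj; rewrite /= !idxE// xy.
have /choice[e eP] : forall i : 'I_n, exists x, K x /\ idx x = i.
  move=> i; have [_ [x Kx <-] fx] := fsurj i (ltn_ord i).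
  by exists x; split=> //; apply: val_inj; rewrite /= idxE.
have eK i : K (e i) by case: (eP i).
have eE i : idx (e i) = i by case: (eP i).
have act_inj x : K x -> injective (fun i => idx (e i * x)).
  move=> Kx i j /(idxP _ _ (KM _ _ (eK i) Kx) (KM _ _ (eK j) Kx)).
  by rewrite invgM !mulgA mulgK => /(idxP _ _ (eK i) (eK j)); rewrite !eE.
pose pr x : {perm 'I_n} := if pselect (K x) is left Kx then perm (act_inj x Kx) else 1.
have prE x i : K x -> pr x i = idx (e i * x).
  by move=> Kx; rewrite /pr; case: pselect => // Kx'; rewrite permE.
have prM x y : K x -> K y -> pr (x * y) = pr x * pr y.
  move=> Kx Ky; apply/perm.permP => i; rewrite permM !prE//; last exact: KM.
  have Kex := KM _ _ (eK i) Kx; set j := idx (e i * x).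
  apply/(idxP _ _ (KM _ _ (eK i) (KM _ _ Kx Ky)) (KM _ _ (eK j) Ky)).
  by rewrite invgM !mulgA mulgK; apply/(idxP _ _ Kex (eK j)); rewrite eE.
have pr1 h : H h -> pr h = 1.
  move=> Hh; apply/perm.permP => i; rewrite perm1 prE; last exact: HK.
  rewrite -[RHS]eE; apply/(idxP _ _ (KM _ _ (eK i) (HK _ Hh)) (eK i)).
  have := HJ h (e i)^-1 Hh (KV _ (eK i)).
  by rewrite /conjg invgK mulgA.
pose A := [set s | `[< exists2 x, K x & s = pr x >]]%SET.
have AP s : reflect (exists2 x, K x & s = pr x) (s \in A) by rewrite inE; exact: asboolP.
have gA : group_set A.
  apply/group_setP; split; first by apply/AP; exists 1 => //; rewrite pr1.
  by move=> _ _ /AP[x Kx ->] /AP[y Ky ->]; apply/AP; exists (x * y); [exact: KM|rewrite prM].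
have ei1 : H (e i1).
  rewrite -[e i1]mulg1 -[X in _ * X]invg1; apply/(idxP _ _ (eK i1) K1); rewrite eE.
  by apply: val_inj; rewrite /= idxE.
(* The action is regular: as K normalizes H, a translation is determined by the image of the coset
   H. *)
have cardA : #|A| = n.
  rewrite -[RHS]card_ord -cardsT; rewrite -(card_in_imset (f := fun s : {perm 'I_n} => s i1)).
    apply: eq_card => i; rewrite inE; apply/imsetP; exists (pr (e i)).
      by apply/AP; exists (e i).
    rewrite prE// -[LHS]eE; apply/esym/(idxP _ _ (KM _ _ (eK i1) (eK i)) (eK i)).
    by rewrite mulgK.
  move=> _ _ /AP[x Kx ->] /AP[y Ky ->]; rewrite !prE//.
  move=> /(idxP _ _ (KM _ _ (eK i1) Kx) (KM _ _ (eK i1) Ky)) Hxy.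
  have {}Hxy : H (x * y^-1).
    have := HM _ _ (HM _ _ (HV _ ei1) Hxy) ei1.
    by rewrite invgM !mulgA mulVg mul1g mulgVK.
  apply/perm.permP => i; rewrite !prE//.
  apply/(idxP _ _ (KM _ _ (eK i) Kx) (KM _ _ (eK i) Ky)).
  have := HJ _ (e i)^-1 Hxy (KV _ (eK i)).
  by rewrite /conjg invgK invgM !mulgA.
have : p.-nat #|A|.
  apply/pnatP => [|q qp qA]; first exact: (cardG_gt0 (fingroup.Group gA)).
  have [s sA sq] := Cauchy qp (qA : q %| #|fingroup.Group gA|).
  have /AP[x Kx sx] : s \in A by [].
  have [k Hk] := Kp x Kx.
  have prX m : pr (x ^+ m) = (pr x ^+ m)%g.
    elim: m => [|m IHm]; first by rewrite pr1 ?expg0.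
    rewrite expgS prM// ?IHm ?expgS//; exact: (@subgroupX _ K).
  have := pr1 _ Hk; rewrite prX -sx => /eqP; rewrite -order_dvdn sq => qpk.
  by move: qpk; rewrite Euclid_dvdX// => /andP[+ _]; rewrite dvdn_prime2.
by rewrite cardA => /p_natP[k ->]; exists k.
Qed.

End FiniteIndex.

(** * Profinite completion *)

Section CompletionBasics.
Variable G : groupType.
Local Notation P := (profinite_completion G).
Implicit Types (c d : P) (N M : finite_index_normal G) (x y g : G).

Definition fin_normal (N : set G) (NN : is_normal N)
    (Nf : finite_set (rcosets_of setT N)) : finite_index_normal G :=
  exist _ N (mem_set (conj NN Nf)).

Lemma fin_normalP N : is_normal N. Proof. by case: (set_valP N). Qed.

Lemma fin_finite N : finite_set (rcosets_of setT N). Proof. by case: (set_valP N). Qed.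

Lemma finite_rcosetsI (A B : set G) : is_subgroup A -> is_subgroup B ->
  finite_set (rcosets_of setT A) -> finite_set (rcosets_of setT B) ->
  finite_set (rcosets_of setT (A `&` B)).
Proof.
move=> AG BG Af Bf; apply: sub_finite_set (finite_image2 (fun C E => C `&` E) Af Bf).
move=> _ [x _ <-]; exists (rcoset_of A x); first by exists x.
exists (rcoset_of B x); first by exists x.
rewrite eqEsubset; split=> y.
  by move=> [/rcoset_ofP Ay /rcoset_ofP By]; apply/rcoset_ofP.
by move=> /rcoset_ofP[Ay By]; split; apply/rcoset_ofP.
Qed.

Lemma normalI (A B : set G) : is_normal A -> is_normal B -> is_normal (A `&` B).
Proof.
move=> [[A1 AM AV] AJ] [[B1 BM BV] BJ]; split; first split.
- by [].
- by move=> x y [Ax Bx] [Ay By]; split; [exact: AM|exact: BM].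
- by move=> x [Ax Bx]; split; [exact: AV|exact: BV].
- by move=> x y [Ax Bx]; split; [exact: AJ|exact: BJ].
Qed.

Definition finI N M : finite_index_normal G :=
  fin_normal (normalI (fin_normalP N) (fin_normalP M))
    (finite_rcosetsI (proj1 (fin_normalP N)) (proj1 (fin_normalP M)) (fin_finite N) (fin_finite M)).

Lemma finIl N M : finI N M `<=` N. Proof. by move=> x []. Qed.
Lemma finIr N M : finI N M `<=` M. Proof. by move=> x []. Qed.

Lemma completion_mem c N x : c N x -> c N = rcoset_of N x.
Proof.
have [y ->] := completion_rep c N => /rcoset_ofP Nxy.
apply/rcoset_of_eq; first exact: (proj1 (fin_normalP N)).
by case: (fin_normalP N) => -[_ _ NV] _; have := NV _ Nxy; rewrite invgM invgK.
Qed.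

Lemma completion_le c d M N : M `<=` N -> c M = d M -> c N = d N.
Proof.
move=> MN cd; have [x cE] := completion_rep c M.
have xc : c M x by rewrite cE; apply/rcoset_ofP; rewrite mulgV; case: (fin_normalP M) => -[].
by rewrite (completion_mem (completion_sub MN xc)) (completion_mem (x := x)) //;
   apply: (completion_sub MN); rewrite -cd.
Qed.

Lemma completion_mulN c d N x y : c N = rcoset_of N x -> d N = rcoset_of N y ->
  completion_fun (c * d) N = rcoset_of N (x * y).
Proof. by move=> cE dE; rewrite completion_mulE cE dE rcoset_ofM. Qed.

Lemma completion_invN c N x : c N = rcoset_of N x -> completion_fun c^-1 N = rcoset_of N x^-1.
Proof. by move=> cE; rewrite completion_invE cE rcoset_ofV. Qed.

Lemma completion_oneN N : completion_fun (1 : P) N = rcoset_of N 1.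
Proof. exact: completion_oneE. Qed.

Lemma completion_expN c N x k : c N = rcoset_of N x -> completion_fun (c ^+ k) N = rcoset_of N (x ^+ k).
Proof.
move=> cE; elim: k => [|k IHk]; first exact: completion_oneN.
by rewrite !expgS; exact: completion_mulN.
Qed.

Definition dense_family g : coset_families G := fun N => rcoset_of N g.

Lemma dense_family_subproof g : inverse_limit (dense_family g).
Proof.
split=> [N|M N MN x /rcoset_ofP Mx]; first by exists g.
by apply/rcoset_ofP/MN.
Qed.

Definition to_completion g : P := exist _ (dense_family g) (mem_set (dense_family_subproof g)).
Local Notation iota := to_completion.

Lemma to_completionE g N : iota g N = rcoset_of N g. Proof. by []. Qed.

Lemma to_completionM x y : iota (x * y) = iota x * iota y.
Proof. by apply: completion_ext => N; rewrite (completion_mulN (x := x) (y := y)). Qed.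

Lemma to_completion1 : iota 1 = 1.
Proof. by apply: completion_ext => N; rewrite completion_oneN. Qed.

Lemma to_completionV x : iota x^-1 = (iota x)^-1.
Proof. by apply: completion_ext => N; rewrite (completion_invN (x := x)). Qed.

Lemma to_completionR x y : iota [~ x, y] = [~ iota x, iota y].
Proof. by rewrite /commg /conjg !to_completionM !to_completionV. Qed.

Lemma normalT : is_normal [set: G]. Proof. by []. Qed.

Lemma finite_rcosetsT : finite_set (rcosets_of [set: G] setT).
Proof.
apply: sub_finite_set (finite_set1 [set: G]) => _ [x _ <-] /=.
by rewrite eqEsubset; split=> // y _; apply/rcoset_ofP.
Qed.

(** Finitely many conditions on coordinates follow from a single one, at the intersection of the
    subgroups concerned. *)
Lemma nbhs_completion c (A : set P) : nbhs c A ->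
  exists N, [set d : P | completion_fun d N = completion_fun c N] `<=` A.
Proof.
pose B N := [set d : P | completion_fun d N = completion_fun c N].
pose F := filter_from setT B.
have FF : Filter F.
  apply: filter_from_filter.
    by exists (fin_normal normalT finite_rcosetsT).
  move=> N M _ _; exists (finI N M) => // d dE.
  by split; apply: completion_le dE; [exact: finIl|exact: finIr].
have cv : set_val @ F --> (set_val c : coset_families G).
  apply/cvg_sup => N C [E [[O oO <-]]] /= Of OC.
  exists N => // d dE; apply: OC => /=; move: dE; rewrite /B /= /completion_fun => ->.
  exact: Of.
move=> [E [[O oO <-] Oc OA]].
have /cv [N _ BN] : nbhs (set_val c : coset_families G) O by apply: open_nbhs_nbhs.
by exists N => d dE; apply: OA; exact: BN.
Qed.

Lemma near_families (f : coset_families G) N :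
  nbhs f [set g : coset_families G | g N = f N].
Proof.
have pc := @proj_continuous _ (fun _ : finite_index_normal G => discrete_topology (set G)) N f.
by have /pc := @discrete_set1 (discrete_topology (set G)) (f N).
Qed.

Lemma completion_hausdorff : hausdorff_space P.
Proof.
move=> c d cd; apply: completion_ext => N.
have [e [ec ed]] := cd _ _ (near_completion c N) (near_completion d N).
by rewrite -ec -ed.
Qed.

Lemma completion_open_coset c N : open [set d : P | completion_fun d N = completion_fun c N].
Proof.
rewrite openE => d dE; rewrite /interior.
by apply: filterS (near_completion d N) => e eE; rewrite /= eE.
Qed.

Lemma completion_totally_disconnected : totally_disconnected [set: P].
Proof.
apply: zero_dimension_totally_disconnected => c d cd.
have [N cdN] : exists N, completion_fun c N <> completion_fun d N.
  by apply/existsNP => cdE; move/eqP: cd; apply; exact: completion_ext.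
exists [set e : P | completion_fun e N = completion_fun c N]; split=> //=; last exact/nesym.
split; first exact: completion_open_coset.
rewrite -openC openE => e eN; rewrite /interior.
by apply: filterS (near_completion e N) => e' e'E; rewrite /= e'E.
Qed.

(** Tychonoff's theorem gives a cluster point in the product of the finite sets of cosets. It is
    compatible, because each condition involves two coordinates only, which agree with those of some
    element of the completion. *)
Lemma completion_compact : compact [set: P].
Proof.
move=> F FF _.
have tych : compact [set f : coset_families G | forall N, rcosets_of setT N (f N)].
  apply: (@tychonoff _ (fun _ => discrete_topology (set G)) (fun N => rcosets_of setT N)) => N.
  by apply: finite_compact; exact: fin_finite.
have tychB : (set_val @ F) [set f : coset_families G | forall N, rcosets_of setT N (f N)].
  apply: (@filterS _ F _ setT); last exact: filterT.
  by move=> c _ N; have [] := set_valP c.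
have [f [fB fF]] := tych (set_val @ F) (fmap_proper_filter set_val FF) tychB.
have near1 A U : F A -> nbhs f U -> exists2 c, A c & U (set_val c).
  move=> FA fU; have [g [[c Ac <-] Uc]] : (set_val @` A) `&` U !=set0.
    apply: fF fU; apply: (@filterS _ F _ A) => // c Ac.
    by exists c.
  by exists c.
have fP : inverse_limit f.
  split=> // M N MN; have UMN := filterI (near_families f M) (near_families f N).
  have [c _ [<- <-]] := near1 setT _ (@filterT _ F _) (UMN _).
  by have [_] := set_valP c; apply.
exists (exist _ f (mem_set fP)); split=> // A U FA /nbhs_completion[N NU].
have [c Ac cN] := near1 A _ FA (near_families f N).
by exists c; split=> //; apply: NU.
Qed.

Lemma completion_profinite : profinite P.
Proof.
split; [exact: completion_compact|exact: completion_hausdorff|exact: completion_totally_disconnected].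
Qed.

End CompletionBasics.

(** * The closed lower central series of the completion *)

Section CompletionSeries.
Variable G : groupType.
Local Notation P := (profinite_completion G).
Local Notation iota := (@to_completion G).
Implicit Types (c d : P) (N M : finite_index_normal G) (x y g : G).

Lemma completion_subgroup N : is_subgroup [set c : P | completion_fun c N = rcoset_of N 1].
Proof.
split=> /= [|c d cE dE|c cE]; first exact: completion_oneN.
  by rewrite (completion_mulN cE dE) mulg1.
by rewrite (completion_invN cE) invg1.
Qed.

Lemma completion_coset1 c N x : completion_fun c N = rcoset_of N x ->
  completion_fun c N = rcoset_of N 1 <-> (N : set G) x.
Proof.
move=> ->; rewrite -[x in (N : set G) x]mulg1 -[X in x * X]invg1.
exact: rcoset_of_eq (fin_subgroup N).
Qed.

Lemma completion_divN c d N : completion_fun c N = completion_fun d N ->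
  completion_fun (c * d^-1) N = rcoset_of N 1.
Proof.
have [x dE] := completion_rep d N; rewrite dE => cE.
by rewrite (completion_mulN cE (completion_invN dE)) mulgV.
Qed.

Lemma completion_conjN c d N x y : completion_fun c N = rcoset_of N x ->
  completion_fun d N = rcoset_of N y -> completion_fun (c ^ d) N = rcoset_of N (x ^ y).
Proof.
by move=> cE dE; apply: completion_mulN; [exact: completion_invN|exact: completion_mulN].
Qed.

Lemma completion_commN c d N x y : completion_fun c N = rcoset_of N x ->
  completion_fun d N = rcoset_of N y -> completion_fun [~ c, d] N = rcoset_of N [~ x, y].
Proof.
by move=> cE dE; apply: completion_mulN; [exact: completion_invN|exact: completion_conjN].
Qed.

Lemma finite_rcosets_trans (H K : set G) : is_subgroup H -> is_subgroup K ->
  finite_set (rcosets_of setT K) -> finite_set (rcosets_of K H) ->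
  finite_set (rcosets_of setT H).
Proof.
move=> HG [K1 KM KV] Kf Hf.
pose f (C E : set G) : set G := [set a * xget 1 C | a in E].
apply: sub_finite_set (finite_image2 f Kf Hf) => _ [x _ <-].
have : rcoset_of K x (xget 1 (rcoset_of K x)).
  by apply: xgetI (x) _; apply/rcoset_ofP; rewrite mulgV.
move=> /rcoset_ofP/KV; rewrite invgM invgK; set y := xget _ _ => Kxy.
exists (rcoset_of K x); first by exists x.
exists (rcoset_of H (x * y^-1)); first by exists (x * y^-1).
rewrite eqEsubset; split=> [_ [_ [h Hh <-] <-]|_ [h Hh <-]].
  by exists h => //; rewrite mulgA mulgVK.
by exists (h * (x * y^-1)); [exists h|rewrite mulgA mulgVK].
Qed.

Lemma completion_pro_p p : prime p ->
  (forall N, p_cofinal p N) -> pro_p_group p P.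
Proof.
move=> pp Gp; split; first exact: completion_profinite.
move=> N [NG NJ] No; have [N1 _ _] := NG.
have [M MN] : exists M, [set d : P | completion_fun d M = completion_fun (1 : P) M] `<=` N.
  by apply: nbhs_completion; apply: open_nbhs_nbhs.
rewrite completion_oneN in MN.
apply: (@index_p_power P p N setT) => //.
- by move=> h x Nh _; apply: NJ.
(* A coset of N depends only on the coordinate at M; [xget] picks an element with that
   coordinate. *)
- pose f C := rcoset_of N (xget 1 [set c : P | completion_fun c M = C]).
  apply: sub_finite_set (finite_image f (fin_finite M)) => _ [c _ <-].
  have [x cE] := completion_rep c M.
  exists (completion_fun c M); first by exists x.
  apply/(rcoset_of_eq _ _ NG); apply: MN; apply: completion_divN.
  exact: (xgetI 1 (erefl : [set d : P | completion_fun d M = completion_fun c M] c)).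
- move=> c _; have [x cE] := completion_rep c M; have [k Mk] := Gp M x.
  by exists k; apply: MN; apply/(completion_coset1 (completion_expN _ cE)).
Qed.

Lemma commutators_completion n c N : @commutators P n c ->
  exists2 x, @commutators G n x & completion_fun c N = rcoset_of N x.
Proof.
elim: n c => [|n IHn] c /= => [_|[d /IHn[x xC dE] [e ->]]].
  by have [x cE] := completion_rep c N; exists x.
have [y eE] := completion_rep e N.
by exists [~ x, y]; [exists x => //; exists y|exact: completion_commN].
Qed.

Lemma completion_coset_closed N x : closed [set c : P | completion_fun c N = rcoset_of N x].
Proof.
rewrite -[X in closed X]setCK -/(~` _) closedC openE => c cN; rewrite /interior.
by apply: filterS (near_completion c N) => e eE; rewrite /= eE.
Qed.

Lemma commutators_to_completion n x : @commutators G n x -> @commutators P n (iota x).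
Proof.
elim: n x => [//|n IHn] x [u uC [y ->]].
by exists (iota u); [exact: IHn|exists (iota y); rewrite to_completionR].
Qed.

Lemma subgroup_to_completion (H : set P) : is_subgroup H -> is_subgroup [set x | H (iota x)].
Proof.
move=> [H1 HM HV]; split=> /= [|x y Hx Hy|x Hx]; rewrite ?to_completion1//.
  by rewrite to_completionM; apply: HM.
by rewrite to_completionV; apply: HV.
Qed.

Section Width.
Variable p : nat.
Hypotheses (p_prime : prime p) (p_cofin : forall N, p_cofinal p N).
(** The products u^i v^j with i, j < p are numbered by n = i + j p, so that indices can be compared
    with p^2. *)
Definition pair_word (u v : G) n : G := u ^+ (n %% p) * v ^+ (n %/ p).
Hypothesis lc_rank2 : forall i, (0 < i)%N -> exists u v, [/\ lc i u, lc i v &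
  forall x, lc i x -> exists2 n, (n < p * p)%N & lc i.+1 (x * (pair_word u v n)^-1)].

Lemma lc_finite i : finite_set (rcosets_of setT (lc (G := G) i)).
Proof.
have lcT0 : lc 1 = [set: G] by rewrite eqEsubset; split=> // x _; exact: lcT.
elim: i => [|[|i] IHi]; try by rewrite -[lc _]/(lc 1) lcT0; exact: finite_rcosetsT.
apply: finite_rcosets_trans IHi _; try exact: lc_subgroup.
have [u [v [_ _ uv]]] := @lc_rank2 i.+1 isT.
apply: sub_finite_set (finite_image (fun n => rcoset_of (lc i.+2) (pair_word u v n)) (finite_II (p * p))).
move=> _ [x xL <-]; have [n np xn] := uv x xL.
by exists n => //; apply/esym/rcoset_of_eq => //; exact: lc_subgroup.
Qed.

Definition fin_lc i : finite_index_normal G := fin_normal (@lc_normal G i) (lc_finite i).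
Local Notation L := fin_lc.

Lemma gammaE i : (0 < i)%N ->
  gamma P i = [set c : P | completion_fun c (L i) = rcoset_of (L i) 1].
Proof.
move=> i0; rewrite eqEsubset; split=> [c|c cE H [HG Hcl HC]].
  apply; split; [exact: completion_subgroup|exact: completion_coset_closed|].
  move=> d dC; have [x xC dE] := commutators_completion (L i) dC.
  by apply/(completion_coset1 dE); exact: (sub_gen xC : lc i x).
apply: Hcl => A /nbhs_completion[M MA].
(* A representative modulo both M and gamma_i approximates c and at the same time lies in
   gamma_i. *)
have [x xE] := completion_rep c (finI M (L i)).
have MLx := completion_le (d := iota x) _ xE.
exists (iota x); split; last by apply/MA/esym/MLx; exact: finIl.
suff : lc i `<=` [set x | H (iota x)].
  by apply; apply/(completion_coset1 (N := L i) (MLx _ (@finIr _ M (L i)))).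
by apply: gen_min; [exact: subgroup_to_completion|move=> y yC; exact/HC/commutators_to_completion].
Qed.

Lemma fin_lcS i : (L i.+1 : set G) `<=` L i. Proof. exact: lcS. Qed.

Lemma gamma_fin_lc i c x : (0 < i)%N -> completion_fun c (L i) = rcoset_of (L i) x ->
  gamma P i c <-> lc i x.
Proof. by move=> i0 cE; rewrite gammaE//; apply: (completion_coset1 cE). Qed.

(** That the index is a power of p comes from [index_p_power]; the bound p^2 comes from the pair
    words, which cover the cosets. *)
Lemma gamma_index i : (0 < i)%N ->
  exists2 k, (k <= 2)%N & has_index (gamma P i) (gamma P i.+1) (p ^ k)%N.
Proof.
move=> i0; have [u [v [uL vL uv]]] := @lc_rank2 i i0.
have gS j : (0 < j)%N -> is_subgroup (gamma P j) by move=> j0; rewrite gammaE//; exact: completion_subgroup.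
have sub : rcosets_of (gamma P i) (gamma P i.+1) `<=`
    [set rcoset_of (gamma P i.+1) (iota (pair_word u v n)) | n in `I_(p * p)].
  move=> _ [c cL <-]; have [x cE] := completion_rep c (L i.+1).
  have xL : lc i x by apply/(gamma_fin_lc i0 (completion_le (d := iota x) (@fin_lcS i) cE)).
  have [n np xn] := uv x xL; exists n => //; apply/esym/rcoset_of_eq; first exact: gS.
  apply/gamma_fin_lc; last exact: xn; first by [].
  by apply: completion_mulN cE _; exact: completion_invN.
have [k kI] : exists k, has_index (gamma P i) (gamma P i.+1) (p ^ k)%N.
  apply: index_p_power; [exact: p_prime|exact: gS|exact: gS| | | |].
  - move=> c; have [x cE] := completion_rep c (L i.+1).
    move=> /(gamma_fin_lc _ cE) xL; apply/(gamma_fin_lc i0 (completion_le (d := iota x) (@fin_lcS i) cE)).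
    by apply: lcS; exact: xL.
  - move=> c d; have [x cE] := completion_rep c (L i.+1); have [y dE] := completion_rep d (L i.+1).
    move=> /(gamma_fin_lc _ cE) xL _; apply/(gamma_fin_lc _ (completion_conjN cE dE)) => //.
    by apply: lcJ; exact: xL.
  - exact: sub_finite_set sub (finite_image _ (finite_II _)).
  move=> c _; have [x cE] := completion_rep c (L i.+1); have [k xk] := p_cofin (L i.+1) x.
  by exists k; apply/(gamma_fin_lc _ (completion_expN _ cE)).
exists k => //; rewrite -(leq_exp2l _ _ (prime_gt1 p_prime)) -card_le_II expnS expn1.
rewrite -(card_le_eql kI); apply: card_le_trans (subset_card_le sub) _.
exact: card_image_le.
Qed.

Lemma completion_width u v :
  (forall m n, (m < p * p)%N -> (n < p * p)%N ->
    lc 2 (pair_word u v m * (pair_word u v n)^-1) -> m = n) ->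
  lower_central_width p P 2.
Proof.
move=> uv_inj; split; first exact: gamma_index.
exists 1%N => //; have [k k2 kI] := @gamma_index 1 isT.
suff k2E : k = 2%N by rewrite -[X in (p ^ X)%N]k2E.
apply/eqP; rewrite eqn_leq k2 -(leq_exp2l _ _ (prime_gt1 p_prime)) -card_le_II expnS expn1.
rewrite -(card_le_eqr kI).
pose f n := rcoset_of (gamma P 2) (iota (pair_word u v n)).
have gS : is_subgroup (gamma P 2) by rewrite gammaE//; exact: completion_subgroup.
have finj : {in `I_(p * p) &, injective f}.
  move=> m n /set_mem mp /set_mem np /(rcoset_of_eq _ _ gS) mn; apply: uv_inj => //.
  move: mn; rewrite -to_completionV -to_completionM => mn.
  exact/(gamma_fin_lc (i := 2) isT (to_completionE _ (L 2))).
rewrite -(card_le_eql (inj_card_eq finj)); apply: subset_card_le => _ [n _ <-].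
exists (iota (pair_word u v n)) => //; rewrite gammaE//=.
apply/(completion_coset1 (to_completionE _ _)); exact: lcT.
Qed.

End Width.

End CompletionSeries.

Section GGSCompletion.
Variables (p : nat) (G : groupType) (D : ggs_data p G).
Local Notation P := (profinite_completion G).
Local Notation rho := (rho D).
Local Notation phi := (phi D).
Local Notation X := (gX D).

Lemma fin_p_cofinal (N : finite_index_normal G) : p_cofinal p N.
Proof.
have [i [j [ij Nij]]] : exists i j, (i < j)%N /\ rcoset_of N (X ^+ i) = rcoset_of N (X ^+ j).
  apply: contrapT => noij; apply: infinite_nat.
  have fN : [set: nat] = (fun n => rcoset_of N (X ^+ n)) @^-1` rcosets_of setT N.
    by rewrite eqEsubset; split=> // n _; exists (X ^+ n).
  rewrite fN; apply: finite_preimage (fin_finite N) => i j _ _ Nij.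
  by case: (ltngtP i j) => // ij; case: noij; [exists i, j|exists j, i].
have Nk : (N : set G) (X ^+ (j - i)).
  move: Nij => /esym/(rcoset_of_eq _ _ (fin_subgroup N)).
  by rewrite -{1}(subnK (ltnW ij)) expgnDr mulgK.
apply: (p_cofinal_normal D (fin_normalP N) Nk); apply: (infinite_order (D := D)).
- by rewrite rho_X oner_neq0.
- by rewrite phi_X oner_neq0.
- by rewrite subn_gt0.
Qed.

Lemma lc_pair_word n u v : lc n u -> lc n v -> span2 (lv D n u) (lv D n v) ->
  forall x, lc n x -> exists2 m, (m < p * p)%N & lc n.+1 (x * (pair_word p u v m)^-1).
Proof.
move=> uL vL uv x xL; have [r [s xE]] := uv (lv D n x).
have [rp sp] : (r < p)%N /\ (s < p)%N by split; exact: Fp_lt D _.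
have p0 : (0 < p)%N by exact: leq_ltn_trans rp.
exists (s * p + r)%N.
  apply: leq_trans (_ : s.+1 * p <= _)%N; first by rewrite mulSn addnC ltn_add2r.
  by rewrite leq_mul2r sp orbT.
rewrite /pair_word modnMDl modn_small// divnMDl// divn_small// addn0.
rewrite -[x in x * _]invgK; apply: (lvE (D := D)).
- exact: lcV.
- by apply: lcV; apply: lcM; exact: lcX.
- by rewrite !lvV// ?lvM ?lvX -?scaleFpE ?xE//; try exact: lcX; apply: lcM; exact: lcX.
Qed.

Lemma lc_rank2 i : (0 < i)%N -> exists u v : G, [/\ lc i u, lc i v &
  forall x, lc i x -> exists2 n, (n < p * p)%N & lc i.+1 (x * (pair_word p u v n)^-1)].
Proof.
case: i => [//|[_|i _]].
  exists (gc D), (gb D); split; try exact: lcT.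
  apply: lc_pair_word; try exact: lcT.
  move=> z; have [x xL ->] := lv_surj z.
  by exists (rho x), (phi x); exact: lv1_coord.
have [y uy] := layer_rank2_all D (isT : (1 < i.+2)%N).
have [v vL yE] := lv_surj y.
have uL : lc i.+2 (engel D i.+2) by exact: engel_lc.
exists (engel D i.+2), v; split=> //.
by apply: lc_pair_word => //; rewrite -yE.
Qed.

(** [rho] and [phi] read off the two base p digits of the number of a word. *)
Lemma pair_word_cb_inj m n : (m < p * p)%N -> (n < p * p)%N ->
  lc 2 (pair_word p (gc D) (gb D) m * (pair_word p (gc D) (gb D) n)^-1) -> m = n.
Proof.
move=> mp np mnL; have p0 := prime_gt0 (ggs_prime D).
have rhoE k : rho (pair_word p (gc D) (gb D) k) = k%:R%R.
  rewrite rhoM !rhoX rho_c rho_b mul0rn addr0.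
  by apply/(natFpP D); rewrite modn_mod.
have phiE k : phi (pair_word p (gc D) (gb D) k) = (k %/ p)%:R%R.
  by rewrite phiM !phiX phi_c phi_b mul0rn add0r.
have mod_eq : m %% p = n %% p.
  apply/(natFpP D)/eqP; rewrite -subr_eq0 -!rhoE -rhoV -rhoM.
  by apply/eqP; exact: lc2_rho.
have : (m %/ p) %% p = (n %/ p) %% p.
  apply/(natFpP D)/eqP; rewrite -subr_eq0 -!phiE -phiV -phiM.
  by apply/eqP; exact: lc2_phi.
rewrite !modn_small ?ltn_divLR// => div_eq.
by rewrite (divn_eq m p) (divn_eq n p) mod_eq div_eq.
Qed.

Theorem ggs_completion : pro_p_group p P /\ lower_central_width p P 2.
Proof.
split; first exact: completion_pro_p (ggs_prime D) fin_p_cofinal.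
apply: (@completion_width _ p (ggs_prime D) fin_p_cofinal lc_rank2 (gc D) (gb D)).
exact: pair_word_cb_inj.
Qed.

End GGSCompletion.

(** * Sections of elements of the GGS-group *)

Section GGSGroup.
Variables (p : nat) (p_prime : prime p) (e : 'rV['F_p]_p.-1).
Local Notation H := (ggs_group e).
Local Notation S := [set ggs_a p; ggs_b e].
Implicit Types (g h : H) (x y : 'I_p) (j : 'F_p) (v w : seq 'I_p).

Lemma Fp_ltn j : (j < p)%N.
Proof. by have := ltn_ord j; rewrite [X in (_ < X)%N -> _]Fp_cast. Qed.

Definition letter j : 'I_p := Ordinal (Fp_ltn j).

Lemma letter_nat x : letter x%:R%R = x.
Proof. by apply: val_inj; rewrite /= val_Fp_nat// modn_small. Qed.

Lemma nat_letter j : ((letter j)%:R = j :> 'F_p)%R.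
Proof. exact: natr_Zp. Qed.

Definition act g v : seq 'I_p := tree_fun (set_val g) v.

Lemma actM g h v : act (g * h) v = act h (act g v). Proof. by []. Qed.

Lemma act_inj g h : act g =1 act h -> g = h.
Proof. by move=> gh; apply: val_inj; apply: tree_aut_ext. Qed.

Definition gen_a : H := exist _ (ggs_a p) (mem_set (sub_gen (or_introl erefl : S _))).
Definition gen_b : H := exist _ (ggs_b e) (mem_set (sub_gen (or_intror erefl : S _))).

Lemma act_aX k x v : act (gen_a ^+ k) (x :: v) = letter (x%:R + k%:R)%R :: v.
Proof.
elim: k x => [|k IHk] x; first by rewrite addr0 letter_nat.
rewrite expgS actM [act gen_a _]/= -[act gen_a _]/(ordS x :: v) IHk; congr (letter _ :: _).
have -> : ((ordS x)%:R = x.+1%:R :> 'F_p)%R.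
  by apply: val_inj; rewrite /= !val_Fp_nat//= modn_mod.
by rewrite -natr1 -[in RHS]natr1; ring.
Qed.

Lemma val_expH g k : set_val (g ^+ k) = set_val g ^+ k.
Proof. by elim: k => // k IHk; rewrite !expgS -IHk. Qed.

Lemma act_bX k x v : act (gen_b ^+ k) (x :: v) =
  x :: (if insub (val x) is Some i then act (gen_a ^+ (e 0%R i * k)) v else act (gen_b ^+ k) v).
Proof.
elim: k v => [|k IHk] v; first by case: insubP => //= i _ _; rewrite muln0.
rewrite expgS actM -[act gen_b _]/(ggs_b e (x :: v)) ggs_bE IHk.
case: insubP => // i _ _; rewrite mulnS expgnDr actM.
by rewrite /act !val_expH.
Qed.

(** The generator a moves letters up by 1, so the sign gives its inverse the rotation number 1. The
    sections are required to lie in the group itself. *)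
Definition sections_of g (r : 'F_p) (s : 'F_p -> H) : Prop :=
  act g [::] = [::] /\
  forall j v, act g (letter j :: v) = letter (j - r)%R :: act (s j) v.

Lemma sections_of1 : sections_of 1 0%R (fun=> 1).
Proof. by split=> // j v; rewrite subr0. Qed.

Lemma sections_ofM g h r r' s s' : sections_of g r s -> sections_of h r' s' ->
  sections_of (g * h) (r + r')%R (fun j => s j * s' (j - r)%R).
Proof.
move=> [g0 gE] [h0 hE]; split=> [|j v]; first by rewrite actM g0.
by rewrite actM gE hE opprD addrA.
Qed.

Lemma sections_ofV g r s : sections_of g r s ->
  sections_of g^-1 (- r)%R (fun j => (s (j + r)%R)^-1).
Proof.
move=> [g0 gE]; split=> [|j v].
  by rewrite -{1}g0 -actM mulgV.
have := gE (j + r)%R (act (s (j + r)%R)^-1 v).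
by rewrite addrK -actM mulVg opprK => <-; rewrite -actM mulgV.
Qed.

Lemma sections_of_uniq g r r' s s' : sections_of g r s -> sections_of g r' s' ->
  r = r' /\ s =1 s'.
Proof.
move=> [_ gE] [_ gE']; have E j v := etrans (esym (gE j v)) (gE' j v).
split=> [|j].
  have /(congr1 (fun v => (head (letter 0) v)%:R : 'F_p)%R) := E 0%R [::].
  by rewrite [LHS]nat_letter [RHS]nat_letter !sub0r => /oppr_inj.
by apply: act_inj => v; have /(congr1 behead) := E j v.
Qed.

Lemma sections_of_aX k : sections_of (gen_a ^+ k) (- k%:R)%R (fun=> 1).
Proof.
split=> [|j v]; first by elim: k => // k IHk; rewrite expgS actM.
by rewrite act_aX nat_letter opprK.
Qed.

Lemma sections_of_bX k : sections_of (gen_b ^+ k) 0%R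
  (fun j => if insub (val (letter j)) is Some i then gen_a ^+ (e 0%R i * k) else gen_b ^+ k).
Proof.
split=> [|j v]; first by elim: k => // k IHk; rewrite expgS actM.
by rewrite act_bX subr0; case: insubP.
Qed.

Lemma sections_of_ex g : exists rs : 'F_p * ('F_p -> H), sections_of g rs.1 rs.2.
Proof.
(* [generated] is a set of tree automorphisms, so the property is transported along [set_val]. *)
pose K := [set t | exists2 g : H, set_val g = t &
  exists rs : 'F_p * ('F_p -> H), sections_of g rs.1 rs.2].
suff: K (set_val g) by move=> [h /val_inj <-].
apply: (@gen_min _ S K); last exact: set_valP.
  split=> [|_ _ [h1 <- [[r1 s1] E1]] [h2 <- [[r2 s2] E2]]|_ [h <- [[r s] E]]].
  - exists 1 => //; exists (0%R, fun=> 1); exact: sections_of1.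
  - by exists (h1 * h2) => //; eexists (_, _); exact: sections_ofM E1 E2.
  - by exists h^-1 => //; eexists (_, _); exact: sections_ofV E.
move=> _ [->|->]; [exists gen_a => //|exists gen_b => //].
  by eexists (_, _); have := sections_of_aX 1; rewrite expg1; exact.
by eexists (_, _); have := sections_of_bX 1; rewrite expg1; exact.
Qed.

Definition rot g : 'F_p := (projT1 (cid (sections_of_ex g))).1.
Definition section j g : H := (projT1 (cid (sections_of_ex g))).2 j.

Lemma sectionsP g : sections_of g (rot g) (section^~ g).
Proof. by rewrite /rot /section; case: cid => rs. Qed.

Lemma rotE g r s : sections_of g r s -> rot g = r.
Proof. by move=> gE; have [] := sections_of_uniq (sectionsP g) gE. Qed.

Lemma sectionE g r s j : sections_of g r s -> section j g = s j.
Proof. by move=> gE; have [_] := sections_of_uniq (sectionsP g) gE; apply. Qed.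

Lemma act_level_stab g v : level_stab rot section (size v) g -> act g v = v.
Proof.
elim: v g => [|x v IHv] g /=; first by have [] := sectionsP g.
move=> [g0 gs]; rewrite -[x]letter_nat; have [_ ->] := sectionsP g.
by rewrite g0 subr0 IHv.
Qed.

Lemma exp_a : gen_a ^+ p = 1.
Proof.
apply: act_inj => -[|x v].
  by have [] := sections_of_aX p.
by rewrite act_aX pchar_Fp_0// addr0 letter_nat.
Qed.

Lemma exp_b : gen_b ^+ p = 1.
Proof.
apply: act_inj; elim=> [|x v IHv]; first by have [] := sections_of_bX p.
rewrite act_bX IHv; case: insubP => // i _ _.
by rewrite mulnC expgnA exp_a expg1n.
Qed.

Lemma gen_ab K : is_subgroup K -> K gen_a -> K gen_b -> K = [set: H].
Proof.
move=> [K1 KM KV] Ka Kb; rewrite eqEsubset; split=> // g _.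
suff: [set t | exists2 g : H, set_val g = t & K g] (set_val g) by move=> [h /val_inj <-].
apply: (@gen_min _ S); last exact: set_valP.
  split=> [|_ _ [h1 <- h1K] [h2 <- h2K]|_ [h <- hK]].
  - by exists 1.
  - by exists (h1 * h2) => //; exact: KM.
  - by exists h^-1 => //; exact: KV.
by move=> _ [->|->]; [exists gen_a|exists gen_b].
Qed.

Lemma pred_p_Fp : ((p.-1)%:R = -1 :> 'F_p)%R.
Proof.
by apply/eqP; rewrite -subr_eq0 opprK natr1 prednK ?prime_gt0// pchar_Fp_0.
Qed.

Lemma letter_lt_last j : (letter j < p.-1)%N = (j != -1)%R.
Proof.
have -> : (j == -1)%R = (letter j == p.-1 :> nat).
  apply/eqP/eqP => [->|jE]; last by rewrite -[j]nat_letter jE pred_p_Fp.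
  by rewrite -pred_p_Fp /= val_Fp_nat// modn_small// ltn_predL prime_gt0.
by rewrite ltn_neqAle; have := ltn_ord (letter j); rewrite -{2}[p]prednK ?prime_gt0// ltnS => ->; rewrite andbT.
Qed.

Lemma exp_a_mod k l : (k%:R = l%:R :> 'F_p)%R -> gen_a ^+ k = gen_a ^+ l.
Proof.
move=> kl; apply: act_inj => -[|x v]; first by have [-> _] := sections_of_aX k; have [-> _] := sections_of_aX l.
by rewrite !act_aX kl.
Qed.

Lemma sum_letter (V : zmodType) (f : 'F_p -> option 'I_p.-1 -> V) :
  (\sum_j f j (insub (val (letter j))) = \sum_(i < p.-1) f i%:R (Some i) + f (-1) None)%R.
Proof.
rewrite -pred_p_Fp; pose u k := f k%:R%R (insub k).
transitivity (\sum_(x < p) u x)%R.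
  rewrite (reindex_onto letter (fun x => x%:R%R))/=; last by move=> x _; exact: letter_nat.
  by apply: eq_big => [j|j _]; rewrite ?nat_letter ?eqxx// /u nat_letter.
have -> : (\sum_(x < p) u x = \sum_(x < p.-1.+1) u x)%R by rewrite prednK ?prime_gt0.
rewrite big_ord_recr/=; congr (_ + _)%R; last by rewrite /u insubF ?ltnn.
by apply: eq_bigr => i _; rewrite /u valK.
Qed.

Hypotheses (p_odd : odd p) (FG : FG_type e).
(** With this r the sections of the power of b are a^(r e_i) = c^(e_i / epsilon). In the numbering
    from 1, [F d] is e_d / epsilon, and [F 0] is 0 as it belongs to the last letter. *)
Let r : 'F_p := (- (\sum_(i < p.-1) e 0 i)^-1)%R.
Let F (d : 'F_p) : 'F_p := oapp (fun i => - (r * e 0 i))%R 0%R (insub (val (letter (d - 1)%R))).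

Let c := gen_a^-1.
Let b := gen_b ^+ r.

Lemma ggs_concrete : ggs_data p H.
Proof.
have secc j : section j c = 1.
  by rewrite (sectionE _ (sections_ofV (sections_of_aX 1))) invg1.
have secb j : section j b = if j == (-1)%R then b else c ^+ F (j + 1)%R.
  rewrite (sectionE _ (sections_of_bX r)) /F addrK.
  case: insubP => [i jp _|/=]; last by rewrite letter_lt_last negbK => ->.
  have /negbTE -> : (j != -1)%R by rewrite -letter_lt_last.
  rewrite [oapp _ _ _]/(- (r * e 0 i))%R.
  apply: (mulIg (gen_a ^+ nat_of_ord (- (r * e 0 i))%R)).
  rewrite -expgnDr -expgMn ?mulVg ?expg1n; last by rewrite /commute mulVg mulgV.
  rewrite -[RHS](expg0 gen_a); apply: exp_a_mod.
  by rewrite natrD natrM !natr_Zp mulrC subrr.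
have sumF (f : 'F_p -> 'F_p) : (\sum_d f d * F d = - (r * \sum_(i < p.-1) f i.+1%:R * e 0 i))%R.
  rewrite (reindex_inj (h := fun j => (j + 1)%R))/=; last exact: addIr.
  under eq_bigr do rewrite /F addrK.
  rewrite (sum_letter (fun j o => f (j + 1) * oapp (fun i => - (r * e 0 i)) 0 o)%R)/= mulr0 addr0.
  rewrite mulr_sumr -sumrN; apply: eq_bigr => i _.
  by rewrite natr1; ring.
have [eps0 del0] := FG.
apply: (@GgsData p H p_prime p_odd rot section c b F) => //.
- by move=> g h; rewrite (rotE (sections_ofM (sectionsP g) (sectionsP h))).
- by move=> j g h; rewrite (sectionE _ (sections_ofM (sectionsP g) (sectionsP h))).
- by rewrite (rotE (sections_ofV (sections_of_aX 1))) opprK.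
- by rewrite (rotE (sections_of_bX r)).
- by rewrite /F sub0r insubF// letter_lt_last eqxx.
- apply: gen_ab; first exact: generated_subgroup.
    rewrite -[gen_a]invgK; have [_ _] := generated_subgroup [set c; b].
    by apply; apply: sub_gen; left.
  suff -> : gen_b = b ^+ (r^-1)%R.
    by apply: subgroupX (generated_subgroup _) _; apply: sub_gen; right.
  have r0 : r != 0%R by rewrite oppr_eq0 invr_eq0.
  rewrite /b -expgnA (divn_eq (nat_of_ord r * nat_of_ord r^-1%R)%N p) expgnDr [X in gen_b ^+ X * _]mulnC expgnA exp_b expg1n mul1g.
  have -> : ((nat_of_ord r * nat_of_ord r^-1%R) %% p = 1 %% p)%N.
    by rewrite -!val_Fp_nat// natrM !natr_Zp mulfV.
  by rewrite modn_small ?expg1// prime_gt1.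
- by move=> g gn; apply: act_inj => v; rewrite act_level_stab.
- under eq_bigr do rewrite -[F _]mul1r.
  rewrite (sumF (fun=> 1%R)); under eq_bigr do rewrite mul1r.
  by rewrite /r mulNr opprK mulVf.
- by rewrite (sumF id) oppr_eq0 mulf_neq0// oppr_eq0 invr_eq0.
Qed.
End GGSGroup.

Theorem corollaryB (p : nat) (p_prime : prime p) (p_odd : odd p)
    (e : 'rV['F_p]_p.-1) (e_neq0 : (e != 0)%R) (e_FG : FG_type e) :
  pro_p_group p (profinite_completion (ggs_group e)) /\
  lower_central_width p (profinite_completion (ggs_group e)) 2.
Proof. exact: ggs_completion (ggs_concrete p_prime p_odd e_FG). Qed.
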